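(* Let $k\geq 2$, $\ell_1\geq 3$, $\ell_2\geq 2$ be integers and let $r\geq \max\{\ell_1(\ell_1-2),\ \ell_1+\ell_2+k-1\}$ be an integer. Let $T_{\ell_1}$ be a tree with $\ell_1$ edges which is not the star $S_{\ell_1}$, and let $\ell_{\max}=\max\{\ell_1,\ell_2\}$, $\ell_{\min}=\min\{\ell_1,\ell_2\}$. Then there is a constant $C$ (independent of $n$) such that for all sufficiently large $n$, $$ (\ell_{\min}-1)\left\lfloor\frac{n-k+1}{r-k+2}\right\rfloor\leq {\rm ex}_r(n,{\rm Berge}\text{-}T_{\ell_1}\cup (k-1)S_{\ell_2})\leq \frac{(\ell_{\max}-1)n}{r-k+2}+C. $$
   Context: An $r$-graph is a hypergraph whose hyperedges are distinct $r$-element subsets of the vertex set. For a graph $F$, an $r$-graph $H$ is a Berge-$F$ if there is a bijection $\phi:E(F)\to E(H)$ with $e\subseteq\phi(e)$ for each $e\in E(F)$; an $r$-graph contains a Berge-$F$ if some subhypergraph is a Berge-$F$. ${\rm ex}_r(n,{\rm Berge}\text{-}F)$ is the maximum number of hyperedges in an $n$-vertex $r$-graph containing no Berge-$F$. $S_m$ is the star with $m$ edges; $\cup$ is vertex-disjoint union and $cG$ is the disjoint union of $c$ copies of $G$. *)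

(* Defs.v *)
From HB Require Import structures.
From mathcomp Require Import all_boot all_order all_algebra.

Set Implicit Arguments.
Unset Strict Implicit.
Unset Printing Implicit Defensive.

Record sgraph := SGraph {
  svertex :> finType;
  sadj : rel svertex;
  sadj_sym : symmetric sadj;
  sadj_irrefl : irreflexive sadj
}.

Definition sedges (G : sgraph) : {set {set G}} :=
  [set [set x; y] | x in [set: G], y in [set: G] & sadj x y].

Definition isomorphic (G H : sgraph) : Prop :=
  exists f : G -> H, bijective f /\ forall x y, sadj (f x) (f y) = sadj x y.

Definition connected (G : sgraph) : Prop :=
  0 < #|G| /\ forall x y : G, connect (@sadj G) x y.

Definition acyclic (G : sgraph) : Prop :=
  forall c : seq G, 2 < size c -> ~~ (cycle (@sadj G) c && uniq c).

Definition is_tree (G : sgraph) : Prop := connected G /\ acyclic G.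

(* [None] is the centre of the star, the [Some i] are its [m] leaves. *)
Definition star_adj (m : nat) : rel (option 'I_m) :=
  fun x y => (x == None) (+) (y == None).

Lemma star_adj_sym m : symmetric (@star_adj m).
Proof. by move=> x y; rewrite /star_adj addbC. Qed.

Lemma star_adj_irrefl m : irreflexive (@star_adj m).
Proof. by move=> x; rewrite /star_adj addbb. Qed.

Definition star (m : nat) : sgraph :=
  SGraph (@star_adj_sym m) (@star_adj_irrefl m).

Definition dunion_adj (G H : sgraph) : rel (G + H)%type :=
  fun x y => match x, y with
             | inl a, inl b => sadj a b
             | inr a, inr b => sadj a b
             | _, _ => false
             end.

Lemma dunion_adj_sym G H : symmetric (@dunion_adj G H).
Proof. by case=> a [] b //=; rewrite sadj_sym. Qed.

Lemma dunion_adj_irrefl G H : irreflexive (@dunion_adj G H).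
Proof. by case=> a /=; rewrite sadj_irrefl. Qed.

Definition dunion (G H : sgraph) : sgraph :=
  SGraph (@dunion_adj_sym G H) (@dunion_adj_irrefl G H).

Definition copies_adj (c : nat) (G : sgraph) : rel ('I_c * G)%type :=
  fun x y => (x.1 == y.1) && sadj x.2 y.2.

Lemma copies_adj_sym c G : symmetric (@copies_adj c G).
Proof. by move=> x y; rewrite /copies_adj eq_sym sadj_sym. Qed.

Lemma copies_adj_irrefl c G : irreflexive (@copies_adj c G).
Proof. by move=> x; rewrite /copies_adj sadj_irrefl andbF. Qed.

Definition copies (c : nat) (G : sgraph) : sgraph :=
  SGraph (@copies_adj_sym c G) (@copies_adj_irrefl c G).

(* A hypergraph on [V] is given by its set of hyperedges. *)
Definition uniform (V : finType) (r : nat) (H : {set {set V}}) : bool :=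
  [forall h in H, #|h| == r].

(* [f] places the vertices of [F] among those of the hypergraph; [phi] is only
   relevant on [sedges F], where it is a bijection onto [H]. *)
Definition is_berge (F : sgraph) (V : finType) (H : {set {set V}}) : bool :=
  [exists f : {ffun F -> V}, exists phi : {ffun {set F} -> {set V}},
    [&& injectiveb f,
        dinjectiveb phi (mem (sedges F)),
        phi @: sedges F == H
      & [forall e in sedges F, f @: e \subset phi e]]].

Definition contains_berge (F : sgraph) (V : finType) (H : {set {set V}}) :
    bool :=
  [exists H' : {set {set V}}, (H' \subset H) && is_berge F H'].

Definition ex_berge (r n : nat) (F : sgraph) : nat :=
  \max_(H : {set {set 'I_n}} | uniform r H && ~~ contains_berge F H) #|H|.

(* Main.v *)
(* Upper bound. Let [A] be the set of vertices of very large degree; a star can be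
   completed greedily at any vertex of [A], so it suffices to embed the tree with
   its non-leaves missing [k - 1] vertices of [A].  If [A] is large, or if many
   vertices outside [A] have degree at least [l2], the stars can always be placed
   away from the tree, so the hypergraph has no Berge copy of the tree alone and a
   weighting argument (every vertex contributes at most [l1 - 1]) applies.
   Otherwise, after deleting boundedly many hyperedges, all degrees outside [A]
   are at most [l2 - 1].  If there are more hyperedges than claimed, a minimal
   overfull pair (vertex set, edge set) outside [A] has large minimum degree and
   satisfies Hall's condition, so tree branches embed in it greedily; robustly
   many such pairs share the same few vertices [B] of [A], where the branches are
   joined, and enough of [A] is left over for the centres of the stars.

   Lower bound. Fix [k - 1] vertices, cut the rest into blocks of size
   [r - k + 2], and take as hyperedges the fixed vertices plus a block minus one
   of its points, [min(l1, l2) - 1] times per block.  One of the [k] components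
   misses the fixed vertices and hence lies in a single block, which has too few
   hyperedges. *)
Require Import Defs.
From Stdlib Require Import Classical.
From HB Require Import structures.
From mathcomp Require Import all_boot all_order all_algebra zify.
Import Order.TTheory GRing.Theory Num.Theory.

Set Implicit Arguments.
Unset Strict Implicit.
Unset Printing Implicit Defensive.

(** * Matchings and overfull pairs *)

(* [#|U|] for [U : {set {set V}}] elaborates to convertible but syntactically
   different terms, which [lia] would treat as distinct atoms. *)
Ltac arith_only :=
  repeat match goal with
         | H : is_true (leq _ _) |- _ => revert H
         | H : is_true (leq _ _ && leq _ _) |- _ => revert H
         | H : is_true (negb (@eq_op _ _ _)) |- _ => revert H
         | H : @eq ?T ?a ?b |- _ => unify T nat; change (@eq nat a b) in H; revert H
         | H : not (@eq ?T ?a ?b) |- _ =>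
           unify T nat; change (not (@eq nat a b)) in H; revert H
         end;
  repeat match goal with
         | |- context [@card.body ?T ?A] =>
           let c := fresh "c" in set c := (@card.body T A); clearbody c
         end;
  clear; intros.
Ltac slia := arith_only; lia.

(** Before the final theorem [k] counts the stars, so the denominator of the bound reads
    [(r - k).+1]. Density is measured by overfull pairs: vertices [X] and hyperedges [Y] with more
    incidences than a threshold [a] per vertex plus an offset per hyperedge. Minimality turns the
    threshold into minimum degree and the offset into Hall's condition, so that every new hyperedge
    brings its own new vertex. The obstacle without the stars is that [l - 1] hyperedges on few
    common vertices contain no tree and are as dense as the bound allows. An overfull pair therefore
    only forces such a cluster, which is split off; the weight [minn l.-1 (2 * degree)] is designed
    to add up under this splitting. With the stars, the obstacle is that for [k + q] vertices in [A]
    a hyperedge may keep only [r - k - q] vertices outside. The hypothesis [l * (l - 2) <= r] enters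
    as [l.-1 ^ 2 <= r.+1] for tree-free hypergraphs, and in the comparison [weight_ineq_excess]. *)

Lemma exists_inj_on (I J : finType) (j0 : J) (S : {set I}) (B : {set J}) :
  #|S| <= #|B| ->
  exists f : I -> J, {in S &, injective f} /\ forall i, i \in S -> f i \in B.
Proof.
move=> le_SB.
exists (fun i => nth j0 (enum B) (index i (enum S))); split=> [i i' Si Si'|i Si].
  have lt x : x \in S -> index x (enum S) < size (enum B).
    by move=> Sx; rewrite -cardE (leq_trans _ le_SB) // cardE index_mem mem_enum.
  move/eqP; rewrite nth_uniq ?enum_uniq ?lt // => /eqP eq_i.
  by rewrite -[LHS](@nth_index _ i i (enum S)) ?mem_enum // eq_i nth_index ?mem_enum.
by rewrite -mem_enum mem_nth // -cardE (leq_trans _ le_SB) // cardE index_mem mem_enum.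
Qed.

Lemma leq_cardsD (J : finType) (B W : {set J}) : #|B| - #|W| <= #|B :\: W|.
Proof. by rewrite cardsD leq_sub2l // subset_leq_card // subsetIr. Qed.

Lemma pick_notin (J : finType) (B W : {set J}) :
  #|W| < #|B| -> exists2 v, v \in B & v \notin W.
Proof.
move=> lt; have /set0Pn[v]: B :\: W != set0.
  by rewrite -card_gt0 (leq_trans _ (leq_cardsD _ _)) // subn_gt0.
by rewrite inE => /andP[nW vB]; exists v.
Qed.

Lemma sub_of_card (J : finType) (S B : {set J}) (n : nat) :
  S \subset B -> #|S| <= n -> n <= #|B| ->
  exists2 Q : {set J}, S \subset Q & (Q \subset B) && (#|Q| == n).
Proof.
move=> sSB; elim: n => [|n IH] leS leB.
  exists S => //; rewrite sSB /=; lia.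
case: (leqP #|S| n) => [leSn|ltS]; last by exists S => //; rewrite sSB /=; lia.
have [Q sSQ /andP[sQB /eqP cQ]] := IH leSn (ltnW leB).
have [v vB vQ] : exists2 v, v \in B & v \notin Q by apply: pick_notin; rewrite cQ.
exists (v |: Q); first by rewrite (subset_trans sSQ) ?subsetUr.
by rewrite subUset sub1set vB sQB cardsU1 vQ cQ /=.
Qed.

Lemma greedy_pairs (I : finType) (V W : finType) (v0 : V) (w0 : W)
    (R : I -> V -> W -> bool) (V0 : {set V}) (W0 : {set W}) :
  (forall i (Vu : {set V}) (Wu : {set W}),
     #|Vu| <= #|V0| + #|I| -> #|Wu| <= #|W0| + #|I| ->
     V0 \subset Vu -> W0 \subset Wu ->
     exists v w, [/\ R i v w, v \notin Vu & w \notin Wu]) ->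
  exists (f : I -> V) (g : I -> W),
    [/\ injective f, injective g, forall i, R i (f i) (g i),
        forall i, f i \notin V0 & forall i, g i \notin W0].
Proof.
move=> step.
suff [f [g [fi gi H]]] : exists (f : I -> V) (g : I -> W),
    [/\ {in enum I &, injective f}, {in enum I &, injective g}
      & forall i, i \in enum I -> [/\ R i (f i) (g i), f i \notin V0 & g i \notin W0]].
  exists f, g; split.
  - by move=> i j; apply: fi; rewrite mem_enum.
  - by move=> i j; apply: gi; rewrite mem_enum.
  - by move=> i; have [|] := H i; rewrite ?mem_enum.
  - by move=> i; have [|] := H i; rewrite ?mem_enum.
  - by move=> i; have [|] := H i; rewrite ?mem_enum.
have: uniq (enum I) by exact: enum_uniq.
have: size (enum I) <= #|I| by rewrite cardE.
elim: (enum I) => [|i s IH] /= les us; first by exists (fun=> v0), (fun=> w0); split.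
have /andP[ns us'] := us.
have [f [g [fi gi H]]] := IH (ltnW les) us'.
pose Vu := V0 :|: [set x in map f s]; pose Wu := W0 :|: [set x in map g s].
have cmap (U : finType) (h : I -> U) (S0 : {set U}) :
    #|S0 :|: [set x in map h s]| <= #|S0| + #|I|.
  apply: leq_trans (leq_card_setU _ _) _; rewrite leq_add2l cardsE.
  by apply: leq_trans (card_size _) _; rewrite size_map ltnW.
have [v [w [Rvw nv nw]]] := step i Vu Wu (cmap _ f V0) (cmap _ g W0) (subsetUl _ _) (subsetUl _ _).
move: nv nw; rewrite !inE !negb_or => /andP[nv0 nv] /andP[nw0 nw].
have ne j : j \in s -> (j == i) = false by apply: contraTF => /eqP->.
exists (fun j => if j == i then v else f j), (fun j => if j == i then w else g j); split.
- move=> j j'; rewrite !inE => /predU1P[->|js] /predU1P[->|js'] //; rewrite ?eqxx ?ne //.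
  + by move=> E; case/negP: nv; rewrite E map_f.
  + by move=> E; case/negP: nv; rewrite -E map_f.
  + exact: fi.
- move=> j j'; rewrite !inE => /predU1P[->|js] /predU1P[->|js'] //; rewrite ?eqxx ?ne //.
  + by move=> E; case/negP: nw; rewrite E map_f.
  + by move=> E; case/negP: nw; rewrite -E map_f.
  + exact: gi.
- by move=> j; rewrite inE => /predU1P[->|js]; rewrite ?eqxx ?ne //; apply: H.
Qed.

Section Hall.
Variables (S T : finType) (t0 : T).
Implicit Types (N : S -> {set T}) (Y Z : {set S}).

(** Induction on [#|Y|]. A tight proper nonempty subset is matched first, and the rest outside its
    neighbourhood. Without one, any [y] may take any [t] in [N y]: strictness absorbs the loss of
    [t]. *)
Lemma hall_marriage N Y :
  (forall Z, Z \subset Y -> #|Z| <= #|\bigcup_(y in Z) N y|) ->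
  exists mu : S -> T, {in Y &, injective mu} /\ forall y, y \in Y -> mu y \in N y.
Proof.
have [n] := ubnP #|Y|; elim: n N Y => // n IH N Y /ltnSE leY hall.
case: (set_0Vmem Y) => [->|[y yY]].
  by exists (fun=> t0); split=> [x y|x]; rewrite inE.
case: (boolP [exists Z : {set S}, [&& Z \proper Y, Z != set0 &
               #|\bigcup_(z in Z) N z| <= #|Z|]]).
  case/existsP=> Z /and3P[prZ nZ tight].
  have [sZY ltZ] := (proper_sub prZ, proper_card prZ).
  have [mu1 [inj1 in1]] : exists mu : S -> T,
      {in Z &, injective mu} /\ forall y, y \in Z -> mu y \in N y.
    apply: IH => [|W sWZ]; first exact: leq_trans ltZ leY.
    by apply: hall; apply: subset_trans sWZ sZY.
  pose NZ := \bigcup_(z in Z) N z.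
  have [mu2 [inj2 in2]] : exists mu : S -> T, {in Y :\: Z &, injective mu}
      /\ forall y, y \in Y :\: Z -> mu y \in N y :\: NZ.
    apply: (IH (fun y => N y :\: NZ)) => [|W sW].
      rewrite cardsD (setIidPr sZY); move: nZ; rewrite -card_gt0; lia.
    have dWZ : #|W :|: Z| = #|W| + #|Z|.
      rewrite cardsU; suff -> : W :&: Z = set0 by rewrite cards0 subn0.
      apply/setP=> x; rewrite !inE; apply/negbTE/negP=> /andP[xW xZ].
      by move/subsetP/(_ x xW): sW; rewrite inE xZ.
    have := hall (W :|: Z).
    rewrite subUset sZY (subset_trans sW (subsetDl _ _)) dWZ => /(_ isT) le1.
    have sub : \bigcup_(x in W :|: Z) N x \subset
               \bigcup_(x in W) (N x :\: NZ) :|: NZ.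
      apply/bigcupsP=> x; rewrite in_setU => xWZ; apply/subsetP=> t tN; rewrite in_setU.
      case: (boolP (t \in NZ)) => [//|ntN]; first by rewrite orbT.
      rewrite orbF; case/orP: xWZ => [xW|xZ].
        by apply/bigcupP; exists x => //; rewrite inE ntN.
      by case/negP: ntN; apply/bigcupP; exists x.
    have := leq_trans (subset_leq_card sub) (leq_card_setU _ _).
    move: tight le1; rewrite -/NZ; lia.
  exists (fun x => if x \in Z then mu1 x else mu2 x); split.
  - move=> a b aY bY; case: ifP => aZ; case: ifP => bZ.
    + exact: inj1.
    + have := in2 b; rewrite !inE bZ bY => /(_ isT)/andP[nb _] E.
      by case/negP: nb; rewrite -E; apply/bigcupP; exists a => //; apply: in1.
    + have := in2 a; rewrite !inE aZ aY => /(_ isT)/andP[nb _] E.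
      by case/negP: nb; rewrite E; apply/bigcupP; exists b => //; apply: in1.
    + by apply: inj2; rewrite inE ?aZ ?bZ.
  - move=> a aY; case: ifP => aZ; first exact: in1.
    by have := in2 a; rewrite !inE aZ aY => /(_ isT)/andP[].
move/existsPn=> strict.
have [t tN] : exists t, t \in N y.
  have := hall [set y]; rewrite sub1set yY cards1 big_set1 => /(_ isT).
  by rewrite card_gt0 => /set0Pn.
have [mu [injmu inmu]] : exists mu : S -> T, {in Y :\ y &, injective mu}
      /\ forall x, x \in Y :\ y -> mu x \in N x :\ t.
  apply: (IH (fun x => N x :\ t)) => [|W sW].
    by move: leY; rewrite (cardsD1 y Y) yY.
  case: (eqVneq W set0) => [->|nW]; first by rewrite cards0.
  have prW : W \proper Y.
    apply: sub_proper_trans sW _; apply/properP; split; first exact: subD1set.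
    by exists y => //; rewrite !inE eqxx.
  have := strict W; rewrite prW nW /= -ltnNge => lt.
  have sub : \bigcup_(x in W) N x \subset t |: \bigcup_(x in W) (N x :\ t).
    apply/bigcupsP=> x xW; apply/subsetP=> u uN; rewrite in_setU1.
    by case: eqVneq => //= ne; apply/bigcupP; exists x; rewrite // !inE ne.
  have := subset_leq_card sub; rewrite cardsU1.
  by move: lt; case: (t \notin _); lia.
exists (fun x => if x == y then t else mu x); split.
- move=> a b aY bY; case: (eqVneq a y) => [->|ay]; case: (eqVneq b y) => [->|bY'] //.
  + by move=> E; have := inmu b; rewrite !inE bY' bY -E eqxx => /(_ isT).
  + by move=> E; have := inmu a; rewrite !inE ay aY E eqxx => /(_ isT).
  + by apply: injmu; rewrite !inE ?ay ?bY'.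
- move=> a aY; case: (eqVneq a y) => [->//|ay].
  by have := inmu a; rewrite !inE ay aY => /(_ isT)/andP[].
Qed.

End Hall.

Lemma greedy_sdr (I W : finType) (w0 : W) (S : I -> {set W}) (W0 : {set W}) :
  (forall i, #|W0| + #|I| <= #|S i|) ->
  exists g : I -> W,
    [/\ injective g, forall i, g i \in S i & forall i, g i \notin W0].
Proof.
move=> le.
have [Z _|g [gi gS]] := @hall_marriage I W w0 (fun i => S i :\: W0) setT.
  case: (set_0Vmem Z) => [->|[i iZ]]; first by rewrite cards0.
  apply: leq_trans (max_card _) _.
  apply: (@leq_trans #|S i :\: W0|); last by apply/subset_leq_card/(bigcup_sup i).
  by apply: leq_trans (leq_cardsD _ _); move: (le i); lia.
have H i : g i \in S i :\: W0 by apply: gS; rewrite inE.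
exists g; split=> [i j||]; first by apply: gi; rewrite inE.
- by move=> i; move: (H i); rewrite inE => /andP[].
- by move=> i; move: (H i); rewrite inE => /andP[].
Qed.

(** * Incidence counts and minimal overfull pairs *)

Section Core.
Variable V : finType.
Implicit Types (O X W : {set V}) (E Y Z : {set {set V}}).

Definition inc E (v : V) : {set {set V}} := [set h in E | v \in h].

Lemma inc_sub E v : inc E v \subset E.
Proof. by apply/subsetP=> h; rewrite inE => /andP[]. Qed.

Lemma mem_inc E v h : (h \in inc E v) = (h \in E) && (v \in h).
Proof. by rewrite inE. Qed.

Lemma incS E Y v : Y \subset E -> inc Y v \subset inc E v.
Proof. by move=> s; apply/subsetP=> h; rewrite !inE => /andP[/(subsetP s)-> ->]. Qed.

Lemma sum_inc E O : \sum_(h in E) #|h :&: O| = \sum_(v in O) #|inc E v|.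
Proof.
under eq_bigr do rewrite -sum1_card.
under [RHS]eq_bigr do rewrite -sum1_card.
rewrite (exchange_big_dep (mem O)) /=; last by move=> h v _; rewrite inE => /andP[].
apply: eq_bigr => v vO; apply: eq_bigl => h; rewrite !inE vO.
by rewrite andbT.
Qed.

(** The offset of [h] is the fraction [c h / w]; multiplying by [w] keeps everything in [nat]. *)
Definition overfull (c : {set V} -> nat) (w a : nat) X Y :=
  w * a * #|X| + \sum_(h in Y) c h < w * \sum_(h in Y) #|h :&: X|.

Definition min_overfull c w a X Y := overfull c w a X Y /\
  forall X' Y', X' \subset X -> Y' \subset Y -> overfull c w a X' Y' ->
    X' = X /\ Y' = Y.

Lemma min_overfull_exists c w a O E : overfull c w a O E ->
  exists X Y, [/\ X \subset O, Y \subset E & min_overfull c w a X Y].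
Proof.
move=> ov.
pose ok (p : {set V} * {set {set V}}) :=
  [&& p.1 \subset O, p.2 \subset E & overfull c w a p.1 p.2].
have ok0 : ok (O, E) by rewrite /ok /= !subxx ov.
case: (arg_minnP (fun p : {set V} * {set {set V}} => #|p.1| + #|p.2|) ok0).
move=> [X Y] /and3P[/= sX sY ovX] minp.
exists X, Y; split=> //; split=> // X' Y' sX' sY' ov'.
have := minp (X', Y'); rewrite /ok /= (subset_trans sX' sX) (subset_trans sY' sY) ov'.
move=> /(_ isT) /= le.
have := subset_leq_card sX'; have := subset_leq_card sY'.
move=> leY leX; split; apply/eqP; rewrite eqEcard ?sX' ?sY' /=.
  by rewrite -(leq_add2r #|Y|); apply: leq_trans le _; rewrite leq_add2l.
by rewrite -(leq_add2l #|X|); apply: leq_trans le _; rewrite leq_add2r.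
Qed.

Section Min.
Variables (c : {set V} -> nat) (w a : nat) (X : {set V}) (Y : {set {set V}}).
Hypothesis mXY : min_overfull c w a X Y.

(** Dropping [v] lowers the left side by [w * a] and the right side by [w] times the degree of
    [v]. *)
Lemma min_overfull_deg v : v \in X -> a < #|inc Y v|.
Proof.
move=> vX; rewrite ltnNge; apply/negP=> le.
have [ov minXY] := mXY.
have [] := minXY (X :\ v) Y (subD1set _ _) (subxx _); last first.
  by move/setP/(_ v); rewrite !inE eqxx vX.
move: ov; rewrite /overfull !sum_inc (cardsD1 v X) vX.
rewrite [\sum_(v in X) _](big_setD1 v vX) /= add1n.
move: le; move: #|inc Y v| #|X :\ v| (\sum_(h in Y) c h) (\sum_(i in X :\ v) _).
by move=> d m C S le; rewrite mulnDr mulnS => ov; have: w * d <= w * a; nia.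
Qed.

Lemma min_overfull_edge h : h \in Y -> c h < w * #|h :&: X|.
Proof.
move=> hY; rewrite ltnNge; apply/negP=> le.
have [ov minXY] := mXY.
have [] := minXY X (Y :\ h) (subxx _) (subD1set _ _); last first.
  by move=> _ /setP/(_ h); rewrite !inE eqxx hY.
move: ov; rewrite /overfull (big_setD1 h hY) /= [X in _ < w * X](big_setD1 h hY) /=.
by rewrite mulnDr; move: le; lia.
Qed.

(** If [Z] had a set [N] of at most [#|Z|] neighbours, deleting [Z] and [N] together would cost at
    most [(a + j) * #|N|] incidences, while the budget drops by [a * #|N| + j * #|Z|], which is no
    less. A smaller overfull pair would remain. *)
Lemma min_overfull_hall j Z :
  (forall v, v \in X -> #|inc Y v| <= a + j) ->
  (forall h, h \in Y -> w * j <= c h) ->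
  Z \subset Y -> Z != set0 -> #|Z| < #|\bigcup_(h in Z) (h :&: X)|.
Proof.
move=> Delta cj sZ nZ; rewrite ltnNge; apply/negP=> le.
have [ov minXY] := mXY.
set N := \bigcup_(h in Z) _ in le.
have sN : N \subset X by apply/bigcupsP=> h _; apply: subsetIr.
have [] := minXY (X :\: N) (Y :\: Z) (subsetDl _ _) (subsetDl _ _); last first.
  move=> _ eqY; have [h hZ] := set0Pn _ nZ.
  by have := subsetP sZ h hZ; rewrite -eqY inE hZ.
have e1 : \sum_(v in X) #|inc Y v| <=
          (a + j) * #|N| + \sum_(v in X :\: N) #|inc (Y :\: Z) v|.
  rewrite (big_setID N) /= (setIidPr sN); apply: leq_add.
    rewrite mulnC -sum_nat_const; apply: leq_sum => v vN.
    by apply: Delta; apply: (subsetP sN).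
  apply: leq_sum => v; rewrite inE => /andP[nv vX]; apply: subset_leq_card.
  apply/subsetP=> h; rewrite !inE => /andP[hY vh]; rewrite hY vh !andbT.
  by apply: contra nv => hZ; apply/bigcupP; exists h; rewrite // inE vh.
have e2 : w * j * #|Z| + \sum_(h in Y :\: Z) c h <= \sum_(h in Y) c h.
  rewrite [X in _ <= X](big_setID Z) /= (setIidPr sZ) leq_add2r.
  rewrite mulnC -sum_nat_const; apply: leq_sum => h hZ; apply: cj.
  exact: (subsetP sZ).
have cX : #|X| = #|N| + #|X :\: N| by rewrite -(cardsID N X) (setIidPr sN).
move: ov; rewrite /overfull !sum_inc cX.
set S1 := \sum_(v in X) _ in e1 *; set S2 := \sum_(v in _ :\: N) _ in e1 *.
set C1 := \sum_(h in Y) _ in e2 *; set C2 := \sum_(h in _ :\: Z) _ in e2 *.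
move=> ov.
have h1 : w * S1 <= w * ((a + j) * #|N| + S2) by rewrite leq_mul2l e1 orbT.
have h2 : w * j * #|N| <= w * j * #|Z| by rewrite leq_mul2l le orbT.
move: ov h1 h2 e2; rewrite !mulnDr !mulnDl ?mulnDr -?mulnA; lia.
Qed.

(** Hall's condition holds with one element to spare, which pays for keeping [v0] free as the root
    of an embedding. *)
Lemma min_overfull_matching j v0 :
  (forall v, v \in X -> #|inc Y v| <= a + j) ->
  (forall h, h \in Y -> w * j <= c h) ->
  exists mu : {set V} -> V, {in Y &, injective mu} /\
    forall h, h \in Y -> [/\ mu h \in h, mu h \in X & mu h != v0].
Proof.
move=> Delta cj.
have [|mu [imu hmu]] := @hall_marriage _ V v0 (fun h => (h :&: X) :\ v0) Y.
  move=> Z sZ; case: (eqVneq Z set0) => [->|nZ]; first by rewrite cards0.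
  have := min_overfull_hall Delta cj sZ nZ.
  have sub : \bigcup_(h in Z) (h :&: X) \subset
             v0 |: \bigcup_(h in Z) ((h :&: X) :\ v0).
    apply/bigcupsP=> h hZ; apply/subsetP=> u uN; rewrite in_setU1.
    by case: eqVneq => //= ne; apply/bigcupP; exists h; rewrite // in_setD1 ne.
  move=> lt; rewrite -ltnS; apply: leq_trans lt (leq_trans (subset_leq_card sub) _).
  by rewrite cardsU1 -add1n leq_add2r leq_b1.
exists mu; split=> // h hY; have := hmu h hY.
by rewrite !inE => /and3P[-> -> ->].
Qed.

End Min.
End Core.

(** * Embeddings of indexed trees *)

Section IndexTree.
Variables (par : nat -> nat) (l : nat).

(** The tree edges are indexed by [1, ..., l]: edge [i] joins [i] to [par i]. *)
Definition itree := forall i, 0 < i <= l -> par i < i.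

(** Having a child. The root is internal even when its degree is one. *)
Definition internal i := has (fun j => par j == i) (iota 1 l).

Lemma internalP i :
  reflect (exists2 j, 0 < j <= l & par j = i) (internal i).
Proof.
apply: (iffP hasP) => [[j]|[j lj <-]].
  by rewrite mem_iota => lj /eqP pj; exists j => //; lia.
by exists j; rewrite ?mem_iota //; lia.
Qed.

Lemma internal_par i : 0 < i <= l -> internal (par i).
Proof. by move=> li; apply/internalP; exists i. Qed.

Lemma internal_lt i : itree -> internal i -> i < l.
Proof. by move=> it /internalP[j lj <-]; have := it j lj; lia. Qed.

(** A Berge copy whose leaves are not placed yet: [phi i] is the hyperedge of tree edge [i], and [g]
    is constrained on internal indices only. Leaves are supplied by [wemb_full]. *)
Record wemb (V : finType) (E : {set {set V}}) (O : {set V})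
    (g : nat -> V) (phi : nat -> {set V}) : Prop := WEmb {
  wemb_edge : forall i, 0 < i <= l -> phi i \in E;
  wemb_phi_inj : forall i j, 0 < i <= l -> 0 < j <= l -> phi i = phi j -> i = j;
  wemb_par : forall i, 0 < i <= l -> g (par i) \in phi i;
  wemb_int : forall i, 0 < i <= l -> internal i -> g i \in phi i;
  wemb_in : forall i, internal i -> g i \in O;
  wemb_inj : forall i j, internal i -> internal j -> g i = g j -> i = j
}.

Lemma wembS (V : finType) (E E' : {set {set V}}) (O O' : {set V}) g phi :
  E \subset E' -> O \subset O' -> wemb E O g phi -> wemb E' O' g phi.
Proof.
move=> sE sO [hE hi hp hint hO hg]; split=> //.
  by move=> i /hE; apply: (subsetP sE).
by move=> i /hO; apply: (subsetP sO).
Qed.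

(** * Greedy embedding of a part of an index tree *)

Section Greedy.
Variables (V : finType) (J : pred nat) (s : nat).
Variables (X : {set V}) (Y U0 : {set {set V}}).
Variable P : {set V} -> {set {set V}} -> Prop.
Hypothesis hJ : forall i, i <= l -> J i -> i != s -> par i < i /\ J (par i).

Definition upd (A : Type) (f : nat -> A) i a := fun j => if j == i then a else f j.

(** State once the indices of [J] below [i] are placed. [s] is the root of the part [J] and gets no
    hyperedge here; [U] and [W] are the hyperedges and vertices spent, [U0] the hyperedges barred
    from the start, and [P] an invariant that guarantees new vertices. *)
Record gstate i (g : nat -> V) (phi : nat -> {set V})
    (U : {set {set V}}) (W : {set V}) : Prop := GState {
  gs_edge : forall j, j < i -> J j -> j != s ->
    [/\ phi j \in Y, phi j \in U, phi j \notin U0 & g (par j) \in phi j];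
  gs_int : forall j, j < i -> J j -> j != s -> internal j -> g j \in phi j;
  gs_phi_inj : forall j j', j < i -> j' < i -> J j -> J j' -> j != s -> j' != s ->
    phi j = phi j' -> j = j';
  gs_vtx : forall j, j < i -> J j -> internal j -> g j \in X /\ g j \in W;
  gs_inj : forall j j', j < i -> j' < i -> J j -> J j' -> internal j ->
    internal j' -> g j = g j' -> j = j';
  gs_P : P W U;
  gs_U0 : U0 \subset U;
  gs_cardU : #|U| <= #|U0| + count (fun j => J j && (j != s)) (iota 0 i);
  gs_cardW : #|W| <= (count (fun j => [&& J j, j != s & internal j]) (iota 0 i)).+1
}.

Lemma gstate_start v0 (g : nat -> V) (phi : nat -> {set V}) :
  (forall j, j < s -> ~~ J j) -> v0 \in X -> g s = v0 ->
  P [set v0] U0 -> gstate s.+1 g phi U0 [set v0].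
Proof.
move=> Js v0X gs P0.
have only j : j < s.+1 -> J j -> j = s.
  rewrite ltnS leq_eqVlt => /predU1P[//|/Js/negbTE->//].
split=> //.
- by move=> j lj Jj; rewrite (only j lj Jj) eqxx.
- by move=> j lj Jj; rewrite (only j lj Jj) eqxx.
- by move=> j j' lj lj' Jj Jj' _ _ _; rewrite (only j) // (only j').
- by move=> j lj Jj _; rewrite (only j lj Jj) gs inE eqxx.
- by move=> j j' lj lj' Jj Jj' _ _ _; rewrite (only j) // (only j').
- exact: leq_addr.
- by rewrite cards1.
Qed.

Lemma gstate_skip i g phi U W : ~~ J i -> gstate i g phi U W ->
  gstate i.+1 g phi U W.
Proof.
move=> nJ [h1 h2 h3 h4 h5 h6 h7 h8 h9].
have lt j : j < i.+1 -> J j -> j < i.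
  by rewrite ltnS leq_eqVlt => /predU1P[->|//]; rewrite (negbTE nJ).
split=> //.
- by move=> j lj Jj; apply: h1 => //; apply: lt.
- by move=> j lj Jj; apply: h2 => //; apply: lt.
- by move=> j j' lj lj' Jj Jj'; apply: h3 => //; apply: lt.
- by move=> j lj Jj; apply: h4 => //; apply: lt.
- by move=> j j' lj lj' Jj Jj'; apply: h5 => //; apply: lt.
- by rewrite -[i.+1]addn1 iotaD count_cat (leq_trans h8) // addnA leq_addr.
- by rewrite -[i.+1]addn1 iotaD count_cat (leq_trans h9) // -addSn leq_addr.
Qed.

Lemma gstate_step i g phi U W f v :
  gstate i g phi U W -> i <= l -> J i -> i != s ->
  f \in Y -> f \notin U -> g (par i) \in f ->
  (internal i -> [/\ v \in f, v \in X & v \notin W]) ->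
  P (if internal i then v |: W else W) (f |: U) ->
  gstate i.+1 (upd g i v) (upd phi i f) (f |: U)
    (if internal i then v |: W else W).
Proof.
move=> [h1 h2 h3 h4 h5 h6 h7 h8 h9] il Ji ins fY fU gf hv hP.
have ltE j : j < i.+1 -> j = i \/ j < i /\ j != i.
  by rewrite ltnS leq_eqVlt => /predU1P[->|lj]; [left|right; rewrite lj neq_ltn lj].
have pE j : j <= i -> J j -> j != s -> par j == i = false.
  by move=> lj Jj js; have [] := hJ (leq_trans lj il) Jj js; lia.
have up A (F : nat -> A) a : upd F i a i = a by rewrite /upd eqxx.
have un A (F : nat -> A) a j : j != i -> upd F i a j = F j.
  by rewrite /upd => /negbTE->.
have upar A (F : nat -> A) a j : j <= i -> J j -> j != s -> upd F i a (par j) = F (par j).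
  by move=> lj Jj js; rewrite /upd pE.
split=> //.
- move=> j /[dup] /ltnSE lj /ltE[->|[lt ne]] Jj js; rewrite upar //.
    rewrite up !inE eqxx fY gf; split=> //.
    by apply: contra fU => /(subsetP h7).
  by rewrite un //; have [-> pU -> ->] := h1 j lt Jj js; rewrite inE pU orbT.
- move=> j /ltE[->|[lt ne]] Jj js ij; first by rewrite !up; case: (hv ij).
  by rewrite !un //; apply: h2.
- move=> j j' /ltE[->|[lt ne]] /ltE[->|[lt' ne']] Jj Jj' js js'; rewrite ?up ?un //.
  + by move=> E; case/negP: fU; rewrite E; have [] := h1 j' lt' Jj' js'.
  + by move=> E; case/negP: fU; rewrite -E; have [] := h1 j lt Jj js.
  + exact: h3.
- move=> j /ltE[->|[lt ne]] Jj ij.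
    by rewrite up ij !inE eqxx; case: (hv ij).
  by rewrite un //; have [-> gW] := h4 j lt Jj ij; case: ifP; rewrite ?inE gW ?orbT.
- move=> j j' /ltE[->|[lt ne]] /ltE[->|[lt' ne']] Jj Jj' ij ij'; rewrite ?up ?un //.
  + by move=> E; have [_ _] := hv ij; rewrite E; have [_ ->] := h4 j' lt' Jj' ij'.
  + by move=> E; have [_ _] := hv ij'; rewrite -E; have [_ ->] := h4 j lt Jj ij.
  + exact: h5.
- exact: subset_trans h7 (subsetUr _ _).
- rewrite -[i.+1]addn1 iotaD count_cat /= add0n Ji ins cardsU1 fU /=; slia.
- rewrite -[i.+1]addn1 iotaD count_cat /= add0n Ji ins /=.
  by case: ifP => ii; rewrite ?cardsU1; move: h9; case: (v \notin W) => /=; slia.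
Qed.

Variables (d m : nat).
Hypothesis hdeg : forall v, v \in X -> d <= #|inc Y v|.
Hypothesis hnew : forall W U f, P W U -> f \in Y -> f \notin U -> #|W| < m ->
  exists v, [/\ v \in f, v \in X, v \notin W & P (v |: W) (f |: U)].
Hypothesis hskip : forall W U f, P W U -> f \in Y -> f \notin U -> P W (f |: U).
Hypothesis hm : (count (fun j => [&& J j, j != s & internal j]) (iota 0 l.+1)).+1 <= m.

(** The parent lies on at least [d] hyperedges of [Y], and fewer are spent. A leaf consumes a
    hyperedge but no vertex, hence [m] only has to exceed the number of internal indices. *)
Lemma gstate_extend i n g phi U W :
  gstate i g phi U W -> s < i -> i + n <= l.+1 ->
  #|U0| + count (fun j => J j && (j != s)) (iota 0 (i + n)) <= d ->
  exists g' phi' U' W', gstate (i + n) g' phi' U' W' /\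
    forall j, j < i -> g' j = g j /\ phi' j = phi j.
Proof.
move=> st si; elim: n => [|n IH] le cnt; first by exists g, phi, U, W; rewrite addn0.
have cS (p : pred nat) k : count p (iota 0 k.+1) = count p (iota 0 k) + p k.
  by rewrite -[k.+1]addn1 iotaD count_cat /= add0n addn0.
move: cnt le; rewrite addnS cS => cnt le.
have [|g' [phi' [U' [W' [st' ag]]]]] := IH (ltnW le); first by move: cnt; slia.
set k := i + n in st' cnt le *.
have ks : k != s by rewrite /k; lia.
case: (boolP (J k)) => Jk; last by exists g', phi', U', W'; split=> //; apply: gstate_skip.
move: cnt; rewrite Jk ks addn1 => cnt.
have [pk Jp] := hJ (ltnSE le) Jk ks.
have kl : 0 < k <= l by lia.
have [gpX _] := gs_vtx st' pk Jp (internal_par kl).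
have [f] : exists2 f, f \in inc Y (g' (par k)) & f \notin U'.
  apply: pick_notin; apply: leq_trans (hdeg gpX); have := gs_cardU st'; move: cnt; slia.
rewrite mem_inc => /andP[fY gf] fU.
have agree v j : j < i -> upd g' k v j = g j /\ upd phi' k f j = phi j.
  move=> ji; have [<- <-] := ag j ji; rewrite /upd.
  by have -> : (j == k) = false by rewrite /k; lia.
case: (boolP (internal k)) => ik; last first.
  exists (upd g' k (g' k)), (upd phi' k f), (f |: U'), W'; split; last exact: agree.
  have := gstate_step (v := g' k) st' (ltnSE le) Jk ks fY fU gf.
  rewrite (negbTE ik); apply=> //; apply: hskip => //; exact: gs_P st'.
have [|v [vf vX vW Pv]] := hnew (gs_P st') fY fU.
  apply: leq_ltn_trans (gs_cardW st') _; apply: leq_trans hm; rewrite ltnS.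
  have -> : iota 0 l.+1 = iota 0 k.+1 ++ iota k.+1 (l - k).
    by rewrite -iotaD; congr iota; lia.
  rewrite count_cat cS Jk ks ik /=; lia.
exists (upd g' k v), (upd phi' k f), (f |: U'), (v |: W'); split; last exact: agree.
have := gstate_step (v := v) st' (ltnSE le) Jk ks fY fU gf.
by rewrite ik; apply.
Qed.

End Greedy.
End IndexTree.

(** * Hypergraphs without a Berge copy of the tree *)

(** Seen from the root, every neighbour but [1] is a leaf, and the tree goes on beyond [1]. A leaf
    of the root comes last, so a copy of all the other edges can only get stuck at the root; [2]
    follows [1] at once so that its hyperedge can be prescribed. *)
Record bent_tree (par : nat -> nat) (l : nat) : Prop := BentTree {
  bt_itree : itree par l;
  bt_size : 3 <= l;
  bt_par1 : par 1 = 0;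
  bt_par2 : par 2 = 1;
  bt_parl : par l = 0;
  bt_leaf : forall i, 1 < i <= l -> par i = 0 -> ~~ internal par l i
}.

Definition root_leaves (par : nat -> nat) l : {set 'I_l.+1} :=
  [set i : 'I_l.+1 | (1 < i) && (par i == 0)].

Section BentTree.
Variables (par : nat -> nat) (l : nat).
Hypothesis bt : bent_tree par l.

Lemma bent_not_internal i : l.-1 <= i -> ~~ internal par l i.
Proof.
have [it l3 _ _ pl _] := bt; move=> li; apply/negP=> /internalP[j lj pj].
have := it j lj; case: (eqVneq j l) => [ej|nj]; last by rewrite pj; slia.
by move: pj; rewrite ej pl; slia.
Qed.

Lemma bent_internal_count :
  (count (fun j => [&& predT j, j != 0 & internal par l j]) (iota 0 l.+1)).+1 <= l.-1.
Proof.
have l3 := bt_size bt.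
rewrite -size_filter.
have sub : {subset [seq j <- iota 0 l.+1 | [&& predT j, j != 0 & internal par l j]]
            <= iota 1 (l - 2)}.
  move=> j; rewrite mem_filter mem_iota => /andP[/andP[_ /andP[j0 ij]] lj].
  rewrite mem_iota; have : ~~ (l.-1 <= j) by apply: contraTN ij => /bent_not_internal.
  by move: j0; slia.
have := uniq_leq_size (filter_uniq _ (iota_uniq 0 l.+1)) sub.
by rewrite size_iota; slia.
Qed.

Lemma bent_root_leaves_gt0 : 0 < #|root_leaves par l|.
Proof.
have l3 := bt_size bt; apply/card_gt0P; exists ord_max.
by rewrite inE /= (bt_parl bt) eqxx; slia.
Qed.

Variable V : finType.
Implicit Types (O X W Xs : {set V}) (E Y R : {set {set V}}).

Section Root.
Variables (X : {set V}) (Y : {set {set V}}) (v0 : V).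
Variable P : {set V} -> {set {set V}} -> Prop.
Hypothesis noT : forall g phi, ~ wemb par l Y X g phi.
Hypothesis hdeg : forall v, v \in X -> l.-1 <= #|inc Y v|.
Hypothesis hnew : forall W U f, P W U -> f \in Y -> f \notin U -> #|W| < l.-1 ->
  exists v, [/\ v \in f, v \in X, v \notin W & P (v |: W) (f |: U)].
Hypothesis hskip : forall W U f, P W U -> f \in Y -> f \notin U -> P W (f |: U).
Hypothesis v0X : v0 \in X.
Hypothesis P0 : P [set v0] set0.

Local Notation gst := (@gstate par l V predT 0 X Y set0 P).

Let hJ : forall i, i <= l -> predT i -> i != 0 -> par i < i /\ predT (par i).
Proof. by move=> i il _ i0; split=> //; apply: (bt_itree bt); slia. Qed.

(** A partial copy extends to everything but the leaf [l], which hangs at the root. As no full copy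
    exists, all hyperedges at [g 0] are spent; at most [l.-1] are spent and the degree is at least
    [l.-1], so the two sets coincide and every spent hyperedge contains [g 0]. *)
Lemma gstate_closed i g phi U W : gst i g phi U W -> 0 < i <= l ->
  #|inc Y (g 0)| = l.-1 /\ forall j, 0 < j < i -> phi j \in inc Y (g 0).
Proof.
have [it l3 p1 p2 pl hl] := bt; move=> st li.
have cnt : count (fun j => predT j && (j != 0)) (iota 0 l) = l.-1.
  rewrite -(prednK (n := l)) ?(ltn_trans _ l3) //= add0n (@eq_in_count _ _ predT).
    by rewrite count_predT size_iota.
  by move=> j; rewrite mem_iota /=; slia.
have [|||g' [phi' [U' [W' [st' ag]]]]] :=
    gstate_extend hJ hdeg hnew hskip bent_internal_count (n := l - i) st.
- by slia.
- by slia.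
- by rewrite subnKC ?cards0 ?cnt //; slia.
rewrite subnKC in st'; last by slia.
have [g0 _] := ag 0 ltac:(slia).
have subU : inc Y (g' 0) \subset U'.
  apply/negPn/negP=> /subsetPn[f fY fU].
  apply: (noT (g := g') (phi := upd phi' l f)).
  have ltl j : 0 < j <= l -> j = l \/ j < l /\ j != l by slia.
  have up : upd phi' l f l = f by rewrite /upd eqxx.
  have un j : j != l -> upd phi' l f j = phi' j by rewrite /upd => /negbTE->.
  have nl : ~~ internal par l l by apply: bent_not_internal; slia.
  have il j : internal par l j -> j < l by apply: internal_lt.
  move: fY; rewrite mem_inc => /andP[fY gf].
  split.
  - move=> j lj; case: (ltl j lj) => [->|[lt ne]]; first by rewrite up.
    by rewrite un //; have [] := gs_edge st' lt isT; rewrite // -lt0n; slia.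
  - move=> j j' lj lj'.
    have mem k : 0 < k <= l -> k < l -> phi' k \in U'.
      by move=> lk lt; have [] := gs_edge st' lt isT; rewrite // -lt0n; slia.
    case: (ltl j lj) (ltl j' lj') => [->|[lt ne]] [->|[lt' ne']] //; rewrite ?up ?un //.
    + by move=> e; case/negP: fU; rewrite e mem.
    + by move=> e; case/negP: fU; rewrite -e mem.
    + by apply: (gs_phi_inj st') => //; rewrite -lt0n; slia.
  - move=> j lj; case: (ltl j lj) => [->|[lt ne]]; first by rewrite up pl.
    by rewrite un //; have [] := gs_edge st' lt isT; rewrite // -lt0n; slia.
  - move=> j lj ij; case: (ltl j lj) => [ej|[lt ne]]; first by rewrite ej (negbTE nl) in ij.
    by rewrite un //; apply: (gs_int st') => //; rewrite -lt0n; slia.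
  - by move=> j ij; have [] := gs_vtx st' (il j ij) isT ij.
  - by move=> j j' ij ij'; apply: (gs_inj st') => //; apply: il.
have cU : #|U'| <= l.-1 by have := gs_cardU st'; rewrite cards0 cnt.
have g0X : g' 0 \in X.
  have i0 : internal par l 0 by apply/internalP; exists 1 => //; slia.
  by have [] := gs_vtx st' (j := 0) ltac:(slia) isT i0.
have eqU : inc Y (g' 0) = U'.
  by apply/eqP; rewrite eqEcard subU (leq_trans cU) // hdeg.
split; first by rewrite -g0; apply/eqP; rewrite eqn_leq hdeg // andbT eqU.
move=> j lj; rewrite -g0 eqU; have [_ <-] := ag j ltac:(slia).
by have [] := gs_edge st' (j := j) ltac:(slia) isT ltac:(slia).
Qed.

Lemma root_start : gst 1 (fun=> v0) (fun=> set0) set0 [set v0].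
Proof. exact: gstate_start. Qed.

Lemma root_deg : #|inc Y v0| = l.-1.
Proof.
have l3 := bt_size bt.
by have [] := gstate_closed root_start ltac:(slia).
Qed.

(* The edges at [v0] absorb the edges at any vertex that may follow [v0]:
   otherwise a copy of the tree minus its last leaf would leave one of the
   [l - 1] edges at [v0] free for that leaf. *)
Lemma root_absorb f v : f \in inc Y v0 -> v \in X -> v \in f -> v != v0 ->
  P (v |: [set v0]) [set f] -> inc Y v = inc Y v0.
Proof.
have [it l3 p1 p2 pl hl] := bt.
rewrite mem_inc => /andP[fY v0f] vX vf nv Pv.
have i1 : internal par l 1 by apply/internalP; exists 2 => //; slia.
have st2 : gst 2 (upd (fun=> v0) 1 v) (upd (fun=> set0) 1 f) [set f] (v |: [set v0]).
  have := gstate_step (v := v) (f := f) hJ root_start (ltnW (ltnW l3)) isT isT fY.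
  by rewrite i1 setU0; apply; rewrite // !inE.
apply/eqP; rewrite eqEcard root_deg hdeg // andbT; apply/subsetP=> h.
rewrite mem_inc => /andP[hY vh].
case: (eqVneq h f) => [->|nh]; first by rewrite mem_inc fY.
have hf : h \notin [set f] by rewrite inE.
have gp : upd (fun=> v0) 1 v (par 2) \in h by rewrite p2 /upd eqxx.
case: (boolP (internal par l 2)) => i2.
  have l4 : 3 < l.
    rewrite ltnNge; apply: contraL i2 => l3'; apply: bent_not_internal; slia.
  have [|x [xh xX xW Px]] := hnew Pv hY hf; first by rewrite cardsU1 cards1 !inE nv; slia.
  have := gstate_step (v := x) hJ st2 (ltnW l3) isT isT hY hf gp.
  rewrite i2 => /(_ (fun=> And3 xh xX xW) Px) st3.
  have [_ /(_ 2)] := gstate_closed st3 ltac:(slia).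
  by rewrite /upd /= => ->.
have := gstate_step (v := v) hJ st2 (ltnW l3) isT isT hY hf gp.
rewrite (negbTE i2) => /(_ (fun e : false => False_ind _ (notF e)) (hskip Pv hY hf)) st3.
have [_ /(_ 2)] := gstate_closed st3 ltac:(slia).
by rewrite /upd /= => ->.
Qed.

End Root.

(** One hyperedge too few for the tree, but enough common vertices for all its internal indices. *)
Definition cluster X Y R Xs :=
  [/\ R \subset Y, #|R| = l.-1, Xs \subset X, l.-1 <= #|Xs|
    & forall x f, x \in Xs -> f \in R -> x \in f].

Lemma cluster_of_thick X Y v0 :
  (forall g phi, ~ wemb par l Y X g phi) ->
  (forall v, v \in X -> l.-1 <= #|inc Y v|) ->
  (forall f, f \in Y -> l.-1 <= #|f :&: X|) -> v0 \in X ->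
  exists R Xs, cluster X Y R Xs.
Proof.
have l3 := bt_size bt; move=> noT hdeg hsz v0X.
pose P (_ : {set V}) (_ : {set {set V}}) := True.
have hnew W U f : P W U -> f \in Y -> f \notin U -> #|W| < l.-1 ->
    exists v, [/\ v \in f, v \in X, v \notin W & P (v |: W) (f |: U)].
  move=> _ fY _ ltW; have [v] := pick_notin (leq_trans ltW (hsz f fY)).
  by rewrite inE => /andP[vf vX] vW; exists v.
have hskip W U f : P W U -> f \in Y -> f \notin U -> P W (f |: U) by [].
have dR := root_deg noT hdeg hnew hskip v0X I.
have abs := root_absorb noT hdeg hnew hskip v0X I.
have [f0 f0R] : exists f0, f0 \in inc Y v0 by apply/card_gt0P; rewrite dR; slia.
have /andP[f0Y v0f0] : (f0 \in Y) && (v0 \in f0) by rewrite -mem_inc.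
exists (inc Y v0), (f0 :&: X); split=> //; first exact: inc_sub.
- exact: subsetIr.
- exact: hsz.
move=> x f; rewrite inE => /andP[xf0 xX] fR.
case: (eqVneq x v0) => [->|nx]; first by move: fR; rewrite mem_inc => /andP[].
by move: fR; rewrite -(abs f0 x f0R xX xf0 nx I) mem_inc => /andP[].
Qed.

(** The invariant confines the spent vertices to [v0] and the partners of spent hyperedges, so an
    unspent hyperedge has an unspent partner. The common vertices are the partners of the hyperedges
    at [v0]. *)
Lemma cluster_of_matching X Y v0 (mu : {set V} -> V) :
  (forall g phi, ~ wemb par l Y X g phi) ->
  (forall v, v \in X -> l.-1 <= #|inc Y v|) ->
  {in Y &, injective mu} ->
  (forall f, f \in Y -> [/\ mu f \in f, mu f \in X & mu f != v0]) -> v0 \in X ->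
  exists R Xs, cluster X Y R Xs.
Proof.
move=> noT hdeg imu hmu v0X.
pose P (W : {set V}) (U : {set {set V}}) :=
  (U \subset Y) && (W \subset v0 |: (mu @: U)).
have muU W U f : P W U -> f \in Y -> f \notin U -> mu f \notin W.
  move=> /andP[sU sW] fY fU; apply/negP=> /(subsetP sW).
  have [_ _ /negbTE nm] := hmu f fY.
  rewrite !inE nm /= => /imsetP[f' f'U e].
  by case/negP: fU; rewrite (imu f f') // (subsetP sU).
have hnew W U f : P W U -> f \in Y -> f \notin U -> #|W| < l.-1 ->
    exists v, [/\ v \in f, v \in X, v \notin W & P (v |: W) (f |: U)].
  move=> PWU fY fU _; have [m1 m2 _] := hmu f fY; exists (mu f); split=> //.
    exact: muU PWU fY fU.
  case/andP: PWU => sU sW; rewrite /P !subUset !sub1set fY sU /= imsetU1 !inE eqxx orbT /=.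
  by rewrite (subset_trans sW) // setUS // subsetUr.
have hskip W U f : P W U -> f \in Y -> f \notin U -> P W (f |: U).
  move=> /andP[sU sW] fY fU; rewrite /P !subUset !sub1set fY sU /= imsetU1.
  by rewrite (subset_trans sW) // setUS // subsetUr.
have P0 : P [set v0] set0 by rewrite /P sub0set sub1set !inE eqxx.
have dR := root_deg noT hdeg hnew hskip v0X P0.
have abs := root_absorb noT hdeg hnew hskip v0X P0.
have sR := inc_sub Y v0.
exists (inc Y v0), (mu @: inc Y v0); split=> //.
- by apply/subsetP=> x /imsetP[f /(subsetP sR) fY ->]; have [] := hmu f fY.
- by rewrite card_in_imset ?dR // => f f' /(subsetP sR) fY /(subsetP sR) fY'; apply: imu.
move=> x f /imsetP[f' f'R ->] fR.
have [m1 m2 m3] := hmu f' (subsetP sR f' f'R).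
suff e : inc Y (mu f') = inc Y v0 by move: fR; rewrite -e mem_inc => /andP[].
apply: (abs f') => //.
by rewrite /P sub1set (subsetP sR) //= imset_set1 setUC.
Qed.

(** The hyperedge [e] at [w] outside [R] is the one the cluster lacks. The root goes to [w], where
    [e] serves one of its leaves, and the other internal indices go into [Xs]. *)
Lemma cluster_exit O E R Xs w :
  cluster O E R Xs -> w \in O ->
  (exists2 f, f \in inc E w & f \in R) -> ~~ (inc E w \subset R) ->
  #|root_leaves par l| < #|inc E w| ->
  exists g phi, wemb par l E O g phi.
Proof.
have [it l3 p1 p2 pl hl] := bt.
move=> [sR cR sXs cXs hXs] wO [f fw fR] /subsetPn[e ew eR] lt.
have ne : e != f by apply: contraNneq eR => ->.
(* [Q] is the set of hyperedges used at the root: [f] leads to index [1] in the cluster, the others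
   serve the root's leaves. Since [e] is not in [R], at least [#|rest|] hyperedges of [R] stay
   outside [Q]. *)
have [||Q] := sub_of_card (S := [set e; f]) (B := inc E w)
    (n := #|root_leaves par l|.+1) _ _ lt.
- by rewrite subUset !sub1set ew.
- by rewrite cards2 ne ltnS bent_root_leaves_gt0.
rewrite subUset !sub1set => /andP[eQ fQ] /andP[sQ /eqP cQ].
pose rest := [set i : 'I_l.+1 | (1 < i) && (par i != 0)].
have cLR : #|root_leaves par l| + #|rest| = l.-1.
  have -> : #|root_leaves par l| + #|rest| = #|[set i : 'I_l.+1 | 1 < i]|.
    rewrite -(cardsID [set i : 'I_l.+1 | par i == 0] [set i : 'I_l.+1 | 1 < i]).
    by congr (_ + _); apply: eq_card => i; rewrite !inE // andbC.
  have -> : [set i : 'I_l.+1 | 1 < i] = setT :\: [set inord 0; inord 1].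
    by apply/setP=> i; rewrite !inE -!val_eqE /= !inordK //; slia.
  rewrite cardsD cardsT card_ord setTI cards2.
  by rewrite -val_eqE /= !inordK //; slia.
have [f1 [i1 h1]] : exists F : 'I_l.+1 -> {set V},
    {in root_leaves par l &, injective F} /\
    forall i, i \in root_leaves par l -> F i \in Q :\ f.
  by apply: exists_inj_on => //; move: cQ; rewrite (cardsD1 f Q) fQ; slia.
have [f2 [i2 h2]] : exists F : 'I_l.+1 -> {set V},
    {in rest &, injective F} /\ forall i, i \in rest -> F i \in R :\: Q.
  apply: exists_inj_on => //; rewrite cardsD.
  have : #|R :&: Q| <= #|Q :\ e|.
    apply: subset_leq_card; apply/subsetP=> x; rewrite !inE => /andP[xR ->].
    by rewrite andbT; apply: contraNneq eR => <-.
  move: cQ; rewrite (cardsD1 e Q) eQ; slia.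
pose ints := [set i : 'I_l.+1 | (0 < i) && internal par l i].
have [h [ih hh]] : exists h : 'I_l.+1 -> V,
    {in ints &, injective h} /\ forall i, i \in ints -> h i \in Xs :\ w.
  apply: exists_inj_on => //.
  have : #|ints| <= count (fun j => [&& predT j, j != 0 & internal par l j]) (iota 0 l.+1).
    rewrite cardE -(size_map val) -size_filter; apply: uniq_leq_size.
      by rewrite map_inj_uniq ?enum_uniq //; apply: val_inj.
    move=> x /mapP[i]; rewrite mem_enum inE => /andP[i0 ii] ->.
    by rewrite mem_filter mem_iota /= -lt0n i0 ii ltn_ord.
  have := bent_internal_count; rewrite (cardsD1 w Xs) in cXs.
  by move: cXs; case: (w \in Xs); slia.
pose g i := if i == 0 then w else h (inord i).
pose phi i := if i == 1 then f else if par i == 0 then f1 (inord i) else f2 (inord i).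
have lI i : 1 < i <= l -> par i = 0 -> inord i \in root_leaves par l.
  by move=> li pi; rewrite inE inordK ?pi ?eqxx ?andbT; slia.
have rI i : 1 < i <= l -> par i <> 0 -> inord i \in rest.
  by move=> li /eqP pi; rewrite inE inordK ?pi ?andbT; slia.
have spl i : 0 < i <= l -> [\/ i = 1, 1 < i <= l /\ par i = 0 | 1 < i <= l /\ par i <> 0].
  move=> li; case: (eqVneq i 1) => [|n1]; first by constructor 1.
  by case: (eqVneq (par i) 0) => [e0|/eqP n0]; [constructor 2|constructor 3]; split=> //; slia.
have p1E : phi 1 = f by [].
have pLE i : 1 < i <= l -> par i = 0 -> phi i = f1 (inord i).
  by rewrite /phi => li ->; case: eqP => //; slia.
have pRE i : 1 < i <= l -> par i <> 0 -> phi i = f2 (inord i).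
  by rewrite /phi => li /eqP/negbTE->; case: eqP => //; slia.
have inj_ord i j : i <= l -> j <= l -> inord i = inord j :> 'I_l.+1 -> i = j.
  by move=> li lj /(congr1 val); rewrite /= !inordK.
have gX i : 0 < i -> internal par l i -> g i \in Xs :\ w.
  move=> i0 ii; rewrite /g; case: eqP => [e0|_]; first by rewrite e0 in i0.
  by apply: hh; rewrite inE inordK ?i0 //; have := internal_lt it ii; slia.
have gXs i : 0 < i -> internal par l i -> g i \in Xs.
  by move=> i0 ii; move: (gX i i0 ii); rewrite inE => /andP[].
have QE x : x \in Q -> (x \in E) && (w \in x) by move/(subsetP sQ); rewrite mem_inc.
have wf : w \in f by case/andP: (QE f fQ).
have RE x : x \in R -> x \in E by apply: (subsetP sR).
exists g, phi; split.
- move=> i /spl[->|[li pi]|[li pi]].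
  + exact: RE.
  + by rewrite pLE //; move: (h1 _ (lI i li pi)); rewrite inE => /andP[_ /QE/andP[]].
  + by rewrite pRE //; move: (h2 _ (rI i li pi)); rewrite inE => /andP[_ /RE].
- move=> i j /spl[->|[li pi]|[li pi]] /spl[->|[lj pj]|[lj pj]] //.
  + by rewrite p1E pLE // => e0; move: (h1 _ (lI j lj pj)); rewrite -e0 !inE eqxx.
  + by rewrite p1E pRE // => e0; move: (h2 _ (rI j lj pj)); rewrite -e0 !inE fQ.
  + by rewrite p1E pLE // => e0; move: (h1 _ (lI i li pi)); rewrite e0 !inE eqxx.
  + rewrite !pLE // => e0; apply: inj_ord; [slia|slia|].
    by apply: i1 => //; apply: lI.
  + rewrite pLE // pRE // => e0; move: (h1 _ (lI i li pi)) (h2 _ (rI j lj pj)).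
    by rewrite e0 !inE => /andP[_ ->].
  + by rewrite p1E pRE // => e0; move: (h2 _ (rI i li pi)); rewrite e0 !inE fQ.
  + rewrite pRE // pLE // => e0; move: (h1 _ (lI j lj pj)) (h2 _ (rI i li pi)).
    by rewrite e0 !inE => /andP[_ ->].
  + rewrite !pRE // => e0; apply: inj_ord; [slia|slia|].
    by apply: i2 => //; apply: rI.
- move=> i li; case/spl: (li) => [->|[li' pi]|[li' pi]].
  + by rewrite p1 p1E.
  + by rewrite pi pLE //; move: (h1 _ (lI i li' pi)); rewrite inE => /andP[_ /QE/andP[]].
  + rewrite pRE //; apply: hXs; first by apply: gXs; [slia|apply: internal_par].
    by move: (h2 _ (rI i li' pi)); rewrite inE => /andP[].
- move=> i li ii; have gi : g i \in Xs by apply: gXs => //; slia.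
  case/spl: (li) => [->|[li' pi]|[li' pi]].
  + by rewrite p1E; apply: hXs => //; apply: gXs => //; apply/internalP; exists 2 => //; slia.
  + by rewrite (negbTE (hl i li' pi)) in ii.
  + by rewrite pRE //; apply: hXs => //; move: (h2 _ (rI i li' pi)); rewrite inE => /andP[].
- move=> i ii; case: (posnP i) => [->//|i0].
  by apply: (subsetP sXs); apply: gXs.
- move=> i j ii ij; case: (posnP i) => [->|i0]; case: (posnP j) => [->//|j0].
  + by move=> e0; move: (gX j j0 ij); rewrite -e0 !inE eqxx.
  + by move=> e0; move: (gX i i0 ii); rewrite e0 !inE eqxx.
  + have := internal_lt it ii; have := internal_lt it ij => ltj lti.
    rewrite /g !ifN -?lt0n // => e0; apply: inj_ord; [slia|slia|].
    by apply: ih => //; rewrite inE inordK ?i0 ?j0 ?ii ?ij //; slia.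
Qed.

(* Vertices meeting at least half of [R] count [#|R|], the others twice their
   degree; when exactly [rho] vertices are capped, distinctness of the traces
   provides the missing weight. *)
Lemma capped_degree_sum O R rho : 2 <= #|R| ->
  (forall h, h \in R -> rho <= #|h :&: O|) ->
  (forall h h', h \in R -> h' \in R -> #|h :&: O| = rho ->
     h :&: O = h' :&: O -> h = h') ->
  rho.+1 * #|R| <= \sum_(v in O) minn #|R| (2 * #|inc R v|).
Proof.
move=> R2 hsz hdist.
pose Cap := [set v in O | #|R| <= 2 * #|inc R v|].
have sCap : Cap \subset O by apply/subsetP=> v; rewrite inE => /andP[].
have -> : \sum_(v in O) minn #|R| (2 * #|inc R v|) =
    #|Cap| * #|R| + 2 * \sum_(h in R) #|h :&: (O :\: Cap)|.
  rewrite (big_setID Cap) /= (setIidPr sCap); congr (_ + _).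
    rewrite -sum_nat_const; apply: eq_bigr => v; rewrite inE => /andP[_ le].
    exact/minn_idPl.
  rewrite sum_inc big_distrr /=; apply: eq_bigr => v; rewrite !inE => /andP[+ vO].
  by rewrite vO -ltnNge => /ltnW lt; apply/minn_idPr.
have out h : h \in R -> rho <= #|Cap| + #|h :&: (O :\: Cap)|.
  move=> hR; apply: leq_trans (hsz h hR) _.
  rewrite -(cardsID Cap (h :&: O)); apply: leq_add.
    by apply: subset_leq_card; apply: subsetIr.
  by apply: subset_leq_card; rewrite -setIDA.
case: (ltngtP #|Cap| rho) => [lt|gt|eqc].
- have : (rho - #|Cap|) * #|R| <= \sum_(h in R) #|h :&: (O :\: Cap)|.
    rewrite mulnC -sum_nat_const; apply: leq_sum => h hR.
    by have := out h hR; slia.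
  by move: (\sum_(h in R) _) #|R| #|Cap| lt {out} => S m c lt le; nia.
- by apply: leq_trans (leq_addr _ _); rewrite leq_mul2r gt orbT.
have : #|R|.-1 <= \sum_(h in R) #|h :&: (O :\: Cap)|.
  pose bad := [set h in R | h :&: O == Cap].
  have badE h : h \in R -> h \notin bad -> 0 < #|h :&: (O :\: Cap)|.
    move=> hR; rewrite inE hR /= => nb; rewrite card_gt0 setIDA setD_eq0.
    apply: contra nb => sub; rewrite eqEcard sub /= eqc; exact: hsz.
  have cbad : #|bad| <= 1.
    rewrite leqNgt; apply/negP=> /card_gt1P[h [h' [hb hb' /negP]]]; apply.
    move: hb hb'; rewrite !inE => /andP[hR /eqP e1] /andP[h'R /eqP e2].
    by apply/eqP; apply: hdist; rewrite ?e1 ?e2.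
  rewrite (big_setID bad) /=; apply: leq_trans (leq_addl _ _).
  apply: (@leq_trans (\sum_(h in R :\: bad) 1)).
    rewrite sum1_card cardsD.
    have : #|R :&: bad| <= #|bad| by apply: subset_leq_card; apply: subsetIr.
    by move: cbad; slia.
  by apply: leq_sum => h; rewrite inE => /andP[nb hR]; apply: badE.
by rewrite -eqc; move: (\sum_(h in R) _) #|R| #|Cap| R2 => S m c; nia.
Qed.

(** Induction on [#|E|]. If the bound fails, the vertices of degree at least half of [l.-1] are
    overfull for the threshold [l.-2]: offset [l.-2] makes the hyperedges thick, offset [1] together
    with maximum degree [l.-1] gives a matching, and either yields a cluster. Removing the cluster
    is compatible with the weights: by [cluster_exit] a vertex meeting it has no other hyperedge, or
    has degree at most [#|root_leaves par l|], so that twice its degree is below the cap. *)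
Lemma tree_free_bound O rho E :
  2 * #|root_leaves par l| <= l.-1 ->
  (forall h, h \in E -> rho <= #|h :&: O|) ->
  (forall h h', h \in E -> h' \in E -> #|h :&: O| = rho ->
     h :&: O = h' :&: O -> h = h') ->
  (forall g phi, ~ wemb par l E O g phi) ->
  l.-1 ^ 2 <= rho.+1 \/
    (forall v, v \in O -> #|inc E v| <= l.-1) /\ 2 * l.-1 <= rho.+1 ->
  rho.+1 * #|E| <= \sum_(v in O) minn l.-1 (2 * #|inc E v|).
Proof.
have l3 := bt_size bt; move=> hp.
have [n] := ubnP #|E|; elim: n E => // n IH E /ltnSE leE hsz hdist noT hcase.
rewrite leqNgt; apply/negP=> big.
suff [R [Xs cl]] : exists R Xs, cluster O E R Xs.
  have [sR cR sXs cXs hXs] := cl.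
  have sE' : E :\: R \subset E by apply: subsetDl.
  have IHR : rho.+1 * #|E :\: R| <=
      \sum_(v in O) minn l.-1 (2 * #|inc (E :\: R) v|).
    apply: IH.
    - move: leE; rewrite cardsD (setIidPr sR) cR.
      by have := subset_leq_card sR; rewrite cR; slia.
    - by move=> h /(subsetP sE'); apply: hsz.
    - by move=> h h' /(subsetP sE') hE /(subsetP sE') h'E; apply: hdist.
    - by move=> g phi /(wembS sE' (subxx O)); apply: noT.
    - case: hcase => [|[D r2]]; [by left|right; split=> // v vO].
      by apply: leq_trans (D v vO); apply: subset_leq_card; apply: incS.
  have cap : rho.+1 * #|R| <= \sum_(v in O) minn #|R| (2 * #|inc R v|).
    apply: capped_degree_sum; first by rewrite cR; slia.
    - by move=> h /(subsetP sR); apply: hsz.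
    - by move=> h h' /(subsetP sR) hE /(subsetP sR) h'E; apply: hdist.
  have cE : #|E| = #|R| + #|E :\: R| by rewrite -(cardsID R E) (setIidPr sR).
  move: big; apply/negP; rewrite -leqNgt cE mulnDr.
  apply: leq_trans (leq_add cap IHR) _; rewrite -big_split /=.
  apply: leq_sum => w wO.
  have dw : #|inc E w| = #|inc R w| + #|inc (E :\: R) w|.
    rewrite -(cardsID R (inc E w)); congr (_ + _); apply: eq_card => h; rewrite !inE.
      by case: (boolP (h \in R)) => [/(subsetP sR)->|_]; rewrite ?andbT ?andbF.
    by rewrite andbA.
  rewrite cR; case: (posnP #|inc R w|) => [a0|a0]; first by rewrite dw a0 muln0 minn0.
  case: (boolP (inc E w \subset R)) => [sw|nw].
    have -> : #|inc (E :\: R) w| = 0.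
      apply: eq_card0 => h; rewrite !inE; apply/negP=> /andP[/andP[nR hE] wh].
      by move/subsetP/(_ h): sw; rewrite mem_inc hE wh (negbTE nR) => /(_ isT).
    by rewrite muln0 minn0 addn0 dw; slia.
  have le : #|inc E w| <= #|root_leaves par l|.
    rewrite leqNgt; apply/negP=> lt.
    have [|g [phi]] := cluster_exit cl wO _ nw lt; last exact: noT.
    by have /card_gt0P[f] := a0; rewrite mem_inc => /andP[fR wf]; exists f;
       rewrite // mem_inc wf (subsetP sR).
  by move: le; rewrite dw; slia.
pose Vb := [set v in O | l.-1 <= 2 * #|inc E v|].
have sVb : Vb \subset O by apply/subsetP=> v; rewrite inE => /andP[].
pose Ps := \sum_(v in O :\: Vb) #|inc E v|.
have eF : \sum_(v in O) minn l.-1 (2 * #|inc E v|) = l.-1 * #|Vb| + 2 * Ps.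
  rewrite (big_setID Vb) /= (setIidPr sVb); congr (_ + _).
    rewrite mulnC -sum_nat_const; apply: eq_bigr => v; rewrite inE => /andP[_ le].
    exact/minn_idPl.
  rewrite big_distrr /=; apply: eq_bigr => v; rewrite !inE => /andP[+ vO].
  by rewrite vO -ltnNge => /ltnW lt; apply/minn_idPr.
have eI : rho * #|E| <= \sum_(h in E) #|h :&: Vb| + Ps.
  rewrite sum_inc /Ps.
  have -> : \sum_(v in Vb) #|inc E v| + \sum_(v in O :\: Vb) #|inc E v| =
            \sum_(v in O) #|inc E v| by rewrite [RHS](big_setID Vb) /= (setIidPr sVb).
  by rewrite -sum_inc mulnC -sum_nat_const; apply: leq_sum.
(* The doubled weight of low degrees is used here: [2 * l.-2 >= l.-1] absorbs their incidences
   [Ps]. *)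
have over c : l.-1 * c.+1 <= rho.+1 -> overfull (fun=> c) 1 l.-2 Vb E.
  rewrite /overfull sum_nat_const; move: big eI; rewrite eF.
  move: (\sum_(h in E) _) #|E| #|Vb| => S e nb; clear eF; clearbody Ps; move: Ps => p.
  have -> : l.-1 = l.-2.+1 by slia.
  have : 0 < l.-2 by slia.
  by move: l.-2 => h h0 H1 H2 H3; rewrite !mul1n; clear -h0 H1 H2 H3; nia.
have core c X Y : X \subset Vb -> Y \subset E -> min_overfull (fun=> c) 1 l.-2 X Y ->
    [/\ exists v0, v0 \in X, forall v, v \in X -> l.-1 <= #|inc Y v|
      & forall g phi, ~ wemb par l Y X g phi].
  move=> sX sY mXY; split.
  - apply/set0Pn; apply/negP=> /eqP X0; case: mXY => + _.
    rewrite /overfull X0 [Z in _ < 1 * Z]big1 ?muln0 ?ltn0 // => h _.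
    by rewrite setI0 cards0.
  - by move=> v vX; have := min_overfull_deg mXY vX; slia.
  - by move=> g phi /(wembS sY (subset_trans sX sVb)); apply: noT.
have up X Y R Xs : X \subset Vb -> Y \subset E -> cluster X Y R Xs -> cluster O E R Xs.
  move=> sX sY [h1 h2 h3 h4 h5]; split=> //; first exact: subset_trans h1 sY.
  by apply: subset_trans h3 (subset_trans sX sVb).
case: hcase => [r2|[D r2]].
  have [|X [Y [sX sY mXY]]] := min_overfull_exists (over l.-2 _).
    by apply: leq_trans r2; rewrite expnS expn1; have -> : l.-2.+1 = l.-1 by slia.
  have [[v0 v0X] hdeg noT'] := core _ _ _ sX sY mXY.
  have [f fY|R [Xs cl]] := cluster_of_thick noT' hdeg _ v0X.
    by have := min_overfull_edge mXY fY; rewrite mul1n; slia.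
  by exists R, Xs; apply: up cl.
have [|X [Y [sX sY mXY]]] := min_overfull_exists (over 1 _); first by slia.
have [[v0 v0X] hdeg noT'] := core _ _ _ sX sY mXY.
have [v vX|//|mu [imu hmu]] := min_overfull_matching (j := 1) mXY v0.
  have -> : l.-2 + 1 = l.-1 by slia.
  apply: leq_trans (D v _); first by apply: subset_leq_card; apply: incS.
  by apply: (subsetP sVb); apply: (subsetP sX).
have [R [Xs cl]] := cluster_of_matching noT' hdeg imu hmu v0X.
by exists R, Xs; apply: up cl.
Qed.

End BentTree.

(** * Completing a tree by stars *)

Record indexing (T : sgraph) (l : nat) (par : nat -> nat) (sg : nat -> T) : Prop :=
  Indexing {
  ix_itree : itree par l;
  ix_inj : forall i j, i <= l -> j <= l -> sg i = sg j -> i = j;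
  ix_surj : forall x, exists2 i, i <= l & sg i = x;
  ix_adj : forall i j, i <= l -> j <= l ->
    sadj (sg i) (sg j) = (0 < i) && (par i == j) || (0 < j) && (par j == i)
}.

Lemma contains_bergeI (F : sgraph) (V J : finType) (H : {set {set V}})
    (ed : J -> {set F}) (hy : J -> {set V}) (f : F -> V) :
  injective f -> injective hy -> (forall j, hy j \in H) ->
  (forall e, e \in sedges F -> exists j, e = ed j) ->
  (forall j x, x \in ed j -> f x \in hy j) ->
  contains_berge F H.
Proof.
move=> fi hi hH hed inc_f.
pose phi : {ffun {set F} -> {set V}} :=
  [ffun e => if [pick j | ed j == e] is Some j then hy j else set0].
have phiP e : e \in sedges F -> exists2 j, e = ed j & phi e = hy j.
  move=> /hed[j ej]; rewrite ffunE; case: pickP => [j' /eqP <-|/(_ j)].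
    by exists j'.
  by rewrite ej eqxx.
apply/existsP; exists (phi @: sedges F); apply/andP; split.
  apply/subsetP=> h /imsetP[e /phiP[j _ ->] ->]; exact: hH.
apply/existsP; exists (finfun f); apply/existsP; exists phi; apply/and4P; split=> //.
- by apply/injectiveP=> x y; rewrite !ffunE; apply: fi.
- apply/dinjectiveP=> e e' /phiP[j -> ->] /phiP[j' -> ->] /hi ejj'.
  by rewrite ejj'.
apply/forallP=> e; apply/implyP=> /phiP[j ej ->]; apply/subsetP=> v /imsetP[x xe ->].
by rewrite ffunE; apply: inc_f; rewrite -ej.
Qed.

Lemma berge_with_stars (T : sgraph) l par sg (V : finType) (H : {set {set V}})
    (g : nat -> V) (phi : nat -> {set V}) (k l2 : nat)
    (ctr : 'I_k -> V) (lf : 'I_k * 'I_l2 -> V) (psi : 'I_k * 'I_l2 -> {set V}) :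
  @indexing T l par sg ->
  (forall i j, i <= l -> j <= l -> g i = g j -> i = j) ->
  (forall i, 0 < i <= l -> [/\ phi i \in H, g i \in phi i & g (par i) \in phi i]) ->
  (forall i j, 0 < i <= l -> 0 < j <= l -> phi i = phi j -> i = j) ->
  injective ctr -> injective lf -> injective psi ->
  (forall p, [/\ psi p \in H, ctr p.1 \in psi p & lf p \in psi p]) ->
  (forall c p, ctr c != lf p) ->
  (forall i, i <= l -> (forall c, g i != ctr c) /\ (forall p, g i != lf p)) ->
  (forall i p, 0 < i <= l -> phi i != psi p) ->
  contains_berge (dunion T (copies k (star l2))) H.
Proof.
move=> ix gi hphi phii ci li pi hpsi ncl ng nphi.
pose F := dunion T (copies k (star l2)).
pose idx (x : T) : nat := if [pick i : 'I_l.+1 | sg i == x] is Some i then i else 0.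
have idxP x : idx x <= l /\ sg (idx x) = x.
  rewrite /idx; case: pickP => [i /eqP <-|none]; first by rewrite -ltnS.
  have [i il ei] := ix_surj ix x.
  by have := none (Ordinal (n := l.+1) (m := i) il); rewrite /= ei eqxx.
have idx_sg i : i <= l -> idx (sg i) = i.
  by move=> il; have [le e] := idxP (sg i); apply: (ix_inj ix).
pose f (x : F) : V := match x with
  | inl y => g (idx y)
  | inr (c, None) => ctr c
  | inr (c, Some j) => lf (c, j) end.
pose ed (j : 'I_l + 'I_k * 'I_l2) : {set F} := match j with
  | inl i => [set inl (sg i.+1); inl (sg (par i.+1))]
  | inr p => [set inr (p.1, None); inr (p.1, Some p.2)] end.
pose hy (j : 'I_l + 'I_k * 'I_l2) : {set V} := match j with
  | inl i => phi i.+1 | inr p => psi p end.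
have ltS (i : 'I_l) : 0 < i.+1 <= l by rewrite ltn_ord.
have lpar i : 0 < i <= l -> par i <= l by move=> hi; have := ix_itree ix hi; lia.
apply: (@contains_bergeI F V _ H ed hy f).
- case=> [x|[c [j|]]] [y|[c' [j'|]]] //=.
  + have [lx ex] := idxP x; have [ly ey] := idxP y => /(gi _ _ lx ly) e.
    by rewrite -ex -ey e.
  + by move=> e; have [_ /(_ (c', j'))] := ng _ (idxP x).1; rewrite e eqxx.
  + by move=> e; have [/(_ c') + _] := ng _ (idxP x).1; rewrite e eqxx.
  + by move=> e; have [_ /(_ (c, j))] := ng _ (idxP y).1; rewrite e eqxx.
  + by move=> /li[-> ->].
  + by move=> e; have := ncl c' (c, j); rewrite e eqxx.
  + by move=> e; have [/(_ c) + _] := ng _ (idxP y).1; rewrite e eqxx.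
  + by move=> e; have := ncl c (c', j'); rewrite e eqxx.
  + by move=> /ci->.
- case=> [i|p] [j|q] //=.
  + by move/(phii _ _ (ltS i) (ltS j)) => [e]; congr inl; apply: val_inj.
  + by move=> e; have := nphi _ q (ltS i); rewrite e eqxx.
  + by move=> e; have := nphi _ p (ltS j); rewrite e eqxx.
  + by move/pi->.
- by case=> [i|p] /=; [have [] := hphi _ (ltS i)|have [] := hpsi p].
- move=> e /imset2P[x y _]; rewrite inE => /andP[_ +] ->.
  case: x y => [x|[c x]] [y|[c' y]] //=.
    have [lx ex] := idxP x; have [ly ey] := idxP y.
    rewrite -ex -ey (ix_adj ix) // => /orP[]/andP[i0 /eqP pe].
      have lx' : (idx x).-1 < l by lia.
      by exists (inl (Ordinal lx')); rewrite /ed /= prednK // pe.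
    have ly' : (idx y).-1 < l by lia.
    by exists (inl (Ordinal ly')); rewrite /ed /= prednK // pe setUC.
  rewrite /copies_adj /= => /andP[/eqP <-]; rewrite /star_adj.
  case: x y => [x|] [y|] //= _.
    by exists (inr (c, x)); rewrite /ed /= setUC.
  by exists (inr (c, y)).
case=> [i|p] x; rewrite !inE => /orP[]/eqP-> /=.
- by rewrite idx_sg; [have [] := hphi _ (ltS i)|].
- by rewrite idx_sg; [have [] := hphi _ (ltS i)|apply: lpar].
- by have [] := hpsi p.
- by case: p => c j; have [] := hpsi (c, j).
Qed.

(** A leaf lies on a single tree edge, so any vertex of its hyperedge will do that is outside [K]
    and not in use; the copy never uses more than [l.+1] vertices. *)
Lemma wemb_full (par : nat -> nat) l (V : finType) (E : {set {set V}}) (O K : {set V})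
    (g : nat -> V) (phi : nat -> {set V}) :
  0 < l -> itree par l -> wemb par l E O g phi ->
  (forall i, internal par l i -> g i \notin K) ->
  (forall h, h \in E -> #|K| + l.+1 <= #|h|) ->
  exists g' : nat -> V, [/\ forall i j, i <= l -> j <= l -> g' i = g' j -> i = j,
    forall i, 0 < i <= l -> g' i \in phi i /\ g' (par i) \in phi i
    & forall i, i <= l -> g' i \notin K].
Proof.
move=> l0 it [hE hi hp hint hO hg] nK hsz.
pose ints := [set i : 'I_l.+1 | internal par l i].
pose W0 := K :|: [set g i | i : 'I_l.+1 in ints].
pose leafT : finType := {i : 'I_l.+1 | ~~ internal par l i}.
have int0 : internal par l 0.
  by apply/internalP; exists 1; [lia|have := it 1; lia].
have lf0 (x : leafT) : 0 < val x.
  by case: x => i /= ni; rewrite lt0n; apply: contraNneq ni => ->.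
have [x|h [ih hS hW]] := @greedy_sdr leafT V (g 0) (fun x => phi (val (val x))) W0.
  apply: leq_trans (hsz _ (hE _ _)); last by rewrite lf0 -ltnS ltn_ord.
  have -> : #|leafT| = #|~: ints| by rewrite card_sig; apply: eq_card => i; rewrite !inE.
  have : #|ints| + #|~: ints| = l.+1 by rewrite cardsC card_ord.
  have : #|W0| <= #|K| + #|ints|.
    apply: leq_trans (leq_card_setU _ _) _; rewrite leq_add2l; exact: leq_imset_card.
  by slia.
pose g' i := if insub (inord i : 'I_l.+1) is Some x then h x else g i.
have g'i i : i <= l -> internal par l i -> g' i = g i.
  by move=> il ii; rewrite /g' insubF //= inordK ?ii.
have g'l i : i <= l -> ~~ internal par l i ->
    exists2 x : leafT, val (val x) = i & g' i = h x.
  move=> il ni; rewrite /g'; case: insubP => [x _ ex|]; last by rewrite /= inordK // ni.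
  by exists x => //; rewrite ex /= inordK.
exists g'; split.
- move=> i j il jl; case: (boolP (internal par l i)) => ii;
    case: (boolP (internal par l j)) => ij.
  + by rewrite !g'i //; apply: hg.
  + rewrite g'i //; have [x _ ->] := g'l j jl ij => e; have := hW x.
    rewrite inE negb_or => /andP[_ /negP[]]; apply/imsetP; exists (inord i) => //.
      by rewrite inE inordK.
    by rewrite inordK.
  + rewrite [g' j]g'i //; have [x _ ->] := g'l i il ii => e; have := hW x.
    rewrite inE negb_or => /andP[_ /negP[]]; apply/imsetP; exists (inord j) => //.
      by rewrite inE inordK.
    by rewrite inordK.
  + have [x <- ->] := g'l i il ii; have [y <- ->] := g'l j jl ij.
    by move/ih->.
- move=> i il; have pil : par i <= l by have := it i il; lia.
  rewrite (g'i (par i)) ?internal_par // hp //; split=> //.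
  have il' : i <= l by lia.
  case: (boolP (internal par l i)) => ii; first by rewrite g'i // hint.
  by have [x ex ->] := g'l i il' ii; rewrite -[i in phi i]ex hS.
- move=> i il; case: (boolP (internal par l i)) => ii; first by rewrite g'i // nK.
  have [x _ ->] := g'l i il ii; have := hW x.
  by rewrite inE negb_or => /andP[].
Qed.

(** A further star edge at a centre must avoid the spent hyperedges, at most [l + k * l2], and
    contain a vertex not in use. At most [l.+1 + k + k * l2] vertices are in use and 2 to that power
    bounds the number of hyperedges among them; the degree threshold is the sum. *)
Lemma berge_stars_at (T : sgraph) l par sg (V : finType) r (H : {set {set V}})
    (O K : {set V}) g phi (k l2 : nat) :
  0 < l -> @indexing T l par sg -> wemb par l H O g phi ->
  (forall h, h \in H -> #|h| = r) -> k + l.+1 <= r -> #|K| = k ->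
  (forall i, internal par l i -> g i \notin K) ->
  (forall a, a \in K -> l + k * l2 + 2 ^ (l.+1 + k + k * l2) < #|inc H a|) ->
  contains_berge (dunion T (copies k (star l2))) H.
Proof.
move=> l0 ix we unif kr cK nK degK.
have it := ix_itree ix.
have [h hH|g' [g'i g'in g'K]] := wemb_full l0 it we nK; first by rewrite (unif h hH) cK.
have [ctr [ci cin]] : exists ctr : 'I_k -> V,
    {in setT &, injective ctr} /\ forall c, c \in setT -> ctr c \in K.
  by apply: exists_inj_on (g 0) _ _ _; rewrite cardsT card_ord cK.
have cK' c : ctr c \in K by apply: cin; rewrite inE.
pose W0 : {set V} := K :|: [set g' i | i : 'I_l.+1].
pose U0 : {set {set V}} := [set phi (i : 'I_l).+1 | i : 'I_l].
have cW0 : #|W0| <= k + l.+1.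
  apply: leq_trans (leq_card_setU _ _) _; rewrite cK leq_add2l.
  by apply: leq_trans (leq_imset_card _ _) _; rewrite card_ord.
have cU0 : #|U0| <= l by apply: leq_trans (leq_imset_card _ _) _; rewrite card_ord.
have [p Vu Wu|psi [lf [pi li R nU nW]]] := @greedy_pairs ('I_k * 'I_l2)%type _ V set0 (g 0)
    (fun p h v => [&& h \in H, ctr p.1 \in h & v \in h]) U0 W0.
  rewrite card_prod !card_ord => cVu cWu _ _.
  have [h] : exists2 h, h \in inc H (ctr p.1) & h \notin Vu :|: powerset Wu.
    apply: pick_notin; apply: leq_ltn_trans (degK _ (cK' p.1)).
    apply: leq_trans (leq_card_setU _ _) _; rewrite card_powerset.
    apply: leq_add; first by apply: leq_trans cVu _; rewrite leq_add2r.
    rewrite leq_exp2l //; apply: leq_trans cWu _; rewrite leq_add2r.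
    by apply: leq_trans cW0 _; rewrite addnC.
  rewrite mem_inc !inE negb_or => /andP[hH ch] /andP[nVu /subsetPn[v vh nv]].
  by exists h, v; rewrite hH ch vh.
have wfix := wemb_edge we.
apply: (@berge_with_stars T l par sg V H g' phi k l2 ctr lf psi) => //.
- by move=> i il; have [g1 g2] := g'in i il; rewrite wfix.
- exact: wemb_phi_inj we.
- by move=> c c' e; apply: ci; rewrite ?inE.
- by move=> p; case/and3P: (R p).
- by move=> c p; apply: contraNneq (nW p) => <-; rewrite inE cK'.
- move=> i il; split=> [c|p]; first by apply: contraNneq (g'K i il) => ->.
  apply: contraNneq (nW p) => <-; rewrite inE; apply/orP; right.
  by apply/imsetP; exists (inord i); rewrite ?inordK.
- move=> i p il; apply: contraNneq (nU p) => <-.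
  have il' : i.-1 < l by lia.
  by apply/imsetP; exists (Ordinal il') => //=; rewrite prednK //; lia.
Qed.

Lemma card_bigcup_le (I V : finType) (S : {set I}) (F : I -> {set V}) b :
  (forall i, i \in S -> #|F i| <= b) -> #|\bigcup_(i in S) F i| <= #|S| * b.
Proof.
move=> le; rewrite -sum_nat_const.
apply: (big_ind2 (fun (X : {set V}) n => #|X| <= n)) => //; first by rewrite cards0.
move=> X m X' m' le1 le2; apply: leq_trans (leq_card_setU _ _) _; exact: leq_add.
Qed.

(** * Stars centred at vertices of bounded degree *)

Section OutsideStars.
Variables (V : finType) (r : nat) (H : {set {set V}}) (A : {set V}) (D : nat).
Hypothesis unif : forall h, h \in H -> #|h| = r.
Hypothesis degO : forall v, v \notin A -> #|inc H v| <= D.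

(** Outside [near S], the hyperedges at a vertex meet [S] only inside [A]. Vertices of [A] are left
    out because their degree is not bounded. *)
Definition near (S : {set V}) : {set V} :=
  \bigcup_(z in S :\: A) \bigcup_(h in inc H z) h.

Lemma card_near S : #|near S| <= #|S| * (D * r).
Proof.
apply: leq_trans (card_bigcup_le (b := D * r) _) _.
  move=> z; rewrite inE => /andP[zA _].
  apply: leq_trans (card_bigcup_le (b := r) _) _; last by rewrite leq_mul2r degO ?orbT.
  by move=> h; rewrite mem_inc => /andP[/unif->].
by rewrite leq_mul2r subset_leq_card ?orbT // subsetDl.
Qed.

Lemma notin_near S v h z :
  v \notin near S -> h \in H -> v \in h -> z \in h -> z \in S -> z \in A.
Proof.
move=> nv hH vh zh zS; apply: contraNT nv => zA.
apply/bigcupP; exists z; rewrite ?inE ?zA //.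
by apply/bigcupP; exists h; rewrite // mem_inc hH.
Qed.

Definition nbhd (v : V) : {set V} := \bigcup_(h in inc H v) h.

(** Each centre excludes the at most [(D * r) ^ 2] vertices two hyperedges away whose connecting
    vertex is outside [A]. Exclusion is symmetric, so a new centre does not spoil the earlier
    ones. *)
Lemma far_centres (C S : {set V}) k :
  C \subset ~: A ->
  #|S| * (D * r) + k * (D * r * (D * r)) < #|C| ->
  exists ctr : 'I_k -> V, forall c, [/\ ctr c \in C, ctr c \notin near S
    & forall c', c != c' -> ctr c \notin near (nbhd (ctr c'))].
Proof.
move=> sC; elim: k => [|k IH] lt.
  by have [v vC _] := pick_notin (leq_ltn_trans (card_near S) (leq_ltn_trans (leq_addr _ _) lt));
     exists (fun=> v) => -[].
have [|ctr hctr] := IH; first by apply: leq_ltn_trans lt; rewrite leq_add2l leq_mul2r leqnSn orbT.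
have nb v : v \in C -> #|near (nbhd v)| <= D * r * (D * r).
  move=> /(subsetP sC); rewrite inE => nA; apply: leq_trans (card_near _) _.
  rewrite leq_mul2r; apply/orP; right.
  apply: leq_trans (card_bigcup_le (b := r) _) _; last by rewrite leq_mul2r degO ?orbT.
  by move=> h; rewrite mem_inc => /andP[/unif->].
have [v vC] : exists2 v, v \in C &
    v \notin near S :|: \bigcup_(c in [set: 'I_k]) near (nbhd (ctr c)).
  apply: pick_notin; apply: leq_ltn_trans lt.
  apply: leq_trans (leq_card_setU _ _) _; apply: leq_add; first exact: card_near.
  apply: leq_trans (card_bigcup_le (b := D * r * (D * r)) _) _.
    by move=> c _; apply: nb; have [] := hctr c.
  by rewrite cardsT card_ord leq_mul2r leqnSn orbT.
rewrite inE negb_or => /andP[nS nC].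
have nv c : v \notin near (nbhd (ctr c)).
  by apply: contra nC => h; apply/bigcupP; exists c; rewrite ?inE.
have nv' c : ctr c \notin near (nbhd v).
  have [cC _ _] := hctr c.
  apply: contra (nv c) => /bigcupP[z]; rewrite inE => /andP[zA /bigcupP[h]].
  rewrite mem_inc => /andP[hH vh] zh /bigcupP[h']; rewrite mem_inc => /andP[h'H zh'] ch'.
  apply/bigcupP; exists z; rewrite ?inE ?zA /=.
    by apply/bigcupP; exists h'; rewrite // mem_inc h'H.
  by apply/bigcupP; exists h; rewrite // mem_inc hH.
exists (fun c => if unlift ord_max c is Some c' then ctr c' else v) => c.
case: unliftP => [c' ->|->].
  have [h1 h2 h3] := hctr c'; split=> // c2 n2; case: unliftP => [c3 e3|e3] //.
  by apply: h3; apply: contraNneq n2 => ->; rewrite e3.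
split=> // c2 n2; case: unliftP => [c3 e3|e3] //.
by rewrite e3 eqxx in n2.
Qed.

End OutsideStars.

(** The hyperedges at far centres meet one another and the tree only inside [A]. Star leaves chosen
    outside [A] cannot collide, and [#|A| + l2.+1 <= r] leaves room for them. *)
Lemma berge_stars_outside (T : sgraph) l par sg (V : finType) r (H : {set {set V}})
    (O A : {set V}) D g phi (k l2 : nat) :
  0 < l -> @indexing T l par sg -> wemb par l H O g phi ->
  (forall h, h \in H -> #|h| = r) -> l < r -> 0 < l2 -> #|A| + l2.+1 <= r ->
  (forall v, v \notin A -> #|inc H v| <= D) ->
  l * r * (D * r) + k * (D * r * (D * r)) < #|[set v in ~: A | l2 <= #|inc H v|]| ->
  contains_berge (dunion T (copies k (star l2))) H.
Proof.
move=> l0 ix we unif lr l20 Ar degO cnt.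
have it := ix_itree ix.
have [i _|h hH|g' [g'i g'in _]] := @wemb_full par l V H O set0 g phi l0 it we.
- by rewrite inE.
- by rewrite (unif h hH) cards0.
pose S := \bigcup_(i in [set: 'I_l]) phi i.+1.
have phiH (i : 'I_l) : phi i.+1 \in H by apply: (wemb_edge we); rewrite ltn_ord.
have cS : #|S| <= l * r.
  apply: leq_trans (card_bigcup_le (b := r) _) _; first by move=> i _; rewrite unif.
  by rewrite cardsT card_ord.
have inS i : 0 < i <= l -> phi i \subset S.
  move=> il; have il' : i.-1 < l by lia.
  have -> : i = (Ordinal il').+1 by rewrite /= prednK //; lia.
  by apply: (bigcup_sup (Ordinal il')).
have gS i : i <= l -> g' i \in S.
  case: i => [_|i il].
    have p1 : par 1 = 0 by have := it 1; lia.
    have [_] := g'in 1 ltac:(lia); rewrite p1; apply: (subsetP (inS 1 ltac:(lia))).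
  by have [+ _] := g'in i.+1 il; apply: (subsetP (inS i.+1 il)).
pose C := [set v in ~: A | l2 <= #|inc H v|].
have sC : C \subset ~: A by apply/subsetP=> v; rewrite inE => /andP[].
have [|ctr hctr] := far_centres unif degO (S := S) (k := k) sC.
  by apply: leq_ltn_trans cnt; rewrite leq_add2r leq_mul2r cS orbT.
have cA c : ctr c \notin A by have [/(subsetP sC)] := hctr c; rewrite inE.
have star c : exists hl : ('I_l2 -> {set V}) * ('I_l2 -> V),
    [/\ injective hl.1, injective hl.2 & forall j, [/\ hl.1 j \in inc H (ctr c),
      hl.2 j \in hl.1 j, hl.2 j \notin A & hl.2 j != ctr c]].
  have [] := hctr c; rewrite inE => /andP[_ dc] _ _.
  have [hs [hi hin]] : exists hs : 'I_l2 -> {set V},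
      {in setT &, injective hs} /\ forall j, j \in setT -> hs j \in inc H (ctr c).
    by apply: exists_inj_on set0 _ _ _; rewrite cardsT card_ord.
  have hin' j : hs j \in inc H (ctr c) by apply: hin; rewrite inE.
  have [j|lf [li lin lnc]] := @greedy_sdr 'I_l2 V (ctr c) (fun j => hs j :\: A) [set ctr c].
    rewrite cards1 card_ord; apply: leq_trans (leq_cardsD _ _).
    by move: (hin' j); rewrite mem_inc => /andP[/unif-> _]; move: Ar; lia.
  exists (hs, lf); split=> //=; first by move=> j j' e; apply: hi; rewrite ?inE.
  move=> j; split=> //; first by move: (lin j); rewrite inE => /andP[].
    by move: (lin j); rewrite inE => /andP[].
  by have := lnc j; rewrite inE.
have [hl hlP] := fin_all_exists star.
pose psi (p : 'I_k * 'I_l2) := (hl p.1).1 p.2.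
pose lf (p : 'I_k * 'I_l2) := (hl p.1).2 p.2.
have sP p : [/\ psi p \in H, ctr p.1 \in psi p, lf p \in psi p, lf p \notin A & lf p != ctr p.1].
  by have [_ _ /(_ p.2)[+ -> -> ->]] := hlP p.1; rewrite mem_inc => /andP[-> ->].
have sep c c' h h' z : c != c' -> h \in H -> h' \in H -> ctr c \in h -> ctr c' \in h' ->
    z \in h -> z \in h' -> z \in A.
  move=> nc hH h'H ch ch' zh zh'; have [_ _ /(_ c' nc) far] := hctr c.
  apply: (notin_near far hH ch zh); apply/bigcupP; exists h' => //.
  by rewrite mem_inc h'H.
have sepS c h z : h \in H -> ctr c \in h -> z \in h -> z \in S -> z \in A.
  by move=> hH ch zh zS; have [_ far _] := hctr c; apply: (notin_near far hH ch zh).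
apply: (@berge_with_stars T l par sg V H g' phi k l2 ctr lf psi) => //.
- by move=> i il; have [g1 g2] := g'in i il; rewrite (wemb_edge we).
- exact: wemb_phi_inj we.
- move=> c c' e; apply/eqP/negPn/negP=> nc.
  have [/(subsetP sC) _ _ /(_ c' nc)] := hctr c.
  have [] := hctr c'; rewrite inE => /andP[_ d'] _ _.
  have /card_gt0P[h] := leq_trans l20 d'.
  rewrite mem_inc => /andP[hH ch] _; case/negP: (cA c).
  by apply: (sep c c' h h) => //; rewrite e.
- move=> p q e; have [pH cp lp lA _] := sP p; have [qH cq lq _ _] := sP q.
  case: (eqVneq p.1 q.1) => [e1|ne].
    have [_ inj _] := hlP q.1; rewrite (surjective_pairing p) (surjective_pairing q) e1.
    by congr (_, _); apply: inj; move: e; rewrite /lf e1.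
  by case/negP: lA; apply: (sep _ _ _ _ _ ne pH qH) => //; rewrite e.
- move=> p q e; have [pH cp lp lA _] := sP p; have [qH cq lq _ _] := sP q.
  case: (eqVneq p.1 q.1) => [e1|ne].
    have [inj _ _] := hlP q.1; rewrite (surjective_pairing p) (surjective_pairing q) e1.
    by congr (_, _); apply: inj; move: e; rewrite /psi e1.
  by case/negP: lA; apply: (sep _ _ _ _ _ ne pH qH) => //; rewrite -e.
- by move=> p; have [] := sP p.
- move=> c p; have [pH cp lp lA nlc] := sP p.
  case: (eqVneq p.1 c) => [<-|ne]; first by rewrite eq_sym.
  apply/negP=> /eqP e; case/negP: (cA c).
  by apply: (sep _ _ _ _ _ ne pH pH); rewrite // e.
- move=> i il; split=> [c|p].
    apply/negP=> /eqP e; case/negP: (cA c); rewrite -e.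
    have [j jl gj] : exists2 j, 0 < j <= l & g' i \in phi j.
      case: (posnP i) => [->|i0]; last by exists i; [lia|have [] := g'in i ltac:(lia)].
      have p1 : par 1 = 0 by have := it 1; lia.
      by exists 1; [lia|have [_] := g'in 1 ltac:(lia); rewrite p1].
    apply: (sepS c (phi j)) => //; rewrite ?(wemb_edge we) -?e //.
    exact: gS.
  apply/negP=> /eqP e; have [pH cp lp lA _] := sP p; case/negP: lA.
  by apply: (sepS _ _ _ pH cp lp); rewrite -e gS.
- move=> i p il; apply/negP=> /eqP e; have [pH cp lp lA _] := sP p; case/negP: lA.
  by apply: (sepS _ _ _ pH cp lp); apply: (subsetP (inS i il)); rewrite e.
Qed.

(** * Orderings of the vertices of a tree *)

Section Rooted.
Variable T : sgraph.
Hypothesis treeT : is_tree T.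

Lemma acyclic_edge (y z : T) : sadj y z ->
  ~~ connect (fun a b => sadj a b && ([set a; b] != [set y; z])) y z.
Proof.
move=> yz; set e := fun _ _ => _; apply/negP=> /connectP[p pth].
case: (shortenP pth) => q qth uq _ lst.
have [_ /(_ (y :: q))] := treeT.
have sub : path (@sadj T) y q by apply: sub_path qth => a b /andP[].
case: q qth uq lst sub => [|a [|b q]] qth uq lst sub.
- by move=> _; move: yz; rewrite lst sadj_irrefl.
- by move: lst qth => /= <-; rewrite /e eqxx andbF.
move=> /(_ isT); rewrite uq andbT => /negP[].
have -> : cycle (@sadj T) [:: y, a, b & q] = path (@sadj T) y (rcons [:: a, b & q] y) by [].
by rewrite rcons_path sub -lst sadj_sym.
Qed.

(** [dep] is the distance to [x], and [pi] picks a neighbour closer to [x]. An edge not of the form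
    [v], [pi v] would be bypassed by the ancestor paths of its two ends, against [acyclic_edge]. *)
Lemma rooted (x : T) : exists (pi : T -> T) (dep : T -> nat),
  [/\ forall y, y != x -> sadj y (pi y) /\ dep (pi y) < dep y
    & forall y z, sadj y z -> (y != x /\ pi y = z) \/ (z != x /\ pi z = y)].
Proof.
have [[_ conn] _] := treeT.
pose reach n (y : T) := [exists p : n.-tuple T, path (@sadj T) y p && (last y p == x)].
have ex y : exists n, reach n y.
  have /connectP[p pth lst] := conn y x.
  by exists (size p); apply/existsP; exists (in_tuple p); rewrite pth -lst eqxx.
pose dep y := ex_minn (ex y).
have step y : exists z, y != x -> sadj y z /\ dep z < dep y.
  case: (eqVneq y x) => [_|ne]; first by exists y.
  rewrite {2}/dep; case: ex_minnP => n /existsP[p /andP[pth /eqP lst]] _.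
  case: n p pth lst => [|n] p; first by rewrite (tuple0 p) /= => _ e; rewrite e eqxx in ne.
  case/tupleP: p => z p /= /andP[yz pth] lst; exists z => _; split=> //.
  rewrite /dep; case: ex_minnP => n' _ min; rewrite ltnS; apply: min.
  by apply/existsP; exists p; rewrite pth lst eqxx.
have [pi hpi] := fin_all_exists step.
exists pi, dep; split=> // y z yz.
case: (boolP ((y != x) && (pi y == z))) => [/andP[? /eqP ?]|n1]; first by left.
case: (boolP ((z != x) && (pi z == y))) => [/andP[? /eqP ?]|n2]; first by right.
case/negP: (acyclic_edge yz); set e := fun _ _ => _.
have esym : symmetric e by move=> a b; rewrite /e sadj_sym [[set b; a]]setUC.
have up w : connect e w x.
  have [n] := ubnP (dep w); elim: n w => // n IH w /ltnSE lew.
  case: (eqVneq w x) => [->|ne]; first exact: connect0.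
  have [ww lt] := hpi w ne.
  apply: connect_trans (IH (pi w) (leq_trans lt lew)); apply: connect1.
  rewrite /e ww /=; apply/negP=> /eqP E.
  have wy : w \in [set y; z] by rewrite -E !inE eqxx.
  have pw : pi w \in [set y; z] by rewrite -E !inE eqxx orbT.
  have nw : pi w != w by apply: contraTneq ww => ->; rewrite sadj_irrefl.
  move: wy pw nw; rewrite !inE => /orP[]/eqP ew /orP[]/eqP ep; rewrite ?ep ?ew ?eqxx //.
    by move=> _; case/negP: n1; rewrite -ew ne ep eqxx.
  by move=> _; case/negP: n2; rewrite -ew ne ep eqxx.
by apply: connect_trans (up y) _; rewrite (sym_connect_sym esym) up.
Qed.

Section Order.
Variables (x : T) (pi : T -> T) (key : T -> nat) (l : nat).
Hypothesis pi_adj : forall y, y != x -> sadj y (pi y).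
Hypothesis adj_pi : forall y z, sadj y z ->
  (y != x /\ pi y = z) \/ (z != x /\ pi z = y).
Hypothesis key_pi : forall y, y != x -> key (pi y) < key y.
Hypothesis size_T : #|sedges T| = l.

Lemma key_root y : y != x -> key x < key y.
Proof.
have [n] := ubnP (key y); elim: n y => // n IH y /ltnSE ley ne.
have lt := key_pi ne; case: (eqVneq (pi y) x) => [<-//|ne'].
exact: ltn_trans (IH _ (leq_trans lt ley) ne') lt.
Qed.

(** The vertices are sorted by [key]. Any key that grows away from the root will do, and the choice
    of key produces the special orders needed later. *)
Lemma tree_indexing : exists (par : nat -> nat) (sg : nat -> T),
  [/\ indexing l par sg, sg 0 = x,
      forall i j, i <= j <= l -> key (sg i) <= key (sg j)
    & forall i, 0 < i <= l -> pi (sg i) = sg (par i)].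
Proof.
pose leK := relpre key leq.
have totK : total leK by move=> a b; apply: leq_total.
have trK : transitive leK by move=> a b c; apply: leq_trans.
pose s := sort leK (enum T).
have us : uniq s by rewrite sort_uniq enum_uniq.
have ss : size s = #|T| by rewrite size_sort cardE.
have ms y : y \in s by rewrite mem_sort mem_enum.
have srt : sorted leK s by apply: sort_sorted.
pose sg i := nth x s i; pose par i := index (pi (sg i)) s.
pose N := #|T|.-1.
have Tgt : 0 < #|T| by apply/card_gt0P; exists x.
have ltN i : i <= N -> i < size s by rewrite ss /N; lia.
have idN y : index y s <= N by have := ms y; rewrite -index_mem ss /N; lia.
have sgI y : sg (index y s) = y by apply: nth_index.
have inj i j : i <= N -> j <= N -> sg i = sg j -> i = j.
  by move=> iN jN /eqP; rewrite nth_uniq ?ltN // => /eqP.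
have mono i j : i <= j <= N -> key (sg i) <= key (sg j).
  move=> /andP[ij jN].
  have := sorted_leq_nth trK (fun a => leqnn (key a)) x srt.
  by move=> /(_ i j); rewrite !inE !ltN //; [apply|apply: leq_trans jN].
have sg0 : sg 0 = x.
  apply/eqP/negPn/negP=> ne; have := key_root ne.
  rewrite ltnNge => /negP[]; rewrite -[X in _ <= key X]sgI; apply: mono; exact: idN.
have nx i : 0 < i <= N -> sg i != x.
  move=> /andP[i0 iN]; apply/negP=> /eqP e; have := inj i 0 iN (leq0n N).
  by rewrite e sg0 => /(_ erefl) ei; rewrite ei in i0.
have pisg i : pi (sg i) = sg (par i) by rewrite /par sgI.
have itN : itree par N.
  move=> i iN; rewrite ltnNge; apply/negP=> le.
  have := key_pi (nx i iN); rewrite pisg ltnNge => /negP[]; apply: mono.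
  by rewrite le idN.
have adjE i j : i <= N -> j <= N ->
    sadj (sg i) (sg j) = (0 < i) && (par i == j) || (0 < j) && (par j == i).
  move=> iN jN; apply/idP/idP.
    case/adj_pi=> [[ne e]|[ne e]]; apply/orP; [left|right]; apply/andP; split.
    - by rewrite lt0n; apply: contraNneq ne => ->; rewrite sg0.
    - by apply/eqP; apply: inj => //; rewrite ?idN // -pisg.
    - by rewrite lt0n; apply: contraNneq ne => ->; rewrite sg0.
    - by apply/eqP; apply: inj => //; rewrite ?idN // -pisg.
  case/orP=> /andP[i0 /eqP <-]; rewrite -pisg.
    by apply: pi_adj; apply: nx; rewrite i0.
  by rewrite sadj_sym; apply: pi_adj; apply: nx; rewrite i0.
have parN i : par i <= N by apply: idN.
have Nl : N = l.
  rewrite -size_T.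
  pose ed (i : 'I_N) := [set sg i.+1; sg (par i.+1)].
  have edi : injective ed.
    suff le (i j : 'I_N) : ed i = ed j -> i <= j.
      by move=> i j e; apply: val_inj; apply/eqP; rewrite eqn_leq !le.
    move=> e; have : sg i.+1 \in ed j by rewrite -e !inE eqxx.
    have jN : j.+1 <= N by apply: ltn_ord.
    have iN : i.+1 <= N by apply: ltn_ord.
    rewrite !inE => /orP[]/eqP/inj; move=> /(_ iN).
      by move=> /(_ jN)[->].
    by move=> /(_ (parN _)) e'; have := itN j.+1; lia.
  rewrite -[LHS]card_ord -cardsT -(card_imset _ edi); apply: eq_card => e.
  apply/imsetP/imset2P=> [[i _ ->]|[y z _]].
    exists (sg i.+1) (sg (par i.+1)) => //; rewrite !inE /= adjE ?parN ?ltn_ord //.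
    by rewrite eqxx.
  rewrite inE => /andP[_ yz] ->; move: yz; rewrite -(sgI y) -(sgI z) adjE //.
  have hN k : 0 < k -> k <= N -> k.-1 < N by lia.
  case/orP=> /andP[i0 /eqP e'].
    exists (Ordinal (hN _ i0 (idN y))) => //.
    by rewrite /ed /= prednK // e'.
  exists (Ordinal (hN _ i0 (idN z))) => //.
  by rewrite /ed /= prednK // e' setUC.
exists par, sg; rewrite -Nl; split=> //.
by split=> // y; exists (index y s).
Qed.

End Order.

Variable l : nat.
Hypothesis size_T : #|sedges T| = l.
Hypothesis not_star : ~ isomorphic T (star l).

Lemma not_star_par par (sg : nat -> T) : indexing l par sg ->
  exists2 i, 0 < i <= l & par i != 0.
Proof.
move=> ix; case: (boolP (has (fun i => par i != 0) (iota 1 l))) => [/hasP[i]|no].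
  by rewrite mem_iota => il pi; exists i => //; lia.
case: not_star.
have p0 i : 0 < i <= l -> par i = 0.
  move=> il; apply/eqP/negPn/negP=> ne; case/negP: no; apply/hasP; exists i => //.
  by rewrite mem_iota; lia.
pose h (o : option 'I_l) : T := if o is Some i then sg i.+1 else sg 0.
pose ix_ (o : option 'I_l) : nat := if o is Some i then i.+1 else 0.
have hE o : h o = sg (ix_ o) by case: o.
have ixl o : ix_ o <= l by case: o => [i|] //=.
have ixi : injective ix_ by move=> [i|] [j|] //= [e]; congr Some; apply: val_inj.
have hi : injective h by move=> o o'; rewrite !hE => /(ix_inj ix (ixl o) (ixl o'))/ixi.
have surj y : exists o, h o == y.
  have [[|i] il <-] := ix_surj ix y; first by exists None.
  by exists (Some (Ordinal il)).
pose f y := xchoose (surj y).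
have hf y : h (f y) = y by apply/eqP; exact: (xchooseP (surj y)).
have fh o : f (h o) = o by apply: hi; rewrite hf.
exists f; split; first by exists h.
move=> y z; rewrite -{2}(hf y) -{2}(hf z) !hE (ix_adj ix) //=.
move: (f y) (f z) => [i|] [j|] //=; rewrite /star_adj //= ?p0 //; by rewrite ltn_ord.
Qed.

Definition endpoint (y z : T) := [/\ sadj y z, exists2 w, w != y & sadj z w,
  forall c, sadj y c -> c != z -> forall w, sadj c w -> w = y
  & exists2 c, c != z & sadj y c].

Definition end_leaves (y z : T) := [set c | sadj y c & c != z].

(** [y] is a deepest vertex other than the root that has a child; one exists because the tree is not
    a star. *)
Lemma rooted_end (x : T) : exists y z, y != x /\
  [/\ sadj y z, forall c, sadj y c -> c != z -> forall w, sadj c w -> w = y,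
      exists2 c, c != z & sadj y c
    & z != x -> exists2 w, w != y & sadj z w].
Proof.
have [pi [dep [hpi adj_pi]]] := rooted x.
have [par [sg [ix sg0 _ pisg]]] := tree_indexing (fun y ne => (hpi y ne).1) adj_pi
  (fun y ne => (hpi y ne).2) size_T.
have [i il pi0] := not_star_par ix.
have nx0 j : 0 < j <= l -> sg j != x.
  move=> /andP[j0 jl]; apply/negP=> /eqP; rewrite -sg0 => /(ix_inj ix jl (leq0n l)) ej.
  by rewrite ej in j0.
have pil : 0 < par i <= l by have := ix_itree ix il; move: pi0; lia.
pose ok y := (y != x) && [exists c, (c != x) && (pi c == y)].
have ok0 : ok (sg (par i)).
  by rewrite /ok nx0 //; apply/existsP; exists (sg i); rewrite nx0 // pisg // eqxx.
case: (arg_maxnP dep ok0) => y /andP[yx /existsP[c /andP[cx /eqP pc]]] maxy.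
have [yp ltp] := hpi y yx.
exists y, (pi y); split=> //; split=> //.
- move=> d yd ne w dw.
  case: (adj_pi _ _ yd) => [[_ e]|[dx pd]]; first by rewrite e eqxx in ne.
  case: (adj_pi _ _ dw) => [[_ <-]//|[wx pw]].
  have okd : ok d by rewrite /ok dx; apply/existsP; exists w; rewrite wx pw eqxx.
  have : dep d <= dep y := maxy d okd.
  by rewrite leqNgt -pd (hpi d dx).2.
- exists c; last by rewrite sadj_sym -pc; have [] := hpi c cx.
  by apply: contraTneq ltp => <-; rewrite -leqNgt -pc ltnW // (hpi c cx).2.
move=> zx; exists (pi (pi y)); last by have [] := hpi _ zx.
apply: contraTneq (ltn_trans (hpi _ zx).2 ltp) => ->; by rewrite ltnn.
Qed.

(** Rooting at the end just found yields a different one. The first, [y1], may lack a continuation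
    beyond [z1] and only serves as a root. The leaf sets of the endpoints [y2] and [y3] are disjoint
    and contain neither endpoint, so together they have at most [l.-1] elements and the smaller at
    most half of that. *)
Lemma endpoint_exists : exists y z, endpoint y z /\ 2 * #|end_leaves y z| <= l.-1.
Proof.
have [x _] : exists x : T, x \in T.
  by have [[/card_gt0P[x xT] _] _] := treeT; exists x.
have [y1 [z1 [_ [a1 b1 c1 _]]]] := rooted_end x.
have next y z : sadj y z ->
    (forall c, sadj y c -> c != z -> forall w, sadj c w -> w = y) ->
    (exists2 c, c != z & sadj y c) -> exists y' z', y' != y /\ endpoint y' z'.
  move=> yz lfy [c cz yc].
  have [y' [z' [ne [a' b' c' d']]]] := rooted_end y.
  exists y', z'; split=> //; split=> //.
  case: (eqVneq z' y) => [ez|nz]; last exact: d'.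
  rewrite ez; exists c => //; apply/negP=> /eqP ec.
  have [d dz y'd] := c'; have := lfy c yc cz d; rewrite ec => /(_ y'd) ed.
  by rewrite ed ez eqxx in dz.
have [y2 [z2 [_ e2]]] := next _ _ a1 b1 c1.
have [a2 w2 b2 c2] := e2.
have [y3 [z3 [n3 e3]]] := next _ _ a2 b2 c2.
have [a3 w3 b3 c3] := e3.
suff le : #|end_leaves y2 z2| + #|end_leaves y3 z3| <= l.-1.
  case: (leqP #|end_leaves y2 z2| #|end_leaves y3 z3|) => lt.
    by exists y2, z2; split=> //; slia.
  by exists y3, z3; split=> //; slia.
have nl y z y' z' : endpoint y z -> endpoint y' z' -> y' \notin end_leaves y z.
  move=> [a w b c] [a' w' b' [d dz yd]]; rewrite inE; apply/negP=> /andP[yy' y'z].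
  have f1 := b _ yy' y'z d yd; have f2 := b _ yy' y'z z' a'.
  by rewrite f1 f2 eqxx in dz.
have dis : end_leaves y2 z2 :&: end_leaves y3 z3 = set0.
  apply/setP=> c; rewrite !inE; apply/negbTE/negP=> /andP[/andP[y2c cz2] /andP[y3c cz3]].
  have e := b2 _ y2c cz2 y3; rewrite sadj_sym y3c in e.
  by move: n3; rewrite e ?eqxx.
have cT : #|T| <= l.+1.
  have [pi [dep [hpi adj_pi]]] := rooted x.
  have [par [sg [ix _ _ _]]] := tree_indexing (fun y ne => (hpi y ne).1) adj_pi
    (fun y ne => (hpi y ne).2) size_T.
  rewrite -cardsT -[l.+1]card_ord.
  apply: leq_trans (leq_imset_card (fun i : 'I_l.+1 => sg i) predT).
  apply: subset_leq_card; apply/subsetP=> y _; have [i il <-] := ix_surj ix y.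
  by apply/imsetP; exists (Ordinal (n := l.+1) (m := i) il).
have := subset_leq_card (subsetT ([set y2; y3] :|: (end_leaves y2 z2 :|: end_leaves y3 z3))).
rewrite cardsT cardsU (_ : [set y2; y3] :&: _ = set0); last first.
  apply/setP=> y; rewrite [in LHS]inE in_set2 in_setU in_set0.
  by case: eqP => [->|_] /=; rewrite ?(negbTE (nl _ _ _ _ e2 e2)) ?(negbTE (nl _ _ _ _ e3 e2)) //;
     case: eqP => [->|//] /=; rewrite ?(negbTE (nl _ _ _ _ e2 e3)) ?(negbTE (nl _ _ _ _ e3 e3)).
rewrite cards0 subn0 cards2 eq_sym n3 cardsU dis cards0 subn0; move: cT; slia.
Qed.

End Rooted.

(** [top i] is the ancestor of [i], possibly [i] itself, nearest to the root among those outside the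
    initial segment [0, ..., t - 1]; it names the branch containing [i]. *)
Record branching (par : nat -> nat) (l t : nat) (top : nat -> nat) : Prop := Branching {
  br_le : forall i, t <= i <= l -> t <= top i <= i;
  br_top : forall i, t <= i <= l -> par (top i) < t;
  br_idem : forall i, t <= i <= l -> top (top i) = top i;
  br_par : forall i, t <= i <= l -> top i = i \/ (t <= par i /\ top (par i) = top i)
}.

Lemma branching_exists par l t : itree par l -> 0 < t ->
  exists top, branching par l t top.
Proof.
move=> it t0.
suff [top hop] : exists top : nat -> nat, forall i, t <= i <= l ->
    top i = if par i < t then i else top (par i).
  have P i : t <= i <= l -> [/\ t <= top i <= i, par (top i) < t & top (top i) = top i].
    have [n] := ubnP i; elim: n i => // n IH i /ltnSE lei hi.
    have lt := it i ltac:(slia).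
    rewrite (hop i hi); case: ltnP => tp; last first.
      by have [h1 h2 h3] := IH (par i) ltac:(slia) ltac:(slia); split=> //; slia.
    by rewrite tp (hop i hi) tp; split=> //; slia.
  exists top; split=> i hi; try by have [] := P i hi.
  by rewrite (hop i hi); case: ltnP => tp; [left|right].
suff : forall n, n <= l.+1 -> exists top : nat -> nat, forall i, t <= i < n ->
    top i = if par i < t then i else top (par i) by move=> /(_ l.+1 (leqnn _)).
elim=> [_|n IH lt]; first by exists id => i; slia.
have [top hop] := IH (ltnW lt).
exists (fun i => if i == n then (if par n < t then n else top (par n)) else top i) => i hi.
case: (eqVneq i n) => [->|ne].
  case: ltnP => // tp; have := it n ltac:(slia).
  by case: eqP => // e; slia.
have lti := it i ltac:(slia).
rewrite hop; last by slia.
case: ltnP => // tp.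
by case: eqP => // e; slia.
Qed.

(* The path [0 - 1 - ... - l] listed as [2, 3, ..., l, 1, 0], so that an initial
   segment leaves a part of two edges on one side and the rest on the other. *)
Definition path_shift l p := if p <= l - 2 then p.+2 else if p == l.-1 then 1 else 0.
Definition path_par l p := if p == l.-1 then 0 else p.-1.

Section PathShift.
Variable l : nat.
Hypothesis l3 : 3 <= l.

Lemma path_shift_le p : p <= l -> path_shift l p <= l.
Proof. by rewrite /path_shift; case: (leqP p (l - 2)); case: (eqVneq p l.-1); lia. Qed.

Lemma path_par_itree : itree (path_par l) l.
Proof. by move=> p; rewrite /path_par; case: (eqVneq p l.-1); lia. Qed.

Lemma path_shift_inj p q : p <= l -> q <= l -> path_shift l p = path_shift l q -> p = q.
Proof.
by rewrite /path_shift; case: (leqP p (l - 2)); case: (eqVneq p l.-1);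
  case: (leqP q (l - 2)); case: (eqVneq q l.-1); lia.
Qed.

Lemma path_shift_surj i : i <= l -> exists2 p, p <= l & path_shift l p = i.
Proof.
rewrite /path_shift; case: i => [|[|i]] il.
- by exists l => //; case: (leqP l (l - 2)); case: (eqVneq l l.-1); lia.
- by exists l.-1; [lia|rewrite eqxx; case: (leqP l.-1 (l - 2)); lia].
- by exists i; [lia|case: (leqP i (l - 2)); lia].
Qed.

Lemma path_shift_adj p q : p <= l -> q <= l ->
  (path_shift l p == (path_shift l q).+1) || (path_shift l q == (path_shift l p).+1) =
  (0 < p) && (path_par l p == q) || (0 < q) && (path_par l q == p).
Proof.
by rewrite /path_shift /path_par; case: (leqP p (l - 2)); case: (eqVneq p l.-1);
  case: (leqP q (l - 2)); case: (eqVneq q l.-1); lia.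
Qed.

Lemma path_branching t : 0 < t <= l - 2 ->
  branching (path_par l) l t (fun i => if i < l.-1 then t else l.-1).
Proof.
move=> tl; split=> i hi; rewrite /path_par; case: (ltnP i l.-1) => hil; rewrite ?ltnn ?eqxx.
- by lia.
- by lia.
- by case: (eqVneq t l.-1); lia.
- by lia.
- by case: (ltnP t l.-1); lia.
- by [].
- case: (eqVneq i t) => [->|ne]; [by left|right].
  by case: (eqVneq i l.-1); case: (ltnP i.-1 l.-1); lia.
case: (eqVneq i l.-1) => [->|ne]; [by left|right].
by case: (ltnP i.-1 l.-1); lia.
Qed.

End PathShift.

Section TreeOrders.
Variables (T : sgraph) (l : nat).
Hypothesis treeT : is_tree T.
Hypothesis size_T : #|sedges T| = l.
Hypothesis not_star : ~ isomorphic T (star l).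
Hypothesis l3 : 3 <= l.

Lemma bent_indexing : exists (par : nat -> nat) (sg : nat -> T),
  [/\ indexing l par sg, bent_tree par l & 2 * #|root_leaves par l| <= l.-1].
Proof.
have [y [z [[yz [w wy zw] lfy [c cz yc]] le]]] := endpoint_exists treeT size_T not_star.
have [pi [dep [hpi adj_pi]]] := rooted treeT y.
have adjn a b : sadj a b -> a != b by apply: contraTneq => ->; rewrite sadj_irrefl.
have [zy piz] : z != y /\ pi z = y.
  by case: (adj_pi _ _ yz) => [[]|//]; rewrite eqxx.
have [cy pic] : c != y /\ pi c = y.
  by case: (adj_pi _ _ yc) => [[]|//]; rewrite eqxx.
have piw : pi w = z.
  by case: (adj_pi _ _ zw) => [[_ e]|[]//]; rewrite piz in e; rewrite e eqxx in wy.
have wz : w != z by rewrite eq_sym adjn.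
have wc : c != w.
  apply: contraNneq zy => ec; apply/eqP/(lfy c yc cz).
  by rewrite ec sadj_sym.
(* The shift by 3 reserves the keys 0, 1, 2 for [y], [z], [w]; [B] exceeds all other keys and puts
   the leaf [c] last. *)
pose B := \max_v dep v + 4.
have depB v : dep v + 3 < B.
  by apply: (@leq_ltn_trans (\max_v dep v + 3)); rewrite ?ltn_add2l // leq_add2r; apply: leq_bigmax.
pose key v := if v == y then 0 else if v == z then 1 else if v == w then 2 else
  if v == c then B else dep v + 3.
have keyy : key y = 0 by rewrite /key eqxx.
have keyz : key z = 1 by rewrite /key (negbTE zy) eqxx.
have keyw : key w = 2 by rewrite /key (negbTE wy) (negbTE wz) eqxx.
have keyc : key c = B by rewrite /key (negbTE cy) (negbTE cz) (negbTE wc) eqxx.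
have keyo v : v != y -> v != z -> v != w -> v != c -> key v = dep v + 3.
  by rewrite /key => /negbTE-> /negbTE-> /negbTE-> /negbTE->.
have B3 : 3 < B by rewrite /B; slia.
have key_pi v : v != y -> key (pi v) < key v.
  move=> vy; case: (eqVneq v z) => [->|vz]; first by rewrite piz keyy keyz.
  case: (eqVneq v w) => [->|vw]; first by rewrite piw keyw keyz.
  case: (eqVneq v c) => [->|vc]; first by rewrite pic keyy keyc; slia.
  rewrite (keyo v) //; have [vp lt] := hpi v vy.
  case: (eqVneq (pi v) y) => [->|py]; first by rewrite keyy addn3.
  case: (eqVneq (pi v) z) => [->|pz]; first by rewrite keyz addn3.
  case: (eqVneq (pi v) w) => [->|pw]; first by rewrite keyw addn3.
  case: (eqVneq (pi v) c) => [ec|pc]; last by rewrite keyo // ltn_add2r.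
  by case/eqP: vy; apply: (lfy c) => //; rewrite -ec sadj_sym.
have [par [sg [ix sg0 mono pisg]]] := tree_indexing (fun v ne => (hpi v ne).1) adj_pi
  key_pi size_T.
have it := ix_itree ix.
have sgi i j : i <= l -> j <= l -> sg i = sg j -> i = j by apply: (ix_inj ix).
have key_inj u : key u < 3 -> [\/ u = y, u = z | u = w].
  case: (eqVneq u y) => [|uy]; first by constructor 1.
  case: (eqVneq u z) => [|uz]; first by constructor 2.
  case: (eqVneq u w) => [|uw]; first by constructor 3.
  case: (eqVneq u c) => [->|uc]; first by rewrite keyc; slia.
  by rewrite keyo // addnC.
have sg1 : sg 1 = z.
  have [j jl ej] := ix_surj ix z.
  have j0 : 0 < j by rewrite lt0n; apply: contraNneq zy => e; rewrite -ej e sg0.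
  have := mono 1 j; rewrite j0 jl ej keyz => /(_ isT) k1.
  case: (key_inj (sg 1) ltac:(slia)) => // e.
    by have := sgi 1 0 ltac:(slia) ltac:(slia); rewrite e sg0 => /(_ erefl).
  by move: k1; rewrite e keyw.
have sg2 : sg 2 = w.
  have [j jl ej] := ix_surj ix w.
  have j1 : 1 < j.
    case: j jl ej => [|[|j]] // jl ej; first by rewrite -ej sg0 eqxx in wy.
    by rewrite -ej sg1 eqxx in wz.
  have := mono 2 j; rewrite j1 jl ej keyw => /(_ isT) k2.
  case: (key_inj (sg 2) ltac:(slia)) => // e.
    by have := sgi 2 0 ltac:(slia) ltac:(slia); rewrite e sg0 => /(_ erefl).
  by have := sgi 2 1 ltac:(slia) ltac:(slia); rewrite e sg1 => /(_ erefl).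
have sgl : sg l = c.
  have [j jl ej] := ix_surj ix c.
  have := mono j l; rewrite jl leqnn ej keyc => /(_ isT) kl.
  apply/eqP/negPn/negP=> ne; move: kl; rewrite leqNgt => /negP[].
  have := depB (sg l); rewrite /key (negbTE ne); move: B3.
  by case: ifP => _; [slia|case: ifP => _; [slia|case: ifP => _; slia]].
have parI i j : 0 < i <= l -> j <= l -> pi (sg i) = sg j -> par i = j.
  move=> il jl e; apply: sgi => //; last by rewrite -pisg.
  by have := it i il; slia.
have leafI i : 1 < i <= l -> par i = 0 -> forall u, sadj (sg i) u -> u = y.
  move=> il p0; apply: lfy.
    by rewrite -sg0 (ix_adj ix) //; [rewrite p0 eqxx; slia|slia].
  by rewrite -sg1; apply/negP=> /eqP /sgi e; have := e ltac:(slia) ltac:(slia); slia.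
exists par, sg; split=> //.
  split=> //.
  - by apply: parI; rewrite ?sg1 ?sg0 //; slia.
  - by apply: parI; rewrite ?sg2 ?sg1 //; slia.
  - by apply: parI; rewrite ?sgl ?sg0 //; slia.
  move=> i il p0; apply/negP=> /internalP[j jl pj].
  have e : sg j = y.
    apply: (leafI i) => //; rewrite (ix_adj ix) ?pj ?eqxx //; last by slia.
    + by rewrite orbC; have -> : 0 < j by slia.
    + by slia.
  by have := sgi j 0 ltac:(slia) ltac:(slia); rewrite e sg0 => /(_ erefl); slia.
apply: leq_trans le; rewrite leq_mul2l /=.
have si : {in root_leaves par l &, injective (fun i : 'I_l.+1 => sg i)}.
  by move=> i j _ _ /(sgi _ _ (ltn_ord i) (ltn_ord j)) e; apply: val_inj.
rewrite -(card_in_imset si); apply: subset_leq_card; apply/subsetP=> u /imsetP[i].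
rewrite !inE => /andP[i1 /eqP p0] ->; apply/andP; split.
  have il : i <= l by rewrite -ltnS.
  by rewrite -sg0 (ix_adj ix) // p0 (ltnW i1).
rewrite -sg1; apply/negP=> /eqP /sgi e.
have := e (ltn_ord i) ltac:(slia); slia.
Qed.

Definition nbrs (v : T) := [set u | sadj v u].

(** Rooted at [x], non-leaves are listed by depth before all leaves. If the initial segment takes in
    every non-leaf, branches are single vertices. Otherwise each vertex of the segment has a child
    and the root has three, so at least three branches hang from it, and each misses at least two of
    the [l.+1 - t] remaining vertices. *)
Lemma branch_order_branched x t : 2 < #|nbrs x| -> 0 < t ->
  exists (par : nat -> nat) (sg : nat -> T) (top : nat -> nat) (t' : nat),
  [/\ indexing l par sg, 0 < t' <= t, branching par l t' top
    & forall b, #|[set i : 'I_l.+1 | (t' <= i) && (top i == b)]| <= maxn 2 (l - t - 1)].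
Proof.
move=> dx t0.
have [pi [dep [hpi adj_pi]]] := rooted treeT x.
pose B := (\max_v dep v).+1.
have depB v : dep v < B by rewrite ltnS; apply: leq_bigmax.
pose nl v := 1 < #|nbrs v|.
pose key v := if nl v then dep v else dep v + B.
have two v a b : a != b -> sadj v a -> sadj v b -> nl v.
  move=> ab va vb; apply: (@leq_trans #|[set a; b]|); first by rewrite cards2 ab.
  by apply: subset_leq_card; rewrite subUset !sub1set !inE va.
have nlpi v : v != x -> nl (pi v).
  move=> vx; have [vp lt] := hpi v vx.
  case: (eqVneq (pi v) x) => [->|px]; first by apply: ltnW.
  have [pp lt2] := hpi _ px.
  apply: (two _ v (pi (pi v))) => //; last by rewrite sadj_sym.
  by apply: contraTneq (ltn_trans lt2 lt) => <-; rewrite ltnn.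
have key_pi v : v != x -> key (pi v) < key v.
  move=> vx; rewrite /key nlpi //; have [_ lt] := hpi v vx.
  by case: ifP => _ //; apply: leq_trans lt (leq_addr _ _).
have [par [sg [ix sg0 mono pisg]]] := tree_indexing (fun v ne => (hpi v ne).1) adj_pi
  key_pi size_T.
have it := ix_itree ix.
have sgi i j : i <= l -> j <= l -> sg i = sg j -> i = j by apply: (ix_inj ix).
pose m := #|[set v | nl v]|.
have nl_lt i : i <= l -> i < m -> nl (sg i).
  move=> il; apply: contraTT => nli; rewrite -leqNgt.
  apply: (@leq_trans #|[set sg j | j : 'I_i]|); last first.
    by apply: leq_trans (leq_imset_card _ _) _; rewrite card_ord.
  apply: subset_leq_card; apply/subsetP=> v; rewrite inE => nlv.
  have [j jl ej] := ix_surj ix v; apply/imsetP.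
  case: (ltnP j i) => [ji|ij]; first by exists (Ordinal ji).
  have := mono i j; rewrite ij jl ej => /(_ isT).
  by rewrite /key (negbTE nli) nlv; have := depB v; slia.
have lt_nl i : i <= l -> nl (sg i) -> i < m.
  move=> il nli.
  have si : injective (fun j : 'I_i.+1 => sg j).
    move=> j j' /sgi e; apply: val_inj; apply: e; last by have := ltn_ord j'; slia.
    by have := ltn_ord j; slia.
  rewrite -[i.+1]card_ord -cardsT -(card_imset _ si).
  apply: subset_leq_card; apply/subsetP=> v /imsetP[j _ ->]; rewrite inE.
  have ji : j <= i by rewrite -ltnS.
  have := mono j i; rewrite ji il => /(_ isT); rewrite {2}/key nli /key.
  by case: ifP => // _; have := depB (sg i); slia.
have m0 : 0 < m by apply: lt_nl => //; rewrite sg0; apply: ltnW.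
have int_nl i : internal par l i -> nl (sg i).
  move=> /internalP[j jl <-]; rewrite -pisg //; apply: nlpi.
  by rewrite -sg0; apply/negP=> /eqP /sgi e; have := e ltac:(slia) ltac:(slia); slia.
have int_lt i : i <= l -> internal par l i -> i < m by move=> il /int_nl; apply: lt_nl.
have tm0 : 0 < minn t m by rewrite leq_min t0.
have [top br] := branching_exists it tm0.
exists par, sg, top, (minn t m); split=> //; first by rewrite tm0 geq_minl.
move=> b; rewrite leq_max.
case: (leqP m t) => [mt|tm].
  rewrite (minn_idPr mt) in br *; apply/orP; left; apply: (@leq_trans 1) => //.
  have e (i : 'I_l.+1) : m <= i -> top i = i.
    move=> mi; have il : m <= i <= l by rewrite mi -ltnS ltn_ord.
    case: (br_par br il) => // -[mp _].
    have i0 : 0 < i <= l by slia.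
    have lti := it i i0.
    by have := int_lt (par i) ltac:(slia) (@internal_par par l i i0); slia.
  apply/card_le1P=> i; rewrite inE => /andP[mi /eqP ti] j; rewrite !inE.
  apply/andP/eqP=> [[mj /eqP tj]|->]; last by rewrite mi ti eqxx.
  by apply: val_inj; rewrite /= -(e i mi) -(e j mj) ti.
rewrite (minn_idPl (ltnW tm)) in br *; apply/orP; right.
have ml : m <= l.+1.
  apply: (@leq_trans #|[set sg j | j : 'I_l.+1]|); last first.
    by apply: leq_trans (leq_imset_card _ _) _; rewrite card_ord.
  apply: subset_leq_card; apply/subsetP=> v _; have [j jl ej] := ix_surj ix v.
  by apply/imsetP; exists (Ordinal (n := l.+1) (m := j) jl).
pose ch j := [set i : 'I_l.+1 | (0 < i) && (par i == j)].
pose C j := [set i : 'I_l.+1 | (0 < i) && (par i < j)].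
have ch0 : 2 < #|ch 0|.
  apply: leq_trans dx _; apply: leq_trans (leq_imset_card (fun i : 'I_l.+1 => sg i) _).
  apply: subset_leq_card; apply/subsetP=> v; rewrite inE -sg0 => xv.
  have [i il ei] := ix_surj ix v; apply/imsetP.
  exists (Ordinal (n := l.+1) (m := i) il) => //; rewrite inE /=.
  by move: xv; rewrite -ei (ix_adj ix).
have chS j : 0 < j < m -> 0 < #|ch j|.
  move=> /andP[j0 jm]; have jl : j <= l by slia.
  have := nl_lt j jl jm; rewrite /nl.
  have sub : nbrs (sg j) \subset sg (par j) |: [set sg (i : 'I_l.+1) | i in ch j].
    apply/subsetP=> v; rewrite inE => jv; have [i il ei] := ix_surj ix v.
    move: jv; rewrite -ei (ix_adj ix) // j0 /= in_setU1 => /orP[/eqP->|/andP[i0 /eqP pj]].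
      by rewrite eqxx.
    apply/orP; right; apply/imsetP; exists (Ordinal (n := l.+1) (m := i) il) => //.
    by rewrite inE /= i0 pj eqxx.
  move=> lt2; have := leq_trans lt2 (subset_leq_card sub); rewrite cardsU1.
  have := leq_imset_card (fun i : 'I_l.+1 => sg i) (ch j).
  by case: (_ \notin _) => /=; slia.
have cC j : j < m -> j.+2 < #|C j.+1|.
  elim: j => [_|j IH jm].
    by apply: leq_trans ch0 _; apply: subset_leq_card; apply/subsetP=> i; rewrite !inE ltnS leqn0.
  have -> : C j.+2 = C j.+1 :|: ch j.+1.
    apply/setP=> i; rewrite !inE -andb_orr; congr (_ && _).
    by rewrite ltnS leq_eqVlt orbC.
  rewrite cardsU (_ : C j.+1 :&: ch j.+1 = set0); last first.
    by apply/setP=> i; rewrite !inE; apply/negbTE/negP=> /andP[/andP[_ lt] /andP[_ /eqP e]]; slia.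
  by rewrite cards0 subn0; have := IH (ltnW jm); have := chS j.+1 ltac:(slia); slia.
pose tops := [set i : 'I_l.+1 | (t <= i) && (par i < t)].
have ctops : 2 < #|tops|.
  have := cC t.-1 ltac:(slia); rewrite prednK // => ct.
  have sub : C t \subset tops :|: [set inord j.+1 | j : 'I_t.-1].
    apply/subsetP=> i; rewrite !inE => /andP[i0 pt]; rewrite pt andbT.
    case: (leqP t i) => //= it'; apply/imsetP.
    have h : i.-1 < t.-1 by slia.
    by exists (Ordinal h) => //=; rewrite prednK // inord_val.
  have := leq_trans ct (leq_trans (subset_leq_card sub) (leq_card_setU _ _)).
  have := leq_imset_card (fun j : 'I_t.-1 => inord j.+1 : 'I_l.+1) predT.
  by rewrite card_ord; slia.
have top_id (i : 'I_l.+1) : i \in tops -> top i = i.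
  rewrite inE => /andP[ti pt].
  by case: (br_par br (i := i)) => [|//|[]]; [rewrite ti -ltnS ltn_ord|slia].
set Sb := [set i : 'I_l.+1 | _].
have dis : Sb :&: [set i in tops | val i != b] = set0.
  apply/setP=> i; rewrite !inE; apply/negbTE/negP=> /andP[/andP[_ /eqP tb] /andP[it' /negP[]]].
  by rewrite -tb top_id // inE.
have c2 : 1 < #|[set i in tops | val i != b]|.
  have sub : tops \subset inord b |: [set i in tops | val i != b].
    apply/subsetP=> i it'; rewrite in_setU1 [in X in _ || X]inE it' /=.
    case: (eqVneq (val i) b) => [<-|]; last by rewrite orbT.
    by rewrite inord_val eqxx.
  have := leq_trans ctops (subset_leq_card sub); rewrite cardsU1.
  by case: (_ \notin _) => /=; slia.
have sub : Sb :|: [set i in tops | val i != b] \subset [set i : 'I_l.+1 | t <= i].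
  apply/subsetP=> i; rewrite !inE => /orP[/andP[]//|/andP[/andP[]//]].
have cge : #|[set i : 'I_l.+1 | t <= i]| <= l.+1 - t.
  have -> : [set i : 'I_l.+1 | t <= i] = ~: [set i : 'I_l.+1 | i < t].
    by apply/setP=> i; rewrite !inE -leqNgt.
  have si : injective (fun j : 'I_t => inord j : 'I_l.+1).
    by move=> j j' /(congr1 val); rewrite /= !inordK;
      [apply: val_inj|have := ltn_ord j'; slia|have := ltn_ord j; slia].
  have : t <= #|[set i : 'I_l.+1 | i < t]|.
    rewrite -[X in X <= _]card_ord -cardsT -(card_imset _ si).
    apply: subset_leq_card; apply/subsetP=> i /imsetP[j _ ->]; rewrite inE inordK //.
    by have := ltn_ord j; slia.
  by have := cardsC [set i : 'I_l.+1 | i < t]; rewrite card_ord; slia.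
have := subset_leq_card sub; rewrite cardsU dis cards0 subn0.
by move: c2 cge; slia.
Qed.

Lemma branch_order_path t : (forall x, #|nbrs x| <= 2) -> 0 < t <= l - 2 ->
  exists (par : nat -> nat) (sg : nat -> T) (top : nat -> nat) (t' : nat),
  [/\ indexing l par sg, 0 < t' <= t, branching par l t' top
    & forall b, #|[set i : 'I_l.+1 | (t' <= i) && (top i == b)]| <= maxn 2 (l - t - 1)].
Proof.
move=> d2 tl.
have [x0 _] : exists x : T, x \in T.
  by have [[/card_gt0P[x xT] _] _] := treeT; exists x.
have index_at x : exists (par : nat -> nat) (sg : nat -> T), indexing l par sg /\ sg 0 = x.
  have [pi [dep [hpi adj_pi]]] := rooted treeT x.
  have [par [sg [ix sg0 _ _]]] := tree_indexing (fun v ne => (hpi v ne).1) adj_pi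
    (fun y ne => (hpi y ne).2) size_T.
  by exists par, sg.
(* The vertex listed last has no child, so it is an end of the path. *)
have [x [u nx]] : exists x u : T, forall v, sadj x v -> v = u.
  have [par [sg [ix _]]] := index_at x0.
  exists (sg l), (sg (par l)) => v; have [i il <-] := ix_surj ix v.
  rewrite (ix_adj ix) // => /orP[/andP[_ /eqP->//]|/andP[i0 /eqP pi]].
  by have := ix_itree ix (i := i); slia.
have [par [sg [ix sg0]]] := index_at x.
have it := ix_itree ix.
have sgi i j : i <= l -> j <= l -> sg i = sg j -> i = j by apply: (ix_inj ix).
have pinj i j : 0 < i <= l -> 0 < j <= l -> par i = par j -> i = j.
  move=> il jl e; have iti := it i il; have itj := it j jl.
  have ad k : 0 < k <= l -> sadj (sg (par k)) (sg k).
    by move=> kl; rewrite (ix_adj ix); [rewrite eqxx andbT orbC; case/andP: kl => ->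
      |have := it k kl; slia|slia].
  case: (posnP (par i)) => [p0|p0].
    apply: sgi; [slia|slia|].
    have ai := ad i il; have aj := ad j jl.
    rewrite p0 sg0 in ai; rewrite -e p0 sg0 in aj.
    by rewrite (nx _ ai) (nx _ aj).
  apply/eqP/negPn/negP=> ne.
  have itp := it (par i) ltac:(slia).
  have ap : sadj (sg (par i)) (sg (par (par i))) by rewrite sadj_sym ad //; slia.
  have ne1 : sg i != sg j by apply/negP=> /eqP /sgi e1; case/eqP: ne; apply: e1; slia.
  have ne2 : sg (par (par i)) != sg i.
    by apply/negP=> /eqP /sgi e1; have := e1 ltac:(slia) ltac:(slia); slia.
  have ne3 : sg (par (par i)) != sg j.
    by apply/negP=> /eqP /sgi e1; have := e1 ltac:(slia) ltac:(slia); slia.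
  have := d2 (sg (par i)); rewrite leqNgt => /negP[].
  apply: (@leq_trans #|sg (par (par i)) |: [set sg i; sg j]|).
    by rewrite cardsU1 cards2 ne1 !inE negb_or ne2 ne3.
  apply: subset_leq_card; rewrite !subUset !sub1set !inE ap ad //=.
  by rewrite e ad.
have parE i : 0 < i <= l -> par i = i.-1.
  have [n] := ubnP i; elim: n i => // n IH i /ltnSE lei il; have iti := it i il.
  apply/eqP/negPn/negP=> ne.
  have e := IH (par i).+1 ltac:(slia) ltac:(slia).
  by have := pinj (par i).+1 i ltac:(slia) il; rewrite e /= => /(_ erefl); slia.
have adjE i j : i <= l -> j <= l -> sadj (sg i) (sg j) = (i == j.+1) || (j == i.+1).
  move=> il jl; rewrite (ix_adj ix) //; apply/idP/idP.
    by case/orP=> /andP[k0 /eqP]; rewrite parE; slia.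
  by case/orP=> /eqP e; apply/orP; [left|right]; rewrite e /= parE //=; slia.
pose sh := path_shift l; pose par' := path_par l.
have shl p : p <= l -> sh p <= l by apply: path_shift_le.
exists par', (sg \o sh), (fun i => if i < l.-1 then t else l.-1), t; split.
- split.
  + exact: path_par_itree.
  + by move=> p q pl ql /= /(sgi _ _ (shl p pl) (shl q ql)); apply: path_shift_inj.
  + move=> v; have [i il <-] := ix_surj ix v.
    by have [p pl ep] := path_shift_surj l3 il; exists p => //=; rewrite /sh ep.
  + by move=> p q pl ql /=; rewrite adjE ?shl //; apply: path_shift_adj.
- by slia.
- exact: path_branching.
move=> b; have cset (P : pred 'I_l.+1) a n : (forall i : 'I_l.+1, P i -> a <= i < a + n) ->
    #|[set i | P i]| <= n.
  move=> h; rewrite cardE -(size_map val) -[X in _ <= X](size_iota a).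
  apply: uniq_leq_size; first by rewrite map_inj_uniq ?enum_uniq //; apply: val_inj.
  by move=> k /mapP[i]; rewrite mem_enum inE => /h hi ->; rewrite mem_iota.
rewrite leq_max; case: (eqVneq b t) => [->|nb].
  apply/orP; right; apply: (cset _ t) => i /andP[ti].
  by case: (ltnP i l.-1) => ? /eqP ?; slia.
apply/orP; left; apply: (cset _ l.-1) => i /andP[ti].
by have := ltn_ord i; case: (ltnP i l.-1) => ? ? /eqP e; [rewrite e eqxx in nb|slia].
Qed.

Lemma branch_order t : 0 < t <= l - 2 ->
  exists (par : nat -> nat) (sg : nat -> T) (top : nat -> nat) (t' : nat),
  [/\ indexing l par sg, 0 < t' <= t, branching par l t' top
    & forall b, #|[set i : 'I_l.+1 | (t' <= i) && (top i == b)]| <= maxn 2 (l - t - 1)].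
Proof.
move=> tl; case: (boolP [exists x, 2 < #|nbrs x|]) => [/existsP[x dx]|no].
  by apply: branch_order_branched dx _; slia.
apply: branch_order_path => // x; rewrite leqNgt.
by apply: contra no => dx; apply/existsP; exists x.
Qed.

Lemma some_indexing : exists (par : nat -> nat) (sg : nat -> T), indexing l par sg.
Proof. by have [par [sg []]] := bent_indexing; exists par, sg. Qed.

End TreeOrders.

(** * Dense cores *)

Section DenseCore.
Variables (V : finType) (A : {set V}) (L Lm rho1 o0 a t : nat).
Implicit Types (E Y : {set {set V}}).
Local Notation O := (~: A).
Local Notation j := (L - a).
Hypothesis a0 : 0 < a.
Hypothesis aL : a <= L.
Hypothesis LLm : L <= Lm.
Hypothesis Lrho : L <= rho1.
Hypothesis jo0 : j <= o0.
Hypothesis star_ineq : a * rho1 <= Lm * (o0 - j).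

(** [Lm / rho1] is the density aimed at. Only hyperedges with at least [t] vertices in [A] may have
    fewer than [rho1] vertices outside. *)
Definition sparse_host E :=
  [/\ forall v, v \notin A -> #|inc E v| <= L,
      forall h, h \in E -> o0 <= #|h :&: O|
    & forall h, h \in E -> #|h :&: A| < t -> rho1 <= #|h :&: O|].

Lemma sparse_hostS E E' : E' \subset E -> sparse_host E -> sparse_host E'.
Proof.
move=> s [h1 h2 h3]; split.
- by move=> v vA; apply: leq_trans (h1 v vA); apply: subset_leq_card; apply: incS.
- by move=> h /(subsetP s); apply: h2.
- by move=> h /(subsetP s); apply: h3.
Qed.

(** All that the greedy embedding of a branch rooted at [v0] requires: minimum degree above [a] and
    a matching that spares [v0]. [f] is the hyperedge through which the branch is joined to vertices
    of [A]. *)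
Definition rooted_core E (X : {set V}) Y (f : {set V}) (v0 : V) (mu : {set V} -> V) :=
  [/\ [/\ X \subset O, Y \subset E & f \in Y], v0 \in X /\ v0 \in f,
      forall v, v \in X -> a < #|inc Y v|, {in Y &, injective mu}
    & forall h, h \in Y -> [/\ mu h \in h, mu h \in X & mu h != v0]].

(* Offsets of the light edges (few vertices in [A]) are proportional to their
   size, so that light edges alone are never overfull: a minimal overfull pair
   contains a heavy edge. *)
Lemma dense_core E : sparse_host E -> Lm * #|V| < rho1 * #|E| ->
  exists X Y f v0 mu, rooted_core E X Y f v0 mu /\ t <= #|f :&: A|.
Proof.
move=> [hL ho hlo] big.
have L0 : 0 < L by apply: leq_trans a0 aL.
have Lm0 : 0 < Lm by apply: leq_trans L0 LLm.
pose c h := if t <= #|h :&: A| then L * j else j * #|h :&: O|.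
have ajL : a + j = L by slia.
(* Summed over [E], this makes [O] and [E] overfull. For a heavy hyperedge it is [star_ineq]; a
   light one keeps the share [a / L] of a trace of size at least [rho1]. *)
have term h : h \in E -> L * a * rho1 + Lm * c h <= Lm * L * #|h :&: O|.
  move=> hE; rewrite /c; case: (leqP t #|h :&: A|) => th.
    have oh := ho h hE.
    have : Lm * (o0 - j) <= Lm * (#|h :&: O| - j) by rewrite leq_mul2l leq_sub2r ?orbT.
    move/(leq_trans star_ineq); move: oh jo0; set o := #|h :&: O|; clearbody o => oh jo le.
    have -> : Lm * L * o = L * (Lm * (o - j)) + Lm * (L * j).
      have -> : o = (o - j) + j by move: oh jo; clear; lia.
      by rewrite addnK; clear; lia.
    by rewrite leq_add2r -mulnA leq_mul2l le orbT.
  have := hlo h hE th; set o := #|h :&: O|; clearbody o => oh.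
  have -> : Lm * L * o = Lm * a * o + Lm * (j * o) by rewrite -{1}ajL; clear; lia.
  rewrite leq_add2r; apply: leq_mul => //; by apply: leq_mul.
have over : overfull c L a O E.
  rewrite /overfull -(ltn_pmul2l Lm0) mulnDr.
  apply: (@leq_trans (L * a * rho1 * #|E| + Lm * \sum_(h in E) c h)).
    rewrite ltn_add2r; apply: (@leq_ltn_trans (L * a * (Lm * #|V|))).
      have := max_card O; move: #|O| #|V| => x y xy; by rewrite mulnCA !leq_mul2l xy !orbT.
    by rewrite -[X in _ < X]mulnA ltn_pmul2l // muln_gt0 L0.
  rewrite mulnA !big_distrr /= [_ * #|E|]mulnC -sum_nat_const -big_split /=.
  exact: leq_sum.
have [X [Y [sX sY mXY]]] := min_overfull_exists over.
have Delta v : v \in X -> #|inc Y v| <= a + j.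
  move=> /(subsetP sX); rewrite inE ajL => vA; apply: leq_trans (hL v vA).
  by apply: subset_leq_card; apply: incS.
have cj h : h \in Y -> L * j <= c h.
  move=> /(subsetP sY) hE; rewrite /c; case: (leqP t #|h :&: A|) => // th.
  by rewrite mulnC leq_mul2l (leq_trans Lrho) ?orbT // hlo.
have [f fY tf] : exists2 f, f \in Y & t <= #|f :&: A|.
  apply/exists_inP; case: (boolP [exists f in Y, t <= #|f :&: A|]) => // /exists_inPn lo.
  case: mXY => + _; rewrite /overfull => ov.
  have e1 : j * \sum_(h in Y) #|h :&: X| <= \sum_(h in Y) c h.
    rewrite big_distrr /=; apply: leq_sum => h hY.
    rewrite /c (negbTE (lo h hY)) leq_mul2l subset_leq_card ?orbT //.
    exact: setIS.
  have e2 : \sum_(h in Y) #|h :&: X| <= L * #|X|.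
    rewrite sum_inc mulnC -sum_nat_const; apply: leq_sum => v vX.
    by rewrite -ajL; apply: Delta.
  have e3 : a * \sum_(h in Y) #|h :&: X| <= a * (L * #|X|) by rewrite leq_mul2l e2 orbT.
  move: ov e1 e3.
  have -> : L * \sum_(h in Y) #|h :&: X| = a * \sum_(h in Y) #|h :&: X| + j * \sum_(h in Y) #|h :&: X|.
    by rewrite -mulnDl ajL.
  move: (\sum_(h in Y) #|h :&: X|) (\sum_(h in Y) c h) #|X| => S C x.
  by clear; lia.
have [v0] : exists v0, v0 \in f :&: X.
  apply/card_gt0P; have := min_overfull_edge mXY fY.
  by case: #|f :&: X| => //; rewrite muln0.
rewrite inE => /andP[v0f v0X].
have [mu [imu hmu]] := min_overfull_matching mXY v0 Delta cj.
exists X, Y, f, v0, mu; split=> //; split=> //.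
by move=> v vX; apply: min_overfull_deg mXY v vX.
Qed.

(** If each [t]-subset of [A] could be spoiled by deleting [K] hyperedges, all these deletions
    together, at most [2 ^ #|A| * K] hyperedges, would leave the host dense. The remainder has a
    core whose [f] contains some [B], and this is also a core after the deletion meant for [B]. *)
Lemma dense_core_robust E K : sparse_host E ->
  Lm * #|V| + rho1 * (2 ^ #|A| * K) < rho1 * #|E| ->
  exists B : {set V}, [/\ B \subset A, #|B| = t
    & forall Del : {set {set V}}, #|Del| <= K ->
      exists X Y f v0 mu, rooted_core (E :\: Del) X Y f v0 mu /\ B \subset f].
Proof.
move=> hE big; pose good (B : {set V}) := forall Del : {set {set V}}, #|Del| <= K ->
  exists X Y f v0 mu, rooted_core (E :\: Del) X Y f v0 mu /\ B \subset f.
case: (classic (exists B : {set V}, [/\ B \subset A, #|B| = t & good B])) => // none.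
have [Del hDel] : exists Del : {set V} -> {set {set V}}, forall B : {set V}, B \subset A -> #|B| = t ->
    #|Del B| <= K /\ forall X Y f v0 mu, rooted_core (E :\: Del B) X Y f v0 mu -> ~~ (B \subset f).
  suff : forall B : {set V}, exists D : {set {set V}}, B \subset A -> #|B| = t ->
      #|D| <= K /\ forall X Y f v0 mu, rooted_core (E :\: D) X Y f v0 mu -> ~~ (B \subset f).
    by case/fin_all_exists=> Del hDel; exists Del.
  move=> B; case: (classic (B \subset A /\ #|B| = t)) => [[sB cB]|nB]; last first.
    by exists set0 => sB cB; case: nB.
  have nB : ~ good B by move=> gB; apply: none; exists B.
  have [D hD] := not_all_ex_not _ _ nB.
  have [cD nD] := imply_to_and _ _ hD.
  exists D => _ _; split=> // X Y f v0 mu rc; apply/negP=> sf; apply: nD.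
  by exists X, Y, f, v0, mu.
pose DD := \bigcup_(B in powerset A) (if #|B| == t then Del B else set0).
have cDD : #|DD| <= 2 ^ #|A| * K.
  rewrite -card_powerset; apply: card_bigcup_le => B; rewrite inE => sB.
  by case: eqP => [cB|_]; [have [] := hDel B sB cB|rewrite cards0].
have hE' := sparse_hostS (subsetDl E DD) hE.
have [|X [Y [f [v0 [mu [rc tf]]]]]] := dense_core hE'.
  have h1 : #|E| <= #|E :\: DD| + 2 ^ #|A| * K.
    by have := leq_cardsD E DD; move: cDD; slia.
  have : rho1 * #|E| <= rho1 * (#|E :\: DD| + 2 ^ #|A| * K) by rewrite leq_mul2l h1 orbT.
  by move: big; rewrite mulnDr; slia.
have [|B _ /andP[sB /eqP cB]] := sub_of_card (n := t) (sub0set (f :&: A)) _ tf.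
  by rewrite cards0.
move: sB; rewrite subsetI => /andP[sBf sBA].
have [cD nD] := hDel B sBA cB.
have [[sX sY fY] hv hdeg imu hmu] := rc.
suff rc' : rooted_core (E :\: Del B) X Y f v0 mu by have := nD _ _ _ _ _ rc'; rewrite sBf.
split=> //; split=> //; apply: subset_trans sY (setDS _ _).
by apply: (bigcup_max B); rewrite ?inE // cB eqxx.
Qed.
End DenseCore.

Lemma count_iota_card (p : pred nat) n : count p (iota 0 n) = #|[set i : 'I_n | p i]|.
Proof.
rewrite -sum1_count -sum1_card -{1}[n]subn0 -/(index_iota 0 n) big_mkord.
by apply: eq_bigl => i; rewrite inE.
Qed.

(** * Assembling the tree from branches in dense cores *)

Section BranchEmbedding.
Variables (V : finType) (A : {set V}) (a : nat).
Implicit Types (E Y : {set {set V}}).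

(** The matching gives each new hyperedge its own vertex other than [v0], so only the degree limits
    the size. [phi s] records [f] for the edge leading from [s] out of the branch, and [U0] can bar
    [f] from use inside it. *)
Lemma core_branch par l (J : pred nat) s E X Y f v0 mu (U0 : {set {set V}}) :
  rooted_core A a E X Y f v0 mu -> s <= l ->
  (forall i, i <= l -> J i -> i != s -> par i < i /\ J (par i)) ->
  (forall i, i < s -> ~~ J i) -> U0 \subset Y ->
  #|U0| + count (fun j => J j && (j != s)) (iota 0 l.+1) <= a.+1 ->
  exists (g : nat -> V) (phi : nat -> {set V}), [/\ g s = v0 /\ phi s = f,
    forall j, j <= l -> J j -> j != s ->
      [/\ phi j \in Y, phi j \notin U0, g (par j) \in phi j
        & internal par l j -> g j \in phi j],
    forall i j, i <= l -> j <= l -> J i -> J j -> i != s -> j != s -> phi i = phi j -> i = j,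
    forall j, j <= l -> J j -> internal par l j -> g j \in X
  & forall i j, i <= l -> j <= l -> J i -> J j -> internal par l i -> internal par l j ->
      g i = g j -> i = j].
Proof.
move=> [[sX sY fY] [v0X v0f] hdeg imu hmu] sl hJ Js U0Y cnt.
pose P (W : {set V}) (U : {set {set V}}) := U \subset Y /\ W \subset v0 |: mu @: U.
have st : gstate par l J s X Y U0 P s.+1 (fun=> v0) (fun=> f) U0 [set v0].
  by apply: gstate_start => //; split=> //; apply: subsetUl.
have PU W U h : P W U -> h \in Y -> P W (h |: U).
  move=> [sU sW] hY; split; first by rewrite subUset sub1set hY.
  by apply: subset_trans sW _; apply/setUS/imsetS/subsetUr.
have hnew (m : nat) (W : {set V}) U h : P W U -> h \in Y -> h \notin U -> #|W| < m ->
    exists v, [/\ v \in h, v \in X, v \notin W & P (v |: W) (h |: U)].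
  move=> PWU hY hU _; have [muh muX mu0] := hmu h hY; exists (mu h); split=> //.
    apply: contra hU => /(subsetP PWU.2); rewrite !inE (negbTE mu0) /=.
    by case/imsetP=> h' h'U /imu-> //; apply: (subsetP PWU.1).
  have [sU sW] := PU W U h PWU hY; split=> //.
  by rewrite subUset sW andbT sub1set !inE imset_f ?orbT // !inE eqxx.
have [||g [phi [U [W [[h1 h2 h3 h4 h5 _ _ _ _] ag]]]]] := gstate_extend hJ hdeg (hnew _)
    (fun W U h PWU hY _ => PU W U h PWU hY) (leqnn _) (n := l - s) st (ltnSn s).
- by rewrite addSn subnKC.
- by rewrite addSn subnKC.
have [gs ps] := ag s (ltnSn s).
move: h1 h2 h3 h4 h5; rewrite addSn subnKC // => h1 h2 h3 h4 h5.
exists g, phi; split=> //.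
- move=> j jl Jj js; have [? _ ? ?] := h1 j jl Jj js; split=> // ij; exact: h2.
- by move=> j jl Jj ij; have [] := h4 j jl Jj ij.
Qed.

Lemma core_wemb par l E X Y f v0 mu : 0 < l -> itree par l ->
  rooted_core A a E X Y f v0 mu -> l <= a.+1 ->
  exists g phi, wemb par l E (~: A) g phi.
Proof.
move=> l0 it rc la.
have [||||g [phi [_ h1 h2 h3 h4]]] := @core_branch par l predT 0 E X Y f v0 mu set0 rc (leq0n l).
- by move=> i il _ i0; split=> //; apply: it; rewrite il lt0n i0.
- by move=> i.
- exact: sub0set.
- rewrite cards0 add0n; apply: leq_trans la.
  have -> : iota 0 l.+1 = 0 :: iota 1 l by [].
  by rewrite /= add0n -[X in _ <= X](size_iota 1 l) count_size.
have [[sX sY _] _ _ _ _] := rc.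
exists g, phi; split.
- move=> i /andP[i0 il]; apply: (subsetP sY).
  by have [] := h1 i il isT; rewrite -?lt0n.
- by move=> i j /andP[i0 il] /andP[j0 jl]; apply: h2; rewrite // -lt0n.
- by move=> i /andP[i0 il]; have [] := h1 i il isT; rewrite -?lt0n.
- by move=> i /andP[i0 il] ii; have [|_ _ _ ->] := h1 i il isT; rewrite -?lt0n.
- by move=> i ii; apply: (subsetP sX); apply: h3 => //; apply/ltnW/(internal_lt it).
- by move=> i j ii ij; apply: h4 => //; apply/ltnW/(internal_lt it).
Qed.

Variables (L l t : nat) (par top : nat -> nat) (E : {set {set V}}) (B : {set V}).
Hypothesis it : itree par l.
Hypothesis t0 : 0 < t <= l.
Hypothesis br : branching par l t top.
Hypothesis brs : forall b, #|[set i : 'I_l.+1 | (t <= i) && (top i == b)]| <= a.+1.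
Hypothesis degO : forall v, v \notin A -> #|inc E v| <= L.
Hypothesis sBA : B \subset A.
Hypothesis cB : #|B| = t.
Hypothesis core : forall Del : {set {set V}}, #|Del| <= l.+1 * L.+1 ->
  exists X Y f v0 mu, rooted_core A a (E :\: Del) X Y f v0 mu /\ B \subset f.

(** The step at which [j] is treated: its own in the initial segment, otherwise that of its top. *)
Let tau j := if j < t then j else top j.

Record branches i (g : nat -> V) (phi : nat -> {set V}) : Prop := Branches {
  bs_edge : forall j, 0 < j <= l -> tau j < i -> phi j \in E;
  bs_inj : forall j j', 0 < j <= l -> 0 < j' <= l -> tau j < i -> tau j' < i ->
    phi j = phi j' -> j = j';
  bs_low : forall j, 0 < j <= l -> tau j < i -> j < t \/ top j = j -> B \subset phi j;
  bs_par : forall j, t <= j <= l -> top j < i -> top j != j -> g (par j) \in phi j;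
  bs_int : forall j, t <= j <= l -> top j < i -> internal par l j ->
    g j \in phi j /\ g j \notin A;
  bs_ginj : forall j j', t <= j <= l -> t <= j' <= l -> top j < i -> top j' < i ->
    internal par l j -> internal par l j' -> g j = g j' -> j = j'
}.


Let tau_hi j : t <= j -> tau j = top j.
Proof. by rewrite /tau leqNgt => /negbTE->. Qed.

Let tau_par j : t <= j <= l -> top j != j -> t <= par j <= l /\ tau (par j) = tau j.
Proof.
move=> jtl nj; case: (br_par br jtl) => [E0|[tp tpar]]; first by rewrite E0 eqxx in nj.
have [tj jl] := andP jtl; have := it (i := j); rewrite !tau_hi // => pj; split=> //.
by rewrite tp; move: pj t0 jtl; slia.
Qed.

(** Deleting the spent hyperedges and all hyperedges at spent vertices outside [A] separates the
    next core from what is built: every vertex of its [X] lies on a surviving hyperedge. *)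
Let Del (g : nat -> V) (phi : nat -> {set V}) : {set {set V}} :=
  \bigcup_(j in [set: 'I_l.+1]) (phi j |: (if g j \in A then set0 else inc E (g j))).

Let card_Del g phi : #|Del g phi| <= l.+1 * L.+1.
Proof.
rewrite -[X in X * _](card_ord l.+1) -cardsT; apply: card_bigcup_le => j _.
rewrite cardsU1; case: ifP => [_|/negbT gA]; first by rewrite cards0; case: (_ \notin _).
by have := degO gA; case: (_ \notin _) => /=; slia.
Qed.

Let Del_phi g phi j : j <= l -> phi j \in Del g phi.
Proof.
move=> jl; apply/bigcupP; exists (inord j) => //; by rewrite inordK // !inE eqxx.
Qed.

Let Del_g g phi j h : j <= l -> g j \notin A -> h \in E -> g j \in h -> h \in Del g phi.
Proof.
move=> jl gA hE gh; apply/bigcupP; exists (inord j) => //.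
by rewrite inordK // (negbTE gA) !inE hE gh orbT.
Qed.

Lemma branches_merge i g phi g1 phi1 : branches i g phi ->
  (forall j, 0 < j <= l -> tau j = i -> phi1 j \in E /\ phi1 j \notin Del g phi) ->
  (forall j j', 0 < j <= l -> 0 < j' <= l -> tau j = i -> tau j' = i ->
    phi1 j = phi1 j' -> j = j') ->
  (forall j, 0 < j <= l -> tau j = i -> j < t \/ top j = j -> B \subset phi1 j) ->
  (forall j, t <= j <= l -> top j = i -> top j != j -> g1 (par j) \in phi1 j) ->
  (forall j, t <= j <= l -> top j = i -> internal par l j -> [/\ g1 j \in phi1 j, g1 j \notin A
    & exists2 h, h \in E :\: Del g phi & g1 j \in h]) ->
  (forall j j', t <= j <= l -> t <= j' <= l -> top j = i -> top j' = i ->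
    internal par l j -> internal par l j' -> g1 j = g1 j' -> j = j') ->
  branches i.+1 (fun j => if tau j == i then g1 j else g j)
    (fun j => if tau j == i then phi1 j else phi j).
Proof.
move=> [b1 b2 b3 b4 b5 b6] c1 c2 c3 c4 c5 c6.
have lt x : x < i.+1 -> x != i -> x < i by rewrite ltnS leq_eqVlt => /predU1P[->|//]; rewrite eqxx.
have pos j : t <= j <= l -> 0 < j <= l by move: t0; clear; lia.
have neq j j' : 0 < j <= l -> 0 < j' <= l -> tau j = i -> phi1 j <> phi j'.
  move=> jl j'l ji E0; have [_] := c1 j jl ji; rewrite E0 Del_phi //.
  by case/andP: j'l.
have gneq j j' : t <= j <= l -> t <= j' <= l -> top j = i -> top j' < i -> internal par l j ->
    internal par l j' -> g1 j <> g j'.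
  move=> jl j'l ji j'i ij ij' E0; have [_ _ [h]] := c5 j jl ji ij.
  rewrite inE => /andP[hD hE]; rewrite E0 => gh; case/negP: hD.
  have [_ gA] := b5 j' j'l j'i ij'; apply: (@Del_g g phi j' h) => //; by case/andP: j'l.
split.
- by move=> j jl ji; case: eqP => [/(c1 j jl)[]//|/eqP ne]; apply: b1 => //; apply: lt.
- move=> j j' jl j'l ji j'i; case: eqP => [e|/eqP ne]; case: eqP => [e'|/eqP ne'].
  + exact: c2.
  + by move=> E0; case: (neq j j').
  + by move=> E0; case: (neq j' j).
  + by apply: b2 => //; apply: lt.
- move=> j jl ji; case: eqP => [e|/eqP ne]; first exact: c3.
  by apply: b3 => //; apply: lt.
- move=> j jtl ji nj; have [_ ->] := tau_par jtl nj; have tj := andP jtl.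
  move: (ji); rewrite tau_hi; last by case: tj.
  case: eqP => [e|/eqP ne] _; first exact: c4.
  by apply: b4 => //; apply: lt.
- move=> j jtl ji ij; have tj := andP jtl.
  rewrite tau_hi; last by case: tj.
  case: eqP => [e|/eqP ne]; first by have [] := c5 j jtl e ij.
  by apply: b5 => //; apply: lt.
- move=> j j' jl j'l ji j'i ij ij'; have [tj _] := andP jl; have [tj' _] := andP j'l.
  rewrite !tau_hi //; case: eqP => [e|/eqP ne]; case: eqP => [e'|/eqP ne'].
  + exact: c6.
  + by move=> E0; case: (gneq j j') => //; apply: lt.
  + by move=> E0; case: (gneq j' j) => //; apply: lt.
  + by apply: b6 => //; apply: lt.
Qed.

(** A step below [t] takes one hyperedge containing [B]. A step that is its own top embeds the whole
    branch in a new core. Any other index belongs to an earlier step, and nothing is added. *)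
Lemma branches_step i g phi : i <= l -> branches i g phi ->
  exists g' phi', branches i.+1 g' phi'.
Proof.
move=> il bs.
have [X [Y [f [v0 [mu [rc Bf]]]]]] := core (card_Del g phi).
have [[sX sY fY] [v0X v0f] hdeg imu hmu] := rc.
have fE : f \in E /\ f \notin Del g phi.
  by have := subsetP sY f fY; rewrite inE => /andP[].
have XY v : v \in X -> exists2 h, h \in E :\: Del g phi & v \in h.
  move=> /hdeg/(leq_ltn_trans (leq0n _))/card_gt0P[h]; rewrite mem_inc => /andP[hY vh].
  by exists h => //; apply: (subsetP sY).
have [ti|ti] := ltnP i t.
  have tauE j : j <= l -> tau j = i -> j = i.
    move=> jl; rewrite /tau; case: ltnP => // tj ji.
    by have := br_le br (i := j); rewrite tj jl => /(_ isT); rewrite ji; move: ti; slia.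
  have no j : t <= j <= l -> top j = i -> False.
    by move=> jl ji; have := br_le br jl; rewrite ji; move: ti; slia.
  exists (fun j => if tau j == i then g j else g j), (fun j => if tau j == i then f else phi j).
  apply: branches_merge => //.
  - by move=> j j' /andP[_ jl] /andP[_ j'l] ji j'i _; rewrite (tauE j) // (tauE j').
  - by move=> j jl ji; case: (no j jl ji).
  - by move=> j jl ji; case: (no j jl ji).
  - by move=> j j' jl _ ji; case: (no j jl ji).
have itl : t <= i <= l by rewrite ti.
case: (eqVneq (top i) i) => [topi|ntop]; last first.
  have no j : t <= j <= l -> top j = i -> False.
    by move=> jl ji; case/eqP: ntop; rewrite -ji; apply: br_idem br _ jl.
  have no' j : 0 < j <= l -> tau j = i -> False.
    move=> /andP[_ jl]; rewrite /tau; case: ltnP => [jt ji|tj ji]; first by move: ti jt; rewrite ji; slia.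
    by apply: (no j); rewrite // tj.
  exists (fun j => if tau j == i then g j else g j), (fun j => if tau j == i then f else phi j).
  apply: branches_merge => //.
  - by move=> j j' jl _ ji; case: (no' j jl ji).
  - by move=> j jl ji; case: (no j jl ji).
  - by move=> j jl ji; case: (no j jl ji).
  - by move=> j j' jl _ ji; case: (no j jl ji).
pose J j := [&& t <= j, j <= l & top j == i].
have Jtau j : 0 < j <= l -> tau j = i -> J j.
  move=> /andP[_ jl]; rewrite /tau /J jl; case: ltnP => [jt ji|tj ->]; last by rewrite eqxx.
  by move: ti jt; rewrite ji; slia.
have JI j : t <= j <= l -> top j = i -> J j by rewrite /J => /andP[-> ->] ->; rewrite eqxx.
have [||||g1 [phi1 [[gi pi] h1 h2 h3 h4]]] := @core_branch par l J i _ X Y f v0 mu [set f] rc il.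
- move=> j jl /and3P[tj _ /eqP ji] nj.
  have jtl : t <= j <= l by rewrite tj.
  have topj : top j != j by rewrite ji eq_sym.
  have [/andP[tp pl] e] := tau_par jtl topj.
  rewrite /J tp pl -(tau_hi tp) e (tau_hi tj) ji eqxx; split=> //.
  by apply: it; move: t0 tj jl; slia.
- by move=> j ji; apply/negP=> /and3P[tj jl /eqP E0]; have := br_le br (i := j); rewrite tj jl E0; move: ji; slia.
- by rewrite sub1set.
- have Ji : J i by rewrite /J ti il topi eqxx.
  apply: leq_trans (brs i); rewrite cards1 count_iota_card.
  have oi : Ordinal (il : i < l.+1) \in [set j : 'I_l.+1 | (t <= j) && (top j == i)].
    by rewrite inE /= ti topi eqxx.
  rewrite [X in _ <= X](cardsD1 (Ordinal (il : i < l.+1))) oi leq_add2l subset_leq_card //.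
  by apply/subsetP=> j; rewrite !inE -val_eqE /= => /andP[/and3P[-> _ ->] ->].
have nf j : j <= l -> J j -> phi1 j = f -> j = i.
  move=> jl Jj E0; apply/eqP; apply/negP=> /negP ne; have [_ + _ _] := h1 j jl Jj ne.
  by rewrite E0 inE eqxx.
exists (fun j => if tau j == i then g1 j else g j), (fun j => if tau j == i then phi1 j else phi j).
apply: branches_merge => //.
- move=> j jl /(Jtau j jl) Jj; case: (eqVneq j i) => [->|ne]; first by rewrite pi.
  have [|/(subsetP sY) + _ _ _] := h1 j _ Jj ne; first by case/andP: jl.
  by rewrite inE => /andP[].
- move=> j j' jl j'l /(Jtau j jl) Jj /(Jtau j' j'l) Jj'; have [_ jl'] := andP jl; have [_ j'l'] := andP j'l.
  case: (eqVneq j i) => [->|ne]; case: (eqVneq j' i) => [->|ne'] //.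
  + by rewrite pi => /esym/nf->.
  + by rewrite pi => /nf->.
  + exact: h2.
- move=> j jl ji jj; have /and3P[tj _ /eqP ti'] := Jtau j jl ji.
  case: jj => [|jj]; first by rewrite ltnNge tj.
  by rewrite -jj ti' pi.
- move=> j jl ji nj; have Jj := JI j jl ji; have [_ jl'] := andP jl.
  by have [] := h1 j jl' Jj; rewrite // -ji eq_sym.
- move=> j jl ji ij; have Jj := JI j jl ji; have [_ jl'] := andP jl.
  have gX := h3 j jl' Jj ij; split; last exact: XY.
    case: (eqVneq j i) => [E0|ne]; first by rewrite E0 gi pi.
    by have [_ _ _ ->] := h1 j jl' Jj ne.
  by have := subsetP sX _ gX; rewrite inE.
- move=> j j' jl j'l ji j'i; have [_ jl'] := andP jl; have [_ j'l'] := andP j'l.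
  by apply: h4 => //; apply: JI.
Qed.

(** The initial segment goes to [B] by an arbitrary injection, since every tree edge that meets it
    has a hyperedge containing all of [B]. *)
Lemma branch_wemb : exists g phi, wemb par l E setT g phi /\
  forall i, internal par l i -> g i \in B \/ g i \notin A.
Proof.
have [b0 b0B] : exists b, b \in B by apply/card_gt0P; rewrite cB; case/andP: t0.
have [gB [gBi gBin]] : exists gB : 'I_t -> V,
    {in setT &, injective gB} /\ forall c, c \in setT -> gB c \in B.
  by apply: (exists_inj_on b0); rewrite cardsT card_ord cB.
have [g [phi [b1 b2 b3 b4 b5 b6]]] : exists g phi, branches l.+1 g phi.
  have bs0 : branches 0 (fun=> b0) (fun=> B) by split.
  have : l.+1 <= l.+1 by [].
  elim: {1 3}l.+1 => [_|i IH il]; first by exists (fun=> b0), (fun=> B).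
  by have [g [phi bs]] := IH (ltnW il); apply: branches_step bs.
have tl j : j <= l -> tau j < l.+1.
  move=> jl; rewrite /tau; case: (ltnP j t) => [_|tj]; first by rewrite ltnS.
  by have := br_le br (i := j); rewrite tj jl; move: jl; slia.
have tl2 j : t <= j <= l -> top j < l.+1.
  by case/andP=> tj jl; rewrite -tau_hi //; apply: tl.
pose g' j := if insub j is Some c then gB c else g j.
have g'lo j (jt : j < t) : g' j = gB (Ordinal jt) by rewrite /g' insubT.
have g'hi j : t <= j -> g' j = g j by rewrite /g' leqNgt => jt; rewrite insubN.
have g'B j : j < t -> g' j \in B by move=> jt; rewrite g'lo gBin.
have hi j : internal par l j -> t <= j -> t <= j <= l.
  by move=> /(internal_lt it)/ltnW jl tj; rewrite tj.
have Bphi j : 0 < j <= l -> j < t \/ top j = j -> B \subset phi j.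
  by move=> jl; apply: b3 => //; apply: tl; case/andP: jl.
exists g', phi; split; [split|].
- by move=> i il; apply: b1 => //; apply: tl; case/andP: il.
- by move=> i j il jl; apply: b2 => //; apply: tl; [case/andP: il|case/andP: jl].
- move=> i il; have [it'|ti] := ltnP i t.
    apply: (subsetP (Bphi i il (or_introl it'))); apply: g'B.
    exact: ltn_trans (it il) it'.
  have itl : t <= i <= l by rewrite ti; case/andP: il.
  case: (eqVneq (top i) i) => [ti'|nt].
    apply: (subsetP (Bphi i il (or_intror ti'))); apply: g'B.
    by rewrite -{1}ti'; apply: br_top br _ itl.
  have [/andP[tp _] _] := tau_par itl nt; rewrite g'hi //; apply: b4 => //.
  exact: tl2.
- move=> i il ii; have [it'|ti] := ltnP i t.
    by apply: (subsetP (Bphi i il (or_introl it'))); apply: g'B.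
  have itl := hi i ii ti.
  by rewrite g'hi //; have [] := b5 i itl (tl2 i itl) ii.
- by move=> i _; rewrite inE.
- move=> i j ii ij; have [it'|ti] := ltnP i t; have [jt|tj] := ltnP j t.
  + by rewrite !g'lo => /gBi; rewrite !inE => /(_ isT isT)[].
  + move=> E0; have jtl := hi j ij tj; have [_] := b5 j jtl (tl2 j jtl) ij.
    by rewrite -(g'hi j tj) -E0 (subsetP sBA) // g'B.
  + move=> E0; have itl := hi i ii ti; have [_] := b5 i itl (tl2 i itl) ii.
    by rewrite -(g'hi i ti) E0 (subsetP sBA) // g'B.
  + by rewrite !g'hi //; apply: b6; rewrite // ?tl2 // hi.
- move=> i ii; have [it'|ti] := ltnP i t; first by left; apply: g'B.
  right; rewrite g'hi //; have itl := hi i ii ti.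
  by have [] := b5 i itl (tl2 i itl) ii.
Qed.
End BranchEmbedding.

(** * The upper bound *)

(** For [#|A| = k]. The value [L = l.-1] is excluded because it would require [a * r'.+1 <= a * r'];
    [critical_equal] treats it by clusters. *)
Lemma weight_ineq_exact l L Lm r' a : 3 <= l -> 0 < L -> l + L.+1 <= r' ->
  L != l.-1 -> Lm = maxn l.-1 L -> a = minn l.-1 L ->
  a * r'.+1 <= Lm * (r' - (L - a)).
Proof.
move=> l3 L0 hr neq hLm ha; have [lt|ge] := leqP L l.-1.
  have -> : a = L by lia.
  have -> : Lm = l.-1 by lia.
  rewrite subnn subn0; have h : L.+1 * r' <= l.-1 * r' by rewrite leq_mul2r; lia.
  by apply: leq_trans h; rewrite mulSn mulnS leq_add2r; lia.
have -> : a = l.-1 by lia.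
have -> : Lm = L by lia.
have [u eu u0] : exists2 u, L = l.-1 + u & 0 < u by exists (L - l.-1); lia.
have [x ex] : exists x, r' = l + L.+1 + x by exists (r' - (l + L.+1)); lia.
have -> : r' - (L - l.-1) = l.-1 + l.-1 + 2 + x by lia.
have -> : r'.+1 = l.-1 + l.-1 + u + 3 + x by lia.
by rewrite eu; move: u0; clear; nia.
Qed.

(** By concavity, [y * (R - y)] is smallest on an interval at one of its ends. *)
Lemma concave_ge c R p s y : p <= y <= s -> s <= R -> c <= p * (R - p) -> c <= s * (R - s) ->
  c <= y * (R - y).
Proof.
move=> /andP[py ys] sR hp hs.
have [le|gt] := leqP (y + p) R.
  apply: leq_trans hp _; move: le py; move: (subnKC (leq_trans ys sR)); clear.
  move: (R - y) => z <- le py; have -> : y + z - p = z + (y - p) by lia.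
  by move: (subnKC py); move: (y - p) => u <-; nia.
apply: leq_trans hs _; move: (subnKC ys) (subnKC sR).
move: (s - y) (R - s) => u z e1 e2; rewrite -e2 in gt *; rewrite -e1 -addnA addKn in gt *.
by nia.
Qed.

(** For [#|A| = k + q]. The delicate case is [t = k < q] with [2 <= a < L]: there [y >= R - L] for
    [R = r' - k]. If [L] is at most [l.-1], the estimate [hp] suffices; beyond that, [L * (R - L)]
    is concave in [L] and is checked at [l.-1] and [r' - l.+1]. *)
Lemma weight_ineq_excess k l L Lm r' q t a : 0 < k -> 3 <= l -> 0 < L ->
  l + L.+1 <= r' -> l * (l - 2) <= r' + k -> 0 < q <= l - 2 ->
  Lm = maxn l.-1 L -> t = minn q k -> a = minn (maxn 1 (l - t - 2)) L ->
  a * r'.+1 <= Lm * (r' - q - (L - a)) /\ L - a <= r' - q.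
Proof.
move=> k0 l3 L0 hr hr2 /andP[q0 ql] hLm ht ha; split; last by lia.
have [y ey] : exists y, y + q + L = r' + a /\ r' - q - (L - a) = y.
  by exists (r' - q - (L - a)); lia.
case: ey => ey ->.
have Lm1 : l.-1 <= Lm by lia.
have Lm2 : L <= Lm by lia.
have hql : q + 2 <= l by lia.
have tq : t = q \/ t = k /\ k < q by lia.
have [small|big] := leqP L (maxn 1 (l - t - 2)).
  have aL : a = L by lia.
  have yr : r' = y + q by lia.
  have le : l.-1 * y <= Lm * y by rewrite leq_mul2r Lm1 orbT.
  apply: leq_trans le; rewrite aL yr.
  have [L1|L2] := leqP L 1.
    have y4 : 4 <= y by lia.
    have [z ->] : exists z, l.-1 = q.+1 + z by exists (l.-1 - q.+1); lia.
    have -> : L = 1 by lia.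
    by move: y4 q0; clear; nia.
  case: tq => [tq|[tk kq]].
    have [z ->] : exists z, l.-1 = L + q + 1 + z by exists (l.-1 - (L + q + 1)); lia.
    have yL : L <= y by lia.
    by move: yL; clear; nia.
  have [z ez] : exists z, l = L + k + 2 + z by exists (l - (L + k + 2)); lia.
  have [w ew] : exists w, l = q + 2 + w by exists (l - (q + 2)); lia.
  have -> : l.-1 = L + k + 1 + z by lia.
  have hy : L * q.+1 <= y.
    have [m em] : exists m, l = m + 3 by exists (l - 3); lia.
    have le : L * q.+1 <= m * (m + 2) by apply: leq_mul; lia.
    apply: leq_trans le _; move: hr2; have -> : l - 2 = m.+1 by lia.
    by move=> hr2; have : l * m.+1 = m * (m + 2) + 2 * m + 3; [rewrite em; clear; lia|lia].
  by move: hy k0; clear; nia.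
have [a1|a2] := leqP a 1.
  have -> : a = 1 by lia.
  have y4 : 4 <= y by lia.
  have Lm3 : 2 <= Lm by lia.
  have le : r'.+1 <= y + Lm + Lm by lia.
  by rewrite mul1n; apply: leq_trans le _; move: y4 Lm3; clear; nia.
case: tq => [tq|[tk kq]].
  have [d ed] : exists d, Lm = a + d by exists (Lm - a); lia.
  have -> : r'.+1 = y + q + (L - a) + 1 by lia.
  have le : a * (y + q + (L - a) + 1) <= a * (y + d + d) by rewrite leq_mul2l; lia.
  have ya : 2 * a <= y by lia.
  by apply: leq_trans le _; rewrite ed; move: ya; clear; nia.
have el : l = a + k + 2 by lia.
have rl : (a + k + 2) * (a + k) <= r' + k.
  by move: hr2; rewrite el addnK.
pose R := r' - k.
have hp : a * r'.+1 <= l.-1 * (R - l.-1).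
  have [z ez] : exists z, r' = (a + k) * (a + k) + 2 * a + k + z.
    by exists (r' - ((a + k) * (a + k) + 2 * a + k)); move: rl; clear; nia.
  have -> : R - l.-1 = r' - (a + k + k + 1) by rewrite /R; lia.
  have -> : l.-1 = a + k + 1 by lia.
  have [y' ey'] : exists y', r' = y' + (a + k + k + 1).
    by exists (r' - (a + k + k + 1)); rewrite ez; move: a2 k0; clear; nia.
  rewrite {2}ey' addnK; move: ez ey' a2 k0; clear => ez ey' a2 k0.
  have [a' ea] : exists a', a = a' + 2 by exists (a - 2); lia.
  have [k' ek] : exists k', k = k' + 1 by exists (k - 1); lia.
  by subst a k; nia.
have hs : a * r'.+1 <= (r' - l.+1) * (R - (r' - l.+1)).
  have -> : R - (r' - l.+1) = a + 3 by rewrite /R; lia.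
  have [y' ey'] : exists y', r' = y' + l.+1 by exists (r' - l.+1); lia.
  rewrite {2}ey' addnK; move: rl ey' a2 k0; rewrite el; clear => rl ey' a2 k0.
  have [a' ea] : exists a', a = a' + 2 by exists (a - 2); lia.
  have [k' ek] : exists k', k = k' + 1 by exists (k - 1); lia.
  by subst a k; nia.
have yR : R - L <= y by rewrite /R; lia.
have [Ll|lL] := leqP L l.-1.
  apply: leq_trans hp _; apply: leq_mul => //; apply: leq_trans yR; rewrite /R; lia.
apply: leq_trans (leq_mul Lm2 yR); apply: (@concave_ge _ _ l.-1 (r' - l.+1)) => //.
  by lia.
by rewrite /R; lia.
Qed.

(** * The cases of the upper bound, by the number of vertices of large degree *)

Section UpperBound.
Variables (T : sgraph) (k l l2 r : nat).
Hypothesis k0 : 0 < k.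
Hypothesis l3 : 3 <= l.
Hypothesis l22 : 2 <= l2.
Hypothesis rl : l * (l - 2) <= r.
Hypothesis rs : l + l2 + k <= r.
Hypothesis treeT : is_tree T.
Hypothesis size_T : #|sedges T| = l.
Hypothesis not_star : ~ isomorphic T (star l).

Section Host.
Variables (V : finType) (H : {set {set V}}).
Hypothesis unif : forall h, h \in H -> #|h| = r.
Hypothesis free : ~~ contains_berge (dunion T (copies k (star l2))) H.

(** The threshold above which [berge_stars_at] can centre a star; [L] below is the largest degree
    too small for a centre. *)
Let D0 := l + k * l2 + 2 ^ (l.+1 + k + k * l2).
Let A : {set V} := [set v | D0 < #|inc H v|].
Let L := l2.-1.
Let Lm := maxn l.-1 L.
Let r' := r - k.

Let l0 : 0 < l. Proof. by move: l3; slia. Qed.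
Let rk : r' + k = r. Proof. by rewrite /r'; move: rs; slia. Qed.
Let L0 : 0 < L. Proof. by rewrite /L; move: l22; slia. Qed.
Let r'L : l + L.+1 <= r'. Proof. by rewrite /r' /L; move: rs l22; slia. Qed.

Let no_wemb_avoiding par (sg : nat -> T) O g phi (K : {set V}) : indexing l par sg ->
  wemb par l H O g phi -> K \subset A -> #|K| = k ->
  ~ (forall i, internal par l i -> g i \notin K).
Proof.
move=> ix we sK cK nK; case/negP: free.
apply: (berge_stars_at l0 ix we unif _ cK nK); first by move: rs l22; slia.
by move=> v /(subsetP sK); rewrite inE.
Qed.

(** With all vertices in [O], traces are the hyperedges themselves and [rho = r]; [l * (l - 2) <= r]
    is the condition [l.-1 ^ 2 <= r.+1]. *)
Let tree_bound par (sg : nat -> T) : indexing l par sg -> bent_tree par l ->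
  2 * #|root_leaves par l| <= l.-1 -> (forall g phi, ~ wemb par l H setT g phi) ->
  r'.+1 * #|H| <= Lm * #|V|.
Proof.
move=> ix bt rlv noT; apply: (@leq_trans (r.+1 * #|H|)).
  by rewrite leq_mul2r ltnS -rk leq_addr orbT.
apply: (@leq_trans (\sum_(v in [set: V]) minn l.-1 (2 * #|inc H v|))).
  apply: (tree_free_bound bt rlv) => //.
  - by move=> h hH; rewrite setIT unif.
  - by move=> h h' _ _ _; rewrite !setIT.
  - left; have [m em] : exists m, l = m + 3 by exists (l - 3); move: l3; slia.
    by move: rl; rewrite em -mulnn; clear; nia.
rewrite -cardsT mulnC -sum_nat_const; apply: leq_sum => v _.
exact: leq_trans (geq_minl _ _) (leq_maxl _ _).
Qed.

(** The internal indices of a bent tree lie below [l.-1], so their images leave [k] vertices of [A]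
    for the centres. *)
Let many_heavy : k + l.-1 <= #|A| -> r'.+1 * #|H| <= Lm * #|V|.
Proof.
move=> cA; have [par [sg [ix bt rlv]]] := bent_indexing treeT size_T not_star l3.
apply: (tree_bound ix bt rlv) => g phi we.
pose S : {set V} := [set g (nat_of_ord i) | i in [set: 'I_l.-1]].
have cS : #|S| <= l.-1.
  by apply: leq_trans (leq_imset_card _ _) _; rewrite -[X in _ <= X]card_ord max_card.
have [||K _ /andP[sK /eqP cK]] := sub_of_card (n := k) (sub0set (A :\: S)) _.
- by rewrite cards0.
- by apply: leq_trans (leq_cardsD _ _); move: cA cS; slia.
apply: (no_wemb_avoiding ix we (subset_trans sK (subsetDl _ _)) cK) => i ii.
apply/negP=> /(subsetP sK); rewrite inE => /andP[/negP nS _]; apply: nS.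
have il : i < l.-1 by rewrite ltnNge; apply: contraL ii; apply: bent_not_internal bt _.
by apply/imsetP; exists (Ordinal il); rewrite ?inE.
Qed.

Let many_medium : #|A| < k + l.-1 ->
  l * r * (D0 * r) + k * (D0 * r * (D0 * r)) < #|[set v in ~: A | l2 <= #|inc H v|]| ->
  r'.+1 * #|H| <= Lm * #|V|.
Proof.
move=> cA big; have [par [sg [ix bt rlv]]] := bent_indexing treeT size_T not_star l3.
apply: (tree_bound ix bt rlv) => g phi we; case/negP: free.
apply: (berge_stars_outside l0 ix we unif _ _ _ _ big).
- by move: rs l22; slia.
- by move: l22; slia.
- by move: rs cA; slia.
- by move=> v; rewrite inE -leqNgt.
Qed.

Section Light.
Variable E : {set {set V}}.
Hypothesis sEH : E \subset H.
Hypothesis degE : forall v, v \notin A -> #|inc E v| <= L.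

Let cardO h : h \in E -> #|h :&: A| + #|h :&: ~: A| = r.
Proof. by move=> /(subsetP sEH)/unif <-; rewrite -setDE cardsID. Qed.

Let sum_light rho : (forall h, h \in E -> rho <= #|h :&: ~: A|) -> rho * #|E| <= L * #|V|.
Proof.
move=> hr; apply: (@leq_trans (\sum_(h in E) #|h :&: ~: A|)).
  by rewrite mulnC -sum_nat_const; apply: leq_sum.
rewrite sum_inc; apply: (@leq_trans (\sum_(v in ~: A) L)).
  by apply: leq_sum => v; rewrite inE; apply: degE.
by rewrite sum_nat_const mulnC leq_mul2l max_card orbT.
Qed.

(** Every hyperedge has at least [r'.+1] vertices outside [A], so double counting suffices. *)
Let few_heavy : #|A| < k -> r'.+1 * #|E| <= Lm * #|V|.
Proof.
move=> cA; apply: (@leq_trans (L * #|V|)); last by rewrite leq_mul2r leq_maxr orbT.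
apply: sum_light => h hE; have := cardO hE; have := subset_leq_card (subsetIr h A).
by move: cA rk; slia.
Qed.

(** Only [r'] vertices outside [A] are guaranteed. A hyperedge with exactly [r'] contains all of [A]
    and is determined by its trace; this distinctness recovers the missing unit in [r'.+1]. *)
Let critical_equal : #|A| = k -> L = l.-1 -> r'.+1 * #|E| <= Lm * #|V|.
Proof.
move=> cA eL; have [par [sg [ix bt rlv]]] := bent_indexing treeT size_T not_star l3.
apply: (@leq_trans (\sum_(v in ~: A) minn l.-1 (2 * #|inc E v|))).
  apply: (tree_free_bound bt rlv).
  - move=> h hE; have := cardO hE; have := subset_leq_card (subsetIr h A).
    by move: cA rk; slia.
  - have sub h : h \in E -> #|h :&: ~: A| = r' -> A \subset h.
      move=> hE hr; apply/setIidPl/eqP; rewrite setIC eqEcard subsetIr /=.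
      by have := cardO hE; rewrite hr cA; move: rk; slia.
    move=> h h' hE h'E hr eh; have hr' : #|h' :&: ~: A| = r' by rewrite -eh.
    rewrite -(setID h A) -(setID h' A) !setDE eh.
    by rewrite (setIidPr (sub h hE hr)) (setIidPr (sub h' h'E hr')).
  - move=> g phi /(wembS sEH (subxx _)) we.
    apply: (no_wemb_avoiding ix we (subxx A) cA) => i /(wemb_in we).
    by rewrite inE.
  - right; split; first by move=> v; rewrite inE -eL; apply: degE.
    by move: r'L; rewrite eL; slia.
apply: (@leq_trans (\sum_(v in ~: A) Lm)).
  by apply: leq_sum => v _; apply: leq_trans (geq_minl _ _) (leq_maxl _ _).
by rewrite sum_nat_const mulnC leq_mul2l max_card orbT.
Qed.

(** With [t = 0] every hyperedge is heavy. If [a = L], a core contradicts the degree bound;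
    otherwise [a = l.-1] and a core holds the whole tree outside [A], leaving all of [A] for the
    centres. *)
Let critical_unequal : #|A| = k -> L != l.-1 -> r'.+1 * #|E| <= Lm * #|V|.
Proof.
move=> cA nL; rewrite leqNgt; apply/negP=> big.
pose a := minn l.-1 L.
have aL : a <= L := geq_minr _ _.
have ineq := weight_ineq_exact l3 L0 r'L nL (erefl Lm) (erefl a).
have [||||X [Y [f [v0 [mu [rc _]]]]]] :=
    @dense_core V A L Lm r'.+1 r' a 0 _ aL (leq_maxr _ _) _ _ ineq E _ big.
- by rewrite /a; move: L0 l3; slia.
- by move: r'L; slia.
- by move: r'L; slia.
- split=> //; move=> h hE; have := cardO hE; have := subset_leq_card (subsetIr h A).
  by move: cA rk; slia.
have [[sX sY _] [v0X _] hdeg _ _] := rc.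
have [lea|gta] := leqP L a.
  have := hdeg v0 v0X; rewrite ltnNge; case/negP.
  have v0A : v0 \notin A by have := subsetP sX _ v0X; rewrite inE.
  apply: leq_trans (leq_trans (degE v0A) lea); apply: subset_leq_card; exact: incS.
have [par [sg ix]] := some_indexing treeT size_T not_star l3.
have [|g [phi we]] := core_wemb l0 (ix_itree ix) rc.
  by move: gta; rewrite /a; slia.
apply: (no_wemb_avoiding ix (wembS sEH (subxx _) we) (subxx A) cA) => i /(wemb_in we).
by rewrite inE.
Qed.

(** [t <= q] leaves [k] vertices of [A] outside [B] for the centres. [t <= k] ensures that a
    hyperedge with fewer than [t] vertices in [A] has at least [r'.+1] outside. If [a < L], then
    [a.+1] is the branch size [maxn 2 (l - t - 1)] allowed by [branch_order]. *)
Let excess q : #|A| = k + q -> 0 < q <= l - 2 ->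
  r'.+1 * #|E| <= Lm * #|V| + r'.+1 * (2 ^ #|A| * (l.+1 * L.+1)).
Proof.
move=> cA hq; rewrite leqNgt; apply/negP=> big.
pose t := minn q k; pose a := minn (maxn 1 (l - t - 2)) L.
have aL : a <= L := geq_minr _ _.
have rl' : l * (l - 2) <= r' + k by rewrite rk.
have [ineq jo] := weight_ineq_excess k0 l3 L0 r'L rl' hq (erefl Lm) (erefl t) (erefl a).
have [|par [sg [top [t' [ix t't br brs]]]]] := branch_order treeT size_T l3 (t := t).
  by rewrite /t; move: hq k0; slia.
have [|||B [sBA cB core]] := @dense_core_robust V A L Lm r'.+1 (r' - q) a t' _ aL
    (leq_maxr _ _) _ jo ineq E (l.+1 * L.+1) _ big.
- by rewrite /a; move: L0; slia.
- by move: r'L; slia.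
- split=> //; move=> h hE; have := cardO hE; have := subset_leq_card (subsetIr h A).
    by move: cA rk; slia.
  by move: t't rk; rewrite /t; slia.
have [lea|gta] := leqP L a.
  have [|X [Y [f [v0 [mu [[[sX sY _] [v0X _] hdeg _ _] _]]]]]] := core set0.
    by rewrite cards0.
  have := hdeg v0 v0X; rewrite ltnNge; case/negP.
  have v0A : v0 \notin A by have := subsetP sX _ v0X; rewrite inE.
  apply: leq_trans (leq_trans (degE v0A) lea); apply: subset_leq_card; apply: incS.
  exact: subset_trans sY (subsetDl _ _).
have [||g [phi [we gB]]] := branch_wemb (ix_itree ix) _ br _ degE sBA cB core.
- by move: t't hq; rewrite /t; slia.
- by move=> b; apply: leq_trans (brs b) _; move: gta; rewrite /a; slia.
have [||K _ /andP[sK /eqP cK]] := sub_of_card (n := k) (sub0set (A :\: B)) _.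
- by rewrite cards0.
- by apply: leq_trans (leq_cardsD _ _); rewrite cA cB; move: t't; rewrite /t; slia.
apply: (no_wemb_avoiding ix (wembS sEH (subxx _) we) (subset_trans sK (subsetDl _ _)) cK).
move=> i /gB h; apply/negP=> /(subsetP sK); rewrite inE => /andP[nB iA].
by case: h => [iB|]; [rewrite iB in nB|rewrite iA].
Qed.

Lemma light_bound : #|A| < k + l.-1 ->
  r'.+1 * #|E| <= Lm * #|V| + r'.+1 * (2 ^ (k + l) * (l.+1 * L.+1)).
Proof.
move=> cA; have [lt|ge] := ltnP #|A| k.
  by apply: leq_trans (few_heavy lt) (leq_addr _ _).
case: (eqVneq #|A| k) => [eA|nA].
  case: (eqVneq L l.-1) => [eL|nL].
    by apply: leq_trans (critical_equal eA eL) (leq_addr _ _).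
  by apply: leq_trans (critical_unequal eA nL) (leq_addr _ _).
have cA' : #|A| = k + (#|A| - k) by rewrite subnKC.
apply: leq_trans (excess cA' _) _; first by move: cA nA ge; slia.
rewrite leq_add2l leq_mul2l leq_mul2r leq_pexp2l ?orbT //.
by apply: leq_trans (ltnW cA) _; rewrite leq_add2l leq_pred.
Qed.
End Light.

Lemma host_bound : r'.+1 * #|H| <= Lm * #|V| + r'.+1 *
  ((l * r * (D0 * r) + k * (D0 * r * (D0 * r))) * D0 + 2 ^ (k + l) * (l.+1 * L.+1)).
Proof.
set M := l * r * _ + _; set c := 2 ^ _ * _.
have [cA|cA] := leqP (k + l.-1) #|A|.
  by apply: leq_trans (many_heavy cA) (leq_addr _ _).
pose Q := [set v in ~: A | l2 <= #|inc H v|].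
have [cQ|cQ] := ltnP M #|Q|.
  by apply: leq_trans (many_medium cA cQ) (leq_addr _ _).
pose R := \bigcup_(v in Q) inc H v.
have cR : #|R| <= M * D0.
  apply: (@leq_trans (#|Q| * D0)); last by rewrite leq_mul2r cQ orbT.
  by apply: card_bigcup_le => v; rewrite !inE => /andP[+ _]; rewrite -leqNgt.
have cH : #|H| <= M * D0 + #|H :\: R|.
  by have := leq_cardsD H R; move: cR; slia.
have := light_bound (subsetDl H R) _ cA; move=> /(_ _) lb.
have {}lb : r'.+1 * #|H :\: R| <= Lm * #|V| + r'.+1 * c.
  apply: lb => v vA; case: (boolP (v \in Q)) => [vQ|].
    rewrite (_ : inc _ v = set0) ?cards0 //; apply/setP=> h; rewrite !inE.
    apply/negP=> /andP[/andP[/negP nR hH] vh]; apply: nR.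
    by apply/bigcupP; exists v => //; rewrite mem_inc hH.
  rewrite inE in_setC vA /= -ltnNge => lt.
  apply: (@leq_trans #|inc H v|); first by apply/subset_leq_card/incS/subsetDl.
  by rewrite /L; move: lt; slia.
apply: (@leq_trans (r'.+1 * (M * D0 + #|H :\: R|))); first by rewrite leq_mul2l cH orbT.
by rewrite !mulnDr addnCA leq_add2l.
Qed.
End Host.

Lemma berge_upper_bound : exists C : nat, forall (V : finType) (H : {set {set V}}),
  (forall h, h \in H -> #|h| = r) ->
  ~~ contains_berge (dunion T (copies k (star l2))) H ->
  (r - k).+1 * #|H| <= maxn l.-1 l2.-1 * #|V| + C.
(* The constant of [host_bound] mentions neither [V] nor [H], so it can be fixed before them. *)
Proof. by eexists=> V H unif free; apply: host_bound unif free. Qed.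
End UpperBound.

(** * The lower bound *)

Section Blocks.
Variables (V : finType) (A : {set V}) (m b c : nat) (x : 'I_m * 'I_b -> V).
Hypothesis x_inj : injective x.
Hypothesis xA : forall p, x p \notin A.
Hypothesis b2 : 1 < b.
Hypothesis cb : c <= b.

Definition block (i : 'I_m) : {set V} := [set x (i, j) | j in [set: 'I_b]].

Definition block_edge (p : 'I_m * 'I_c) : {set V} :=
  A :|: [set x (p.1, j) | j in [set~ widen_ord cb p.2]].

Definition block_graph : {set {set V}} := [set block_edge p | p in [set: 'I_m * 'I_c]].

Lemma mem_block_edge i j j' : (x (i, j') \in block_edge (i, j)) = (j' != widen_ord cb j).
Proof.
rewrite !inE (negbTE (xA _)) /=; apply/imsetP/idP => [[j'' + [E]]|ne].
  by move/x_inj: E => [->]; rewrite !inE.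
by exists j'; rewrite ?inE.
Qed.

Lemma block_edge_notA p v : v \in block_edge p -> v \notin A -> v \in block p.1.
Proof.
rewrite inE => /orP[->//|/imsetP[j _ ->] _].
by apply/imsetP; exists j.
Qed.

Lemma block_disjoint i i' v : v \in block i -> v \in block i' -> i = i'.
Proof. by move=> /imsetP[j _ ->] /imsetP[j' _ /x_inj[]]. Qed.

(** A remaining point, available because [1 < b], reveals the block, and the missing point reveals
    the second index. *)
Lemma block_edge_inj : injective block_edge.
Proof.
move=> [i j] [i' j'] E.
have [j'' nj] : exists j'' : 'I_b, j'' != widen_ord cb j.
  have [|j'' _ nj] := @pick_notin _ [set: 'I_b] [set widen_ord cb j].
    by rewrite cards1 cardsT card_ord.
  by exists j''; rewrite inE in nj.
have Ei : i = i'.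
  have : x (i, j'') \in block_edge (i, j) by rewrite mem_block_edge.
  rewrite E => /block_edge_notA/(_ (xA _)) h; apply: (block_disjoint _ h).
  by apply/imsetP; exists j''.
subst i'; congr (_, _); apply/val_inj.
have := mem_block_edge i j (widen_ord cb j); rewrite E mem_block_edge eqxx.
by move/negbFE/eqP/(congr1 val).
Qed.

Lemma card_block_graph : #|block_graph| = m * c.
Proof. by rewrite card_imset ?cardsT ?card_prod ?card_ord //; apply: block_edge_inj. Qed.

Lemma block_graph_uniform r : r = #|A| + b.-1 -> uniform r block_graph.
Proof.
move=> ->; apply/forall_inP=> h /imsetP[[i j] _ ->]; apply/eqP.
rewrite cardsU (_ : A :&: _ = set0) ?cards0 ?subn0; last first.
  apply/setP=> v; rewrite !inE; apply/negP=> /andP[vA /imsetP[j' _ E]].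
  by have := xA (i, j'); rewrite -E vA.
congr (_ + _); rewrite card_imset => [|j1 j2 /x_inj[]//].
by rewrite cardsC1 card_ord.
Qed.

(* A connected graph placed outside [A] stays inside one block, and each block
   only carries [c] hyperedges. *)
Lemma block_graph_component (G : sgraph) (f : G -> V) (phi : {set G} -> {set V}) :
  (forall u v : G, connect (@sadj G) u v) -> c < #|sedges G| ->
  {in sedges G &, injective phi} -> (forall e, e \in sedges G -> phi e \in block_graph) ->
  (forall e, e \in sedges G -> f @: e \subset phi e) -> exists u, f u \in A.
Proof.
move=> conn ce phi_inj phiH fphi; case: (boolP [exists u, f u \in A]) => [/existsP//|/existsPn fA]; exfalso.
have edge u v : sadj u v -> [set u; v] \in sedges G.
  by move=> uv; apply/imset2P; exists u v; rewrite ?inE.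
have inb u v : sadj u v -> exists p, [/\ phi [set u; v] = block_edge p,
    f u \in block p.1 & f v \in block p.1].
  move=> uv; have eG := edge u v uv; have /imsetP[p _ E] := phiH _ eG; exists p.
  have /subsetP s := fphi _ eG; rewrite E in s; split=> //.
    by apply: block_edge_notA (s _ _) (fA _); apply/imset_f/set21.
  by apply: block_edge_notA (s _ _) (fA _); apply/imset_f/set22.
have [e0 /imset2P[u0 v0 _ +]] : exists e, e \in sedges G.
  by apply/card_gt0P; apply: leq_ltn_trans ce.
rewrite inE => /andP[_ uv0] _.
have [[i0 j0] [_ /= ui0 _]] := inb _ _ uv0.
have all_i0 u : f u \in block i0.
  have cl : closed (@sadj G) [pred u | f u \in block i0].
    move=> u1 v1 uv1; have [p [_ fu fv]] := inb _ _ uv1; rewrite !inE.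
    apply/idP/idP=> [fi|fi].
      by rewrite -(block_disjoint fu fi).
    by rewrite -(block_disjoint fv fi).
  by have := closed_connect cl (conn u0 u); rewrite !inE ui0 => <-.
have sub : phi @: sedges G \subset [set block_edge (i0, j) | j in [set: 'I_c]].
  apply/subsetP=> h /imsetP[e /imset2P[u v _ +] ->].
  rewrite inE => /andP[_ uv] ->; have [[i j] [-> /= fu _]] := inb _ _ uv.
  by apply/imsetP; exists j; rewrite ?inE ?(block_disjoint fu (all_i0 u)).
have := leq_trans (subset_leq_card sub) (leq_imset_card _ _).
by rewrite card_in_imset // cardsT card_ord leqNgt ce.
Qed.
End Blocks.

Lemma star_connect m (u v : star m) : connect (@sadj (star m)) u v.
Proof.
have to_c (w : star m) : connect (@sadj (star m)) w None.
  by case: w => [i|]; [apply: connect1|apply: connect0].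
have sym : connect_sym (@sadj (star m)) by apply: sym_connect_sym; apply: sadj_sym.
by apply: connect_trans (to_c u) _; rewrite sym.
Qed.

Lemma card_sedges_star m : m <= #|sedges (star m)|.
Proof.
rewrite -{1}(card_ord m) -cardsT.
pose e (i : 'I_m) : {set star m} := [set None; Some i].
rewrite -(card_imset (f := e)) => [|i j /setP/(_ (Some i))]; last first.
  by rewrite !inE eqxx /= => /esym/eqP[].
apply/subset_leq_card/subsetP=> s /imsetP[i _ ->].
by apply/imset2P; exists (None : star m) (Some i : star m); rewrite ?inE.
Qed.

Lemma sedges_imset (G F : sgraph) (io : G -> F) (e : {set G}) :
  (forall u v, sadj u v -> sadj (io u) (io v)) ->
  e \in sedges G -> io @: e \in sedges F.
Proof.
move=> hio /imset2P[u v _ +] ->; rewrite inE => /andP[_ uv].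
rewrite imsetU1 imset_set1; apply/imset2P; exists (io u) (io v); rewrite ?inE //.
exact: hio.
Qed.

Lemma block_graph_free (T : sgraph) (V : finType) (A : {set V}) m b c k l2
    (x : 'I_m * 'I_b -> V) (cb : c <= b) :
  injective x -> (forall p, x p \notin A) -> 1 < b -> #|A| = k ->
  connected T -> c < #|sedges T| -> c < l2 ->
  ~~ contains_berge (dunion T (copies k (star l2))) (block_graph A x cb).
Proof.
move=> x_inj xA b2 cA [_ conT] cT cl2; set F := dunion _ _; set H := block_graph _ _ _.
apply/negP=> /existsP[H' /andP[sH' /existsP[f /existsP[phi /and4P[/injectiveP fi phi_i /eqP im /forall_inP fphi]]]]].
have phiH e : e \in sedges F -> phi e \in H.
  by move=> eF; apply: (subsetP sH'); rewrite -im imset_f.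
have comp (G : sgraph) (io : G -> F) : injective io -> (forall u v, sadj u v -> sadj (io u) (io v)) ->
    (forall u v : G, connect (@sadj G) u v) -> c < #|sedges G| -> exists u, f (io u) \in A.
  move=> ioi hio conG cG.
  apply: (block_graph_component (f := f \o io) (phi := fun e => phi (io @: e)) x_inj conG cG).
  - move=> e e' eG e'G E; apply: (imset_inj ioi).
    by apply: (dinjectiveP _ _ phi_i) E; apply: sedges_imset.
  - by move=> e eG; apply: phiH; apply: sedges_imset.
  - by move=> e eG; rewrite imset_comp; apply: fphi; apply: sedges_imset.
(* [lab] reads off the component of a vertex, so picking one vertex per component is automatically
   injective. *)
pose lab (u : F) : option 'I_k := match u with inl _ => None | inr p => Some p.1 end.
have [w hw] : exists w : option 'I_k -> F, forall o, lab (w o) = o /\ f (w o) \in A.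
  apply: (fin_all_exists (P := fun o (u : F) => lab u = o /\ f u \in A)) => -[i|].
    have [||||u fu] := comp (star l2) (fun u => inr (i, u) : F).
    - by move=> u v [].
    - by move=> u v uv; rewrite /= /dunion_adj /= /copies_adj /= eqxx.
    - exact: star_connect.
    - exact: leq_trans cl2 (card_sedges_star _).
    by exists (inr (i, u)).
  have [||||u fu] := comp T (fun u => inl u : F) => //; first by move=> u v [].
  by exists (inl u).
have wi : injective w by move=> o o' E; rewrite -(hw o).1 -(hw o').1 E.
have sub : [set f (w o) | o in [set: option 'I_k]] \subset A.
  by apply/subsetP=> v /imsetP[o _ ->]; apply: (hw o).2.
have := subset_leq_card sub; rewrite card_imset; last by move=> o o' /fi/wi.
by rewrite cardsT card_option card_ord cA ltnn.
Qed.

Lemma berge_lower_bound (T : sgraph) k l2 r n c : connected T ->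
  c < #|sedges T| -> c < l2 -> k < r -> c <= (r - k).+1 -> k <= n ->
  c * ((n - k) %/ (r - k).+1) <= ex_berge r n (dunion T (copies k (star l2))).
Proof.
move=> conT cT cl2 kr cb kn; set b := (r - k).+1 in cb *; set m := _ %/ _.
have bnd (p : 'I_m * 'I_b) : k + (p.1 * b + p.2) < n.
  have h1 : p.1 * b + p.2 < m * b.
    by have := ltn_ord p.1; have := ltn_ord p.2; move: (nat_of_ord p.1) (nat_of_ord p.2); clear; nia.
  have := leq_trunc_div (n - k) b; rewrite -/m; move: h1 kn; slia.
pose x p := Ordinal (bnd p).
pose A := [set widen_ord kn i | i in [set: 'I_k]].
have x_inj : injective x.
  move=> [i j] [i' j'] /(congr1 val) /= /addnI E.
  have jb := ltn_ord j; have jb' := ltn_ord j'.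
  have Ei : nat_of_ord i = i'.
    by have := congr1 (divn^~ b) E; rewrite !divnMDl // !divn_small // !addn0.
  have Ej : nat_of_ord j = j' by move: E; rewrite Ei => /addnI.
  by congr (_, _); apply: val_inj.
have xA p : x p \notin A.
  apply/negP=> /imsetP[i _ /(congr1 val) /= E]; have := ltn_ord i; rewrite -E; slia.
have cA : #|A| = k.
  by rewrite card_imset ?cardsT ?card_ord // => i j /(congr1 val) E; apply: val_inj.
have b2 : 1 < b by rewrite /b; move: kr; slia.
rewrite mulnC -(card_block_graph x_inj xA b2 cb).
apply: (leq_bigmax_cond (F := fun H : {set {set 'I_n}} => #|H|)).
rewrite block_graph_free // andbT; apply: block_graph_uniform => //.
by rewrite cA /b /=; move: kr; slia.
Qed.

Theorem theorem2p6 (k l1 l2 r : nat) (T : sgraph)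
  (hk : 2 <= k) (hl1 : 3 <= l1) (hl2 : 2 <= l2)
  (hr : maxn (l1 * (l1 - 2)) (l1 + l2 + k - 1) <= r)
  (hT : is_tree T) (hTe : #|sedges T| = l1)
  (hTs : ~ isomorphic T (star l1)) :
  exists (C : rat) (N : nat), forall n : nat, N <= n ->
    (minn l1 l2 - 1) * ((n - k + 1) %/ (r - k + 2))
      <= ex_berge r n (dunion T (copies (k - 1) (star l2)))
    /\ ((ex_berge r n (dunion T (copies (k - 1) (star l2))))%:R
         <= (maxn l1 l2 - 1)%:R * n%:R / (r - k + 2)%:R + C)%R.
Proof.
move: hr; rewrite geq_max => /andP[hr1 hr2].
have k0 : 0 < k - 1 by rewrite subn_gt0.
have rs : l1 + l2 + (k - 1) <= r by move: hr2 hk; slia.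
have [C hC] := berge_upper_bound k0 hl1 hl2 hr1 rs hT hTe hTs.
have eb : r - k + 2 = (r - (k - 1)).+1 by move: hk rs; slia.
have eL : maxn l1 l2 - 1 = maxn l1.-1 l2.-1 by slia.
(* The integer constant bounds the error after multiplication by the denominator, hence the
   quotient. The threshold [k] for [n] makes the truncated [n - k + 1] equal to [n - (k - 1)]. *)
rewrite eb eL; exists (C%:R / (r - (k - 1)).+1%:R)%R, k => n kn; split.
  have -> : n - k + 1 = n - (k - 1) by move: kn hk; slia.
  apply: berge_lower_bound; rewrite ?hTe; first by case: hT.
  - by move: hl1; slia.
  - by move: hl2; slia.
  - by move: rs hl1; slia.
  - by move: rs; slia.
  - by move: kn; slia.
rewrite -mulrDl ler_pdivlMr ?ltr0n // -!natrM -natrD ler_nat mulnC.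
rewrite /ex_berge; elim/big_ind: _ => [|m1 m2 h1 h2|H /andP[/forall_inP unif free]].
- by rewrite muln0.
- by rewrite maxnMr geq_max h1.
by have := hC _ H (fun h hH => eqP (unif h hH)) free; rewrite card_ord.
Qed.
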